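(* Let $(M,g)$ be a compact Kähler manifold without boundary. For every $A>0$ there is a constant $C$, depending only on $A$ and the background metric $g$, such that for every smooth solution $(\varphi,F)$ of the cscK system on $(M,g)$ with $\|\varphi\|_0\le A$, one has $$\frac{|\nabla\varphi|^2}{e^F}\le C\quad\text{on }M.$$
   Context: Let $n=\dim_{\mathbb C}M$ and let $\omega_0=\sqrt{-1}\,g_{\alpha\bar\beta}\,dz_\alpha\wedge d\bar z_\beta$ be the Kähler form of $g$. A smooth solution of the cscK system is a pair of smooth real functions $(\varphi,F)$ on $M$ such that $\omega_\varphi=\omega_0+\sqrt{-1}\,\partial\bar\partial\varphi>0$ and $$\log\det(g_{\alpha\bar\beta}+\varphi_{\alpha\bar\beta})=F+\log\det(g_{\alpha\bar\beta}),\qquad \Delta_\varphi F=-\underline R+tr_\varphi Ric_g .$$ Here $\varphi_{\alpha\bar\beta}=\partial_\alpha\partial_{\bar\beta}\varphi$, $\Delta_\varphi=g_\varphi^{\alpha\bar\beta}\partial_\alpha\partial_{\bar\beta}$ is the Laplacian of $\omega_\varphi$ (with $g_\varphi=(g_{\alpha\bar\beta}+\varphi_{\alpha\bar\beta})$), $tr_\varphi$ is the trace with respect to $\omega_\varphi$, $Ric_g=-\sqrt{-1}\,\partial\bar\partial\log\det g$ is the Ricci form of $g$, and $\underline R$ is the average scalar curvature (average over $M$ of $g^{\alpha\bar\beta}R_{\alpha\bar\beta}$). Equivalently, $e^F=\omega_\varphi^n/\omega_0^n$ and $\omega_\varphi$ has constant scalar curvature $\underline R$. $\|\cdot\|_0$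 is the sup norm on $M$ and $|\nabla\varphi|^2=g^{\alpha\bar\beta}\varphi_\alpha\varphi_{\bar\beta}$. *)

(* Defs.v *)
From HB Require Import structures.
From mathcomp Require Import all_boot all_order all_algebra.
From mathcomp Require Import complex.
From mathcomp Require Import all_classical all_reals all_analysis.

Set Implicit Arguments.
Unset Strict Implicit.
Unset Printing Implicit Defensive.

Import Order.TTheory GRing.Theory Num.Theory.
Import numFieldNormedType.Exports.

Local Open Scope classical_set_scope.
Local Open Scope ring_scope.
Local Open Scope complex_scope.

(* The point (x_1, ..., x_n, y_1, ..., y_n) of 'rV[R]_(n + n) represents
   (x_1 + i y_1, ..., x_n + i y_n) in C^n. *)
Notation coords R n := ('rV[R]_(n + n)).

Section LocalCalculus.
Context {R : realType} {n : nat}.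
Implicit Types (U : set (coords R n)) (f : coords R n -> R)
  (h : coords R n -> R[i]) (z : coords R n) (a b : 'I_n).

(* Meaningful for an open set U: the values of f outside U are irrelevant. *)
Fixpoint Ck_on (k : nat) U f : Prop :=
  (forall z, U z -> {for z, continuous f}) /\
  match k with
  | 0 => True
  | k'.+1 => forall j : 'I_(n + n),
      (forall z, U z -> derivable f z (delta_mx 0 j)) /\
      Ck_on k' U (fun z => 'D_(delta_mx 0 j) f z)
  end.

Definition smooth_on U f : Prop := forall k, Ck_on k U f.

Definition csmooth_on U h : Prop :=
  smooth_on U (fun z => complex.Re (h z)) /\
  smooth_on U (fun z => complex.Im (h z)).

Definition cpartial (j : 'I_(n + n)) h z : R[i] :=
  'D_(delta_mx 0 j) (fun w => complex.Re (h w)) z +i*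
  'D_(delta_mx 0 j) (fun w => complex.Im (h w)) z.

Definition dz a h z : R[i] :=
  2%:R^-1 * (cpartial (lshift n a) h z - 'i%C * cpartial (rshift n a) h z).

Definition dzbar a h z : R[i] :=
  2%:R^-1 * (cpartial (lshift n a) h z + 'i%C * cpartial (rshift n a) h z).

Definition zcoord a z : R[i] := z 0 (lshift n a) +i* z 0 (rshift n a).

Definition holomorphic_on U (t : coords R n -> coords R n) : Prop :=
  forall a, csmooth_on U (fun z => zcoord a (t z)) /\
    forall b z, U z -> dzbar b (fun w => zcoord a (t w)) z = 0.

Definition complex_jacobian (t : coords R n -> coords R n) z : 'M[R[i]]_n :=
  \matrix_(a, b) dz b (fun w => zcoord a (t w)) z.

(* f_(a bbar) *)
Definition complex_hessian f z : 'M[R[i]]_n :=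
  \matrix_(a, b) dz a (fun w => dzbar b (fun u => (f u)%:C) w) z.

(* A Hermitian form is represented by the matrix G a b = g_(a bbar). *)
Definition hermitian_posdef (G : 'M[R[i]]_n) : Prop :=
  (forall a b, G b a = (G a b)^*%C) /\
  forall v : 'rV[R[i]]_n, v != 0 ->
    0 < \sum_(a < n) \sum_(b < n) G a b * v 0 a * (v 0 b)^*%C.

(* Since sum_b g_(a bbar) g^(c bbar) = delta_(a c), the coefficient
   g^(a bbar) is the entry (b, a) of the inverse matrix of G. *)
Definition ginv (G : 'M[R[i]]_n) a b : R[i] := invmx G b a.

Definition trace_wrt (G S : 'M[R[i]]_n) : R[i] :=
  \sum_(a < n) \sum_(b < n) ginv G a b * S a b.

Definition log_det (G : 'M[R[i]]_n) : R := ln (complex.Re (\det G)).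

End LocalCalculus.

(* The Lebesgue integral over R^k, computed by iterated integration. *)
Fixpoint lebesgue_iint (R : realType) (k : nat) : ('rV[R]_k -> \bar R) -> \bar R :=
  match k with
  | 0 => fun f => f 0
  | k'.+1 => fun f =>
      (\int[@lebesgue_measure R]_(x in setT)
         lebesgue_iint (fun v : 'rV[R]_k' =>
           f (row_mx (x%:M : 'rV[R]_1) v : 'rV[R]_(1 + k'))))%E
  end.

Record chart (R : realType) (n : nat) (M : topologicalType) := Chart {
  chart_dom : set M;
  chart_cod : set (coords R n);
  chart_map : M -> coords R n;
  chart_inv : coords R n -> M;
  chart_dom_open : open chart_dom;
  chart_cod_open : open chart_cod;
  chart_mapP : forall p, chart_dom p -> chart_cod (chart_map p);
  chart_invP : forall z, chart_cod z -> chart_dom (chart_inv z);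
  chart_mapK : forall p, chart_dom p -> chart_inv (chart_map p) = p;
  chart_invK : forall z, chart_cod z -> chart_map (chart_inv z) = z;
  chart_map_continuous : {within chart_dom, continuous chart_map};
  chart_inv_continuous : {within chart_cod, continuous chart_inv} }.

Definition transition_dom (R : realType) (n : nat) (M : topologicalType)
    (c d : chart R n M) : set (coords R n) :=
  [set z | chart_cod c z /\ chart_dom d (chart_inv c z)].

Definition transition (R : realType) (n : nat) (M : topologicalType)
    (c d : chart R n M) (z : coords R n) : coords R n :=
  chart_map d (chart_inv c z).

Record complex_atlas (R : realType) (n : nat) (M : topologicalType) := ComplexAtlas {
  chart_index : Type;
  chart_at :> chart_index -> chart R n M;
  chart_cover : forall p, exists i, chart_dom (chart_at i) p;
  transition_holomorphic : forall i j,
    holomorphic_on (transition_dom (chart_at i) (chart_at j))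
                   (transition (chart_at i) (chart_at j)) }.

Section KahlerGeometry.
Context {R : realType} {n : nat} {M : topologicalType}.
Variable X : complex_atlas R n M.

(* kmetric i z is the matrix of the g_(a bbar) in the chart i at the point of
   coordinates z.  The last two fields are the coefficients of the equations
   d' omega_0 = 0 and d'' omega_0 = 0, i.e. of d omega_0 = 0. *)
Record kahler_metric := KahlerMetric {
  kmetric : chart_index X -> coords R n -> 'M[R[i]]_n;
  kmetric_smooth : forall i a b,
    csmooth_on (chart_cod (X i)) (fun z => kmetric i z a b);
  kmetric_posdef : forall i z, chart_cod (X i) z -> hermitian_posdef (kmetric i z);
  kmetric_tensor : forall i j z, transition_dom (X i) (X j) z ->
    let t := transition (X i) (X j) in
    let J := complex_jacobian t z in
    forall a b, kmetric i z a b =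
      \sum_(c < n) \sum_(d < n) J c a * (J d b)^*%C * kmetric j (t z) c d;
  kmetric_closed : forall i z, chart_cod (X i) z -> forall a b c,
    dz c (fun w => kmetric i w a b) z = dz a (fun w => kmetric i w c b) z;
  kmetric_closed_bar : forall i z, chart_cod (X i) z -> forall a b c,
    dzbar c (fun w => kmetric i w a b) z = dzbar b (fun w => kmetric i w a c) z }.

Definition local_expr (f : M -> R) (i : chart_index X) : coords R n -> R :=
  fun z => f (chart_inv (X i) z).

Definition smooth_fun (f : M -> R) : Prop :=
  forall i, smooth_on (chart_cod (X i)) (local_expr f i).

Definition sup_norm (f : M -> R) : R := sup (range (fun p => `|f p|)).

Variable g : kahler_metric.

Definition ricci i z : 'M[R[i]]_n :=
  - complex_hessian (fun w => log_det (kmetric g i w)) z.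

Definition scalar_curvature i z : R :=
  complex.Re (trace_wrt (kmetric g i z) (ricci i z)).

(* In a chart, omega_0^n / n! is 2^n det(g) times the Lebesgue measure; the
   factor 2^n is dropped, as it cancels in the average below. *)
Definition volume_density i z : R := complex.Re (\det (kmetric g i z)).

Definition covering_charts (s : seq (chart_index X)) : Prop :=
  forall p, exists k i, onth s k = Some i /\ chart_dom (X i) p.

(* The integral over the complement of D in the union of the domains of the
   charts in s, cut into the disjoint pieces contributed successively by each
   chart.  The integrand is given by its expressions h i in the charts i. *)
Fixpoint chartwise_integral (D : set M) (s : seq (chart_index X))
    (h : chart_index X -> coords R n -> R) : \bar R :=
  match s with
  | [::] => 0%E
  | i :: s' =>
      (lebesgue_iint (patch (fun=> 0)
          [set z | chart_cod (X i) z /\ ~ D (chart_inv (X i) z)]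
          (fun z => (h i z * volume_density i z)%:E)) +
       chartwise_integral (D `|` chart_dom (X i)) s' h)%E
  end.

(* A finite covering family of charts exists on a compact manifold, and the
   integral does not depend on which one is chosen. *)
Definition manifold_integral (h : chart_index X -> coords R n -> R) : R :=
  fine (chartwise_integral set0
    (xget ([::] : {classic seq (chart_index X)}) covering_charts) h).

Definition average_scalar_curvature : R :=
  manifold_integral scalar_curvature / manifold_integral (fun _ _ => 1).

(* The matrix of g_(a bbar) + phi_(a bbar), i.e. of omega_phi. *)
Definition deformed_metric (phi : M -> R) i z : 'M[R[i]]_n :=
  kmetric g i z + complex_hessian (local_expr phi i) z.

Record csck_solution (phi F : M -> R) : Prop := CsckSolution {
  csck_phi_smooth : smooth_fun phi;
  csck_F_smooth : smooth_fun F;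
  csck_posdef : forall i z, chart_cod (X i) z ->
    hermitian_posdef (deformed_metric phi i z);
  csck_volume : forall i z, chart_cod (X i) z ->
    log_det (deformed_metric phi i z) = local_expr F i z + log_det (kmetric g i z);
  csck_laplacian : forall i z, chart_cod (X i) z ->
    trace_wrt (deformed_metric phi i z) (complex_hessian (local_expr F i) z) =
    - average_scalar_curvature%:C + trace_wrt (deformed_metric phi i z) (ricci i z) }.

(* |grad f|^2 = g^(a bbar) f_a f_bbar, computed in the chart i. *)
Definition grad_sqnorm (f : M -> R) i z : R :=
  let fC := fun w => (local_expr f i w)%:C in
  complex.Re (\sum_(a < n) \sum_(b < n)
    ginv (kmetric g i z) a b * dz a fC z * dzbar b fC z).

End KahlerGeometry.

(* Main.v *)
Require Import Defs.
From HB Require Import structures.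
From mathcomp Require Import all_boot all_order all_algebra.
From mathcomp Require Import complex.
From mathcomp Require Import all_classical all_reals all_analysis.
From mathcomp Require Import ring lra.

Set Implicit Arguments.
Unset Strict Implicit.
Unset Printing Implicit Defensive.

Import Order.TTheory GRing.Theory Num.Theory.
Import numFieldNormedType.Exports.

Local Open Scope classical_set_scope.
Local Open Scope ring_scope.

(** The theorem follows from the maximum principle applied to
    u = exp (A) (|grad phi|^2 + 2) with A = - F - lam phi + phi^2 / 2, where lam
    is large compared with the bound on phi and with the curvature of g.

    Let p0 be a maximum of u.  The Laplacian of u for omega_phi is nonpositive
    at p0, and it is computed as follows.  The Laplacian of |grad phi|^2 contains
    the trace of the third derivatives of phi; by the volume equation, once
    differentiated, this trace is dF plus derivatives of g, and since A contains
    - F, all derivatives of F cancel ([trace_holomorphic_part]).  The Laplacian of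
    - F itself is given by the second equation and is bounded by multiples of
    T = tr_phi g.  The term - lam phi contributes lam (T - n), which absorbs the
    Ricci form and the curvature of g, and phi^2 / 2 contributes
    D = |d phi|^2 for omega_phi.  Hence T + D / 2 is bounded at p0
    ([gradient_real_arithmetic]).  If mu_i are the eigenvalues of omega_phi with
    respect to omega_0, then T is the sum of the 1 / mu_i and e^F their product;
    so bounds on T and D bound (|grad phi|^2 + 2) / e^F at p0
    ([volume_product_bound]), hence u at p0, hence u everywhere.

    To differentiate |grad phi|^2 without differentiating the inverse of g and
    without normal coordinates, one replaces it by a function that touches it
    from below.  For any scalar h and any vector s,
    2 Re (h phi_a s^a) <= |h|^2 |grad phi|^2 + |s|^2 ([dual_inequality]), so
    Psi = 2 Re (h phi_a s^a) - |s|^2 + |h|^2 (2 - m e^(-A)), with m = u (p0), is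
    nonpositive, and it vanishes at p0 if h (p0) = 1 and s (p0) is the gradient of
    phi.  Taking h and s holomorphic, affine in the coordinates, with dh = dA and
    s parallel to first order at p0, makes the complex Hessian of Psi at p0
    explicit ([test_function_inequality]): the second derivatives phi_(ka) do not
    appear in it, and the terms in dA complete a square.

    The analysis needed is elementary: the mean value theorem gives
    differentiability from continuous partial derivatives, the symmetry of second
    derivatives and the second derivative test, and Hermitian forms are compared
    by simultaneous diagonalization.  Compactness of M is used for the existence
    of p0 and for a uniform bound on the geometry of g ([geometry_bounded]). *)

(** * Differentiable functions on row vectors *)

Section RealCalculus.
Context {R : realType}.

Lemma continuous_at_sum (T : topologicalType) (x : T) (I : Type) (r : seq I) (P : pred I)
    (f : I -> T -> R) : (forall i, P i -> {for x, continuous (f i)}) ->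
  {for x, continuous (fun y => \sum_(i <- r | P i) f i y)}.
Proof.
move=> fc; elim: r => [|i r IH].
  rewrite (_ : (fun y => _) = (fun=> 0)); first exact: cst_continuous.
  by apply/funext => y; rewrite big_nil.
rewrite (_ : (fun y => _) = 
  (fun y => (if P i then f i y else 0) + \sum_(i <- r | P i) f i y)).
  apply: continuousD => //; case: (P i) (fc i) => [/(_ isT)//|_].
  exact: cst_continuous.
by apply/funext => y; rewrite big_cons; case: ifP; rewrite ?add0r.
Qed.

Section Lines.
Context {V : normedModType R}.
Implicit Types (f : V -> R) (x v : V).

Lemma is_derive_line f x v (s df : R) :
  is_derive (x + s *: v) v f df -> is_derive s 1 (fun t => f (x + t *: v)) df.
Proof.
move=> [fd fv].
have E : (fun h : R => h^-1 *: (f (x + (h *: (1:R) + s) *: v) - f (x + s *: v)))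
       = (fun h : R => h^-1 *: (f (h *: v + (x + s *: v)) - f (x + s *: v))).
  apply/funext => h; congr (_ *: (f _ - _)).
  by rewrite [h *: 1]mulr1 scalerDl addrCA.
apply: DeriveDef.
  by rewrite /derivable /=; rewrite E.
by rewrite -fv /derive /= E.
Qed.

(** Allowing any sign of a spares the case distinction at each use. *)
Lemma line_MVT f x v (a : R) :
  (forall s : R, `|s| <= `|a| -> derivable f (x + s *: v) v) ->
  exists2 c : R, `|c| <= `|a| & f (x + a *: v) - f x = a * 'D_v f (x + c *: v).
Proof.
move=> fd; pose g (t : R) := f (x + t *: v).
have gd (t : R) : `|t| <= `|a| -> is_derive t 1 g ('D_v f (x + t *: v)).
  by move=> t01; apply: is_derive_line; apply: derivableP; exact: fd.
have MV (b c : R) : b < c ->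
    (forall t, b <= t <= c -> `|t| <= `|a|) -> 
    exists2 t, `|t| <= `|a| & g c - g b = 'D_v f (x + t *: v) * (c - b).
  move=> bc tbc; have [||t tin] := @MVT R g (fun t => 'D_v f (x + t *: v)) b c bc.
  - move=> t; rewrite in_itv/= => /andP[/ltW t0 /ltW t1]; apply: gd.
    by rewrite tbc // t0.
  - apply: derivable_within_continuous => t; rewrite in_itv/= => t01.
    by case: (gd t (tbc _ t01)).
  move=> ->; exists t => //; apply: tbc; move: tin.
  by rewrite in_itv/= => /andP[c0 c1]; rewrite !ltW.
have E : f x = g 0 by rewrite /g scale0r addr0.
rewrite E -/(g a); case: (ltrgtP a 0) => a0.
- have [|t ta] := MV a 0 a0.
    by move=> t /andP[ta t0]; rewrite (ler0_norm t0) (ltr0_norm a0) lerN2.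
  by rewrite sub0r => e; exists t => //; lra.
- have [|t ta] := MV 0 a a0.
    by move=> t /andP[t0 ta]; rewrite (ger0_norm t0) (gtr0_norm a0).
  by rewrite subr0 mulrC => e; exists t.
- by exists 0; rewrite ?normr0 ?normr_ge0 // a0 subrr mul0r.
Qed.

End Lines.

Section Rows.
Context {m : nat}.
Implicit Types (f : 'rV[R]_m -> R) (U : set 'rV[R]_m) (z h : 'rV[R]_m).

Lemma row_norm_le h (e : R) : 0 <= e -> (forall j, `|h 0 j| <= e) -> `|h| <= e.
Proof.
move=> e0 he; rewrite {1}/Num.norm /= mx_normrE; apply/bigmax_leP; split => //= -[i j] _ /=.
by rewrite ord1.
Qed.

Lemma row_entry_le h j : `|h 0 j| <= `|h|.
Proof. by rewrite {2}/Num.norm /= mx_normrE;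
  apply: (le_bigmax _ (fun ij => `|h ij.1 ij.2|) (0, j)). Qed.

(** One goes from z to z + h along the edges of a box, changing one coordinate at
    a time.  By the mean value theorem the error on the edge k is h_k times the
    variation of a partial derivative, which is small near z. *)
Lemma C1_differentiable f z :
  (\forall w \near z, forall j, derivable f w (delta_mx 0 j)) ->
  (forall j, {for z, continuous (fun w => 'D_(delta_mx 0 j) f w)}) ->
  differentiable f z.
Proof.
move=> fd fc.
pose L (h : 'rV[R]_m) : R := \sum_j h 0 j * 'D_(delta_mx 0 j) f z.
have linL : linear L.
  move=> a h k; rewrite /L scaler_sumr -big_split; apply: eq_bigr => j _ /=.
  by rewrite !mxE mulrDl -mulrA.
pose dlM := GRing.isLinear.Build _ _ _ _ _ linL.
pose dL : {linear 'rV[R]_m -> R} := HB.pack L dlM.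
have cL : continuous dL.
  move=> h; apply: continuous_at_sum => j _.
  by apply: continuousM; [exact: coord_continuous|exact: cst_continuous].
have fL : f \o shift z = cst (f z) + dL +o_ (0 : 'rV[R]_m) id.
  apply/eqaddoP => e e0 /=.
  have e'0 : 0 < e / (m.+1)%:R by rewrite divr_gt0.
  have : \forall w \near z, forall j, derivable f w (delta_mx 0 j) /\
     `|'D_(delta_mx 0 j) f w - 'D_(delta_mx 0 j) f z| <= e / (m.+1)%:R.
    have : \forall w \near z, forall j, 
      `|'D_(delta_mx 0 j) f w - 'D_(delta_mx 0 j) f z| <= e / (m.+1)%:R.
      have FF : Filter (nbhs z) by exact: nbhs_filter.
      apply: (@filter_forall _ _ (fun j w => `|'D_(delta_mx 0 j) f w - 'D_(delta_mx 0 j)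
        f z| <= e / (m.+1)%:R) (nbhs z) FF) => j; have /cvgrPdist_le/(_ _ e'0) := fc j.
      by apply: filterS => w; rewrite distrC.
    by move: fd; apply: filterS2 => w H1 H2 j; split.
  move=> /nbhs_ballP[d /= d0 Hd].
  apply/nbhs_ballP; exists d => //= h; rewrite -ball_normE /= sub0r normrN => hd.
  (* The vertices of the path: z + T k has the first k coordinates of z + h. *)
  pose T k : 'rV[R]_m := \row_j (if (j < k)%N then h 0 j else 0).
  have T0 : T 0 = 0 by apply/rowP => j; rewrite !mxE.
  have Tm : T m = h by apply/rowP => j; rewrite !mxE ltn_ord.
  have TS (k : 'I_m) : T k.+1 = T k + h 0 k *: delta_mx 0 k.
    apply/rowP => j; rewrite !mxE /= ltnS leq_eqVlt.
    rewrite -(inj_eq val_inj) /=; case: eqP => [E|_]/=.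
      by rewrite E ltnn add0r mulr1; congr (h 0 _); apply: val_inj.
    by rewrite mulr0 addr0.
  have step (k : 'I_m) : `|f (z + T k.+1) - f (z + T k) - h 0 k * 'D_(delta_mx 0 k) f z| <=
    e / (m.+1)%:R * `|h|.
    have inB (s : R) : `|s| <= `|h 0 k| -> ball z d (z + T k + s *: delta_mx 0 k).
      move=> sh; rewrite -ball_normE /= -addrA opprD addNKr normrN.
      apply: le_lt_trans hd; apply: row_norm_le => // j; rewrite !mxE /=.
      rewrite -(inj_eq val_inj) /=; case: ltngtP => // [jk|jk|_].
      - by rewrite mulr0 addr0 row_entry_le.
      - by rewrite mulr0 addr0 normr0.
      - by rewrite mulr1 add0r (le_trans sh) ?row_entry_le.
    have [|c ch] := @line_MVT _ f (z + T k) (delta_mx 0 k) (h 0 k).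
      by move=> s /inB /Hd /(_ k) [].
    rewrite -addrA -TS => ->; rewrite -mulrBr normrM mulrC.
    apply: ler_pM => //; last exact: row_entry_le.
    by case: (Hd _ (inB _ ch) k).
  have -> : (f \o shift z - (cst (f z) + dL)) h = 
     \sum_(k < m) (f (z + T k.+1) - f (z + T k) - h 0 k * 'D_(delta_mx 0 k) f z).
    rewrite sumrB -(big_mkord xpredT (fun k => f (z + T k.+1) - f (z + T k))).
    by rewrite telescope_sumr // Tm T0 addr0 -[LHS]/(f (h + z) - (f z + L h)) opprD addrA [h +
      z]addrC.
  apply: (le_trans (ler_norm_sum _ _ _)).
  apply: (le_trans (ler_sum _ (fun k _ => step k))).
  rewrite sumr_const card_ord -mulrnAl ler_wpM2r // -mulr_natr mulrAC.
  by rewrite ler_pdivrMr ?ltr0n// ler_wpM2l ?ler_nat ?(ltW e0).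
apply/diff_locallyP; rewrite (diff_unique cL fL); split; [exact: cL|exact: fL].
Qed.

End Rows.
End RealCalculus.

Section MixedDerivatives.
Context {R : realType}.

Section Lines.
Context {V : normedModType R}.
Implicit Types (f : V -> R) (x v : V).

Lemma is_derive_translate f x a v (df : R) :
  is_derive (x + a) v f df -> is_derive x v (fun w => f (w + a)) df.
Proof.
move=> [fd fv].
have E : (fun h : R => h^-1 *: (f (h *: v + x + a) - f (x + a)))
       = (fun h : R => h^-1 *: (f (h *: v + (x + a)) - f (x + a))).
  by apply/funext => h; rewrite addrA.
apply: DeriveDef; first by rewrite /derivable /= E.
by rewrite -fv /derive /= E.
Qed.

(** The left-hand side is symmetric in u and v; this is what makes mixed
    derivatives commute. *)
Lemma second_difference_MVT f z u v (t : R) :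
  (forall s r : R, `|s| <= `|t| -> `|r| <= `|t| ->
    derivable f (z + s *: u + r *: v) u /\
    derivable ('D_u f) (z + s *: u + r *: v) v) ->
  exists s r : R, [/\ `|s| <= `|t|, `|r| <= `|t| &
    f (z + t *: u + t *: v) - f (z + t *: u) - (f (z + t *: v) - f z) =
    t * (t * 'D_v ('D_u f) (z + s *: u + r *: v))].
Proof.
move=> fd; pose g w := f (w + t *: v) - f w.
have gd (s : R) : `|s| <= `|t| ->
    is_derive (z + s *: u) u g ('D_u f (z + s *: u + t *: v) - 'D_u f (z + s *: u)).
  move=> st; apply: is_deriveB; first apply: is_derive_translate.
    have [fut _] := fd s t st (lexx _); exact: derivableP fut.
  have r0 : `|0 : R| <= `|t| by rewrite normr0.
  have [fu0 _] := fd s 0 st r0; rewrite scale0r addr0 in fu0.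
  exact: derivableP fu0.
have [s /gd[]|s st] := @line_MVT _ _ g z u t; first by [].
case: (gd s st) => _ -> E.
have [r rt|r rt E'] := @line_MVT _ _ ('D_u f) (z + s *: u) v t.
  by case: (fd s r st rt).
by exists s, r; split => //; rewrite -E' -E.
Qed.

(** Expanding the second difference over a small parallelogram in both orders
    gives two points near z at which the two mixed derivatives agree; let the
    parallelogram shrink. *)
Lemma mixed_derivatives_comm f z u v :
  (\forall w \near z, [/\ derivable f w u, derivable f w v,
     derivable ('D_u f) w v & derivable ('D_v f) w u]) ->
  {for z, continuous ('D_v ('D_u f))} -> {for z, continuous ('D_u ('D_v f))} ->
  'D_v ('D_u f) z = 'D_u ('D_v f) z.
Proof.
move=> fd cvu cuv; apply/eqP; rewrite -subr_eq0 -normr_le0; apply/ler_addgt0Pr => e e0.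
rewrite add0r.
have e20 : 0 < e / 2 by rewrite divr_gt0.
have /nbhs_ballP[d /= d0 Hd] : \forall w \near z, [/\ derivable f w u, derivable f w v,
     derivable ('D_u f) w v & derivable ('D_v f) w u] /\
     (`|'D_v ('D_u f) z - 'D_v ('D_u f) w| <= e / 2 /\
      `|'D_u ('D_v f) z - 'D_u ('D_v f) w| <= e / 2).
  move/cvgrPdist_le: cvu => /(_ _ e20); move/cvgrPdist_le: cuv => /(_ _ e20).
  move: fd; apply: filterS3 => w a b c; exact: (conj a (conj c b)).
(* This t keeps the whole parallelogram in the ball of radius d. *)
pose t := d / (`|u| + `|v| + 1).
have nn : 0 < `|u| + `|v| + 1 by rewrite ltr_wpDl// addr_ge0.
have t0 : 0 < t by rewrite divr_gt0.
have inB (s r : R) : `|s| <= `|t| -> `|r| <= `|t| -> ball z d (z + s *: u + r *: v).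
  move=> st rt; rewrite -ball_normE /= -addrA opprD addNKr normrN.
  apply: (le_lt_trans (ler_normD _ _)); rewrite !normrZ.
  apply: (@le_lt_trans _ _ (t * (`|u| + `|v|))).
    rewrite mulrDr; rewrite !(gtr0_norm t0) in st rt.
    by apply: lerD; apply: ler_wpM2r.
  by rewrite /t mulrAC ltr_pdivrMr // ltr_pM2l // ltrDl.
have [s [r [st rt E1]]] := @second_difference_MVT f z u v t
  (fun s r st rt => let: conj (And4 a b c d) _ := Hd _ (inB s r st rt) in conj a c).
have [|s' [r' [st' rt' E2]]] := @second_difference_MVT f z v u t.
  move=> s' r' st' rt'; have [[_ fv _ fvu] _] := Hd _ (inB r' s' rt' st').
  by rewrite (addrAC z (s' *: v)).
have E : 'D_v ('D_u f) (z + s *: u + r *: v) = 'D_u ('D_v f) (z + r' *: u + s' *: v).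
  apply: (mulfI (lt0r_neq0 t0)); apply: (mulfI (lt0r_neq0 t0)).
  apply: etrans (esym E1) _; rewrite [z + r' *: u + _]addrAC; apply: etrans E2.
  rewrite [z + t *: v + t *: u]addrAC.
  by move: (f _) (f _) (f _) (f z) => *; ring.
case: (Hd _ (inB _ _ st rt)) => _ [B1 _]; case: (Hd _ (inB _ _ rt' st')) => _ [_ B2].
rewrite -E in B2; rewrite distrC in B2.
rewrite (splitr e); apply: le_trans (lerD B1 B2).
by apply: le_trans (ler_normD _ _); rewrite addrA subrK.
Qed.
End Lines.
End MixedDerivatives.

(** * Functions of class C^k *)

Section SmoothClosure.
Context {R : realType} {n : nat}.
Implicit Types (U : set (coords R n)) (f g : coords R n -> R).

Lemma near_eq_continuous_at (T : topologicalType) (z : T) (f g : T -> R) :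
  (\forall w \near z, f w = g w) -> {for z, continuous f} -> {for z, continuous g}.
Proof.
move=> fg cf; have E := nbhs_singleton fg.
have : g w @[w --> z] --> f z.
  by apply: cvg_trans cf; apply: near_eq_cvg; apply: filterS fg.
by rewrite E.
Qed.

Lemma Ck_on_eq k U f g : open U -> (forall z, U z -> f z = g z) ->
  Ck_on k U f -> Ck_on k U g.
Proof.
move=> Uo; elim: k f g => [|k IH] f g fg [fc fd].
  split=> // z Uz; have nfg : \forall w \near z, f w = g w.
    by apply: filterS (open_nbhs_nbhs (conj Uo Uz)) => w; exact: fg.
  exact: near_eq_continuous_at nfg (fc z Uz).
have nfg z : U z -> \forall w \near z, f w = g w.
  by move=> Uz; apply: filterS (open_nbhs_nbhs (conj Uo Uz)) => w; exact: fg.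
split.
  by move=> z Uz; exact: near_eq_continuous_at (nfg z Uz) (fc z Uz).
move=> j; have [fj fDj] := fd j; split.
  by move=> z Uz; apply: near_eq_derivable (fj z Uz); exact: nfg.
apply: IH fDj => z Uz; apply: near_eq_derive; exact: nfg.
Qed.

Lemma Ck_on_weaken k U f : Ck_on k.+1 U f -> Ck_on k U f.
Proof.
elim: k f => [|k IH] f [fc fd]; first by split.
by split => // j; have [fj fDj] := fd j; split => //; exact: IH.
Qed.

Lemma Ck_on_cst k U (c : R) : Ck_on k U (fun=> c).
Proof.
elim: k c => [|k IH] c; first by split=> // z _; exact: cst_continuous.
split; first by move=> z _; exact: cst_continuous.
move=> j; split; first by move=> z _; exact: derivable_cst.
have -> : 'D_(delta_mx 0 j) (fun=> c) = (fun=> 0) :> (coords R n -> R).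
  by apply/funext => z; rewrite derive_cst.
exact: IH.
Qed.

Lemma is_derive_coord (j : 'I_(n + n)) (z v : coords R n) :
  is_derive z v (fun w : coords R n => w 0 j) (v 0 j).
Proof.
apply: DeriveDef.
  apply: diff_derivable; exact: differentiable_coord.
rewrite deriveE; last exact: differentiable_coord.
have cl : continuous (fun w : coords R n => w 0 j) by exact: coord_continuous.
have ll : linear (fun w : coords R n => w 0 j) by move=> a h k; rewrite !mxE.
pose L : {linear coords R n -> R} := HB.pack (fun w : coords R n => w 0 j)
  (GRing.isLinear.Build _ _ _ _ _ ll).
by rewrite -[X in diff _ X]/(L : _ -> _) diff_lin.
Qed.

Lemma Ck_on_coord k U (j : 'I_(n + n)) : Ck_on k U (fun z => z 0 j).
Proof.
have cc z : {for z, continuous (fun w : coords R n => w 0 j)} by exact: coord_continuous.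
case: k => [|k]; first by split.
split=> [z _|i]; first exact: cc.
split; first by move=> z _; case: (is_derive_coord j z (delta_mx 0 i)).
have -> : 'D_(delta_mx 0 i) (fun z : coords R n => z 0 j) =
    (fun=> (delta_mx 0 i : coords R n) 0 j).
  by apply/funext => z; case: (is_derive_coord j z (delta_mx 0 i)).
exact: Ck_on_cst.
Qed.

Lemma Ck_onD k U f g : open U -> Ck_on k U f -> Ck_on k U g ->
  Ck_on k U (fun z => f z + g z).
Proof.
move=> Uo; elim: k f g => [|k IH] f g [fc fd] [gc gd].
  by split => // z Uz; apply: continuousD; [exact: fc|exact: gc].
split=> [z Uz|j]; first by apply: continuousD; [exact: fc|exact: gc].
have [fj fD] := fd j; have [gj gD] := gd j.
split; first by move=> z Uz; apply: derivableD; [exact: fj|exact: gj].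
apply: Ck_on_eq (IH _ _ fD gD) => // z Uz.
by rewrite -[RHS]/('D__ (f + g) z) deriveD //; [exact: fj|exact: gj].
Qed.

Lemma Ck_onM k U f g : open U -> Ck_on k U f -> Ck_on k U g ->
  Ck_on k U (fun z => f z * g z).
Proof.
move=> Uo; elim: k f g => [|k IH] f g fk gk.
  by split => // z Uz; apply: continuousM; [exact: fk.1|exact: gk.1].
split=> [z Uz|j]; first by apply: continuousM; [exact: fk.1|exact: gk.1].
have [fj fD] := fk.2 j; have [gj gD] := gk.2 j.
split; first by move=> z Uz; apply: derivableM; [exact: fj|exact: gj].
have fl := Ck_on_weaken fk; have gl := Ck_on_weaken gk.
apply: Ck_on_eq (Ck_onD Uo (IH _ _ fl gD) (IH _ _ gl fD)) => // z Uz.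
by rewrite -[RHS]/('D__ (f * g) z) deriveM //; [exact: fj|exact: gj].
Qed.

Lemma Ck_onN k U f : open U -> Ck_on k U f -> Ck_on k U (fun z => - f z).
Proof.
move=> Uo fk; apply: Ck_on_eq (Ck_onM Uo (Ck_on_cst k U (-1)) fk) => // z _.
by rewrite mulN1r.
Qed.

Lemma Ck_on_sum k U (I : Type) (r : seq I) (P : pred I) (F : I -> coords R n -> R) :
  open U -> (forall i, P i -> Ck_on k U (F i)) ->
  Ck_on k U (fun z => \sum_(i <- r | P i) F i z).
Proof.
move=> Uo FC; elim: r => [|i r IH].
  by apply: Ck_on_eq (Ck_on_cst k U 0) => // z _; rewrite big_nil.
have /(Ck_on_eq Uo) : forall z, U z -> (if P i then F i z else 0) + 
   \sum_(i <- r | P i) F i z = \sum_(j <- i :: r | P j) F j z.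
  by move=> z _; rewrite big_cons; case: (P i); rewrite ?add0r.
apply; apply: Ck_onD => //; case: (P i) (FC i) => [/(_ isT)//|_].
exact: Ck_on_cst.
Qed.

Lemma Ck_onV k U f : open U -> (forall z, U z -> f z != 0) -> Ck_on k U f ->
  Ck_on k U (fun z => (f z)^-1).
Proof.
move=> Uo f0; elim: k => [|k IH] fk.
  by split => // z Uz; apply: continuousV; [exact: f0|exact: fk.1].
split=> [z Uz|j]; first by apply: continuousV; [exact: f0|exact: fk.1].
have [fj fD] := fk.2 j; have fI := IH (Ck_on_weaken fk).
split; first by move=> z Uz; apply: derivableV; [exact: f0|exact: fj].
apply: Ck_on_eq (Ck_onM Uo (Ck_onN Uo (Ck_onM Uo fI fI)) fD) => // z Uz.
by rewrite deriveV ?f0 //; [rewrite -expr2 exprVn|exact: fj].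
Qed.

Lemma is_derive_outer (f : coords R n -> R) (e : R -> R) (z v : coords R n) (d df : R) :
  is_derive (f z) 1 e d -> is_derive z v f df -> is_derive z v (e \o f) (d * df).
Proof.
move=> [ed ev] [fd fv].
have lineE (g : coords R n -> R) : (fun t : R => t^-1 *: (g ((t *: (1:R) + 0) *: v + z) -
  g (0 *: v + z)))
   = (fun t : R => t^-1 *: (g (t *: v + z) - g z)).
  by apply/funext => t; rewrite scale0r add0r addr0 [t *: 1]mulr1.
have fd1 : is_derive (0:R) 1 (fun t : R => f (t *: v + z)) df.
  by apply: DeriveDef; rewrite -?fv /derivable /derive /= lineE.
have ed1 : is_derive (f (0 *: v + z)) 1 e d by rewrite scale0r add0r; apply: DeriveDef.
have [cd cv] := @is_derive1_comp R e _ (0:R) _ _ ed1 fd1.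
move: cd cv; rewrite /derivable /derive /= (lineE (e \o f)) => cd cv.
exact: DeriveDef.
Qed.

End SmoothClosure.

(** * Smooth functions and the second derivative test *)

Section SmoothFunctions.
Context {R : realType} {n : nat}.
Implicit Types (U : set (coords R n)) (f g : coords R n -> R).

Lemma continuous_outer f (e : R -> R) (z : coords R n) d :
  is_derive (f z) 1 e d -> {for z, continuous f} -> {for z, continuous (e \o f)}.
Proof.
move=> [ed _] fc; apply: continuous_comp => //.
by apply: differentiable_continuous; apply/derivable1_diffP.
Qed.

Lemma Ck_on_expR k U f : open U -> Ck_on k U f -> Ck_on k U (fun z => expR (f z)).
Proof.
move=> Uo; elim: k => [|k IH] fk.
  by split => // z Uz; apply: (@continuous_outer f expR z _ (is_derive_expR _)); exact: fk.1.
split=> [z Uz|j]; first by apply: (@continuous_outer f expR z _ (is_derive_expR _)); exact: fk.1.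
have [fj fD] := fk.2 j.
have D z : U z -> is_derive z (delta_mx 0 j) (fun z => expR (f z)) (expR (f z)
  * 'D_(delta_mx 0 j) f z).
  by move=> Uz; apply: (@is_derive_outer _ _ f expR); apply: derivableP; exact: fj.
split; first by move=> z /D [].
apply: Ck_on_eq (Ck_onM Uo (IH (Ck_on_weaken fk)) fD) => // z /D.
by case.
Qed.

Lemma Ck_on_ln k U f : open U -> (forall z, U z -> 0 < f z) -> Ck_on k U f ->
  Ck_on k U (fun z => ln (f z)).
Proof.
move=> Uo f0; case: k => [|k] fk.
  by split=> // z Uz; exact: (@continuous_outer f (@ln R) z _ (is_derive1_ln (f0 z Uz))
    (fk.1 z Uz)).
split=> [z Uz|j]; first exact: (@continuous_outer f (@ln R) z _ (is_derive1_ln (f0 z Uz))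
  (fk.1 z Uz)).
have [fj fD] := fk.2 j.
have D z : U z -> is_derive z (delta_mx 0 j) (fun z => ln (f z)) ((f z)^-1 * 'D_(delta_mx 0 j)
  f z).
  move=> Uz; exact: (is_derive_outer (is_derive1_ln (f0 z Uz)) (derivableP (fj z Uz))).
split; first by move=> z /D [].
have fI : Ck_on k U (fun z => (f z)^-1).
  by apply: Ck_onV (Ck_on_weaken fk) => // z /f0 /lt0r_neq0.
by apply: Ck_on_eq (Ck_onM Uo fI fD) => // z /D [].
Qed.

Section SmoothOn.
Variables (U : set (coords R n)).
Hypothesis Uo : open U.

Lemma smooth_on_continuous f z : smooth_on U f -> U z -> {for z, continuous f}.
Proof. by move=> /(_ 0) [fc _]; exact: fc. Qed.

Lemma smooth_on_derivable f z j : smooth_on U f -> U z -> derivable f z (delta_mx 0 j).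
Proof. by move=> /(_ 1) [_ fd] /(fd j).1. Qed.

Lemma smooth_on_derive f j : smooth_on U f -> smooth_on U ('D_(delta_mx 0 j) f).
Proof. by move=> fs k; have [_ /(_ j)[]] := fs k.+1. Qed.

Lemma smooth_on_differentiable f z : smooth_on U f -> U z -> differentiable f z.
Proof.
move=> fs Uz; apply: C1_differentiable.
  apply: filterS (open_nbhs_nbhs (conj Uo Uz)) => w Uw j.
  exact: smooth_on_derivable fs Uw.
by move=> j; apply: smooth_on_continuous (smooth_on_derive j fs) Uz.
Qed.

Lemma derive_sum_coord f z (v : coords R n) : smooth_on U f -> U z ->
  derivable f z v /\ 'D_v f z = \sum_j v 0 j * 'D_(delta_mx 0 j) f z.
Proof.
move=> fs Uz; have fd := smooth_on_differentiable fs Uz.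
split; first exact: diff_derivable.
rewrite deriveE // {1}[v]row_sum_delta linear_sum; apply: eq_bigr => j _.
by rewrite linearZ /= -deriveE.
Qed.

Lemma smooth_on_derive_comm f z j k : smooth_on U f -> U z ->
  'D_(delta_mx 0 k) ('D_(delta_mx 0 j) f) z = 'D_(delta_mx 0 j) ('D_(delta_mx 0 k) f) z.
Proof.
move=> fs Uz; have fj := smooth_on_derive j fs; have fk := smooth_on_derive k fs.
apply: mixed_derivatives_comm.
- apply: filterS (open_nbhs_nbhs (conj Uo Uz)) => w Uw.
  by split; [exact: smooth_on_derivable Uw|exact: smooth_on_derivable Uw|
   exact: smooth_on_derivable fj Uw|exact: smooth_on_derivable fk Uw].
- exact: smooth_on_continuous (smooth_on_derive k fj) Uz.
- exact: smooth_on_continuous (smooth_on_derive j fk) Uz.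
Qed.

Lemma smooth_on_derive_dir f (v : coords R n) : smooth_on U f -> smooth_on U ('D_v f).
Proof.
move=> fs k; apply: (@Ck_on_eq _ _ k U (fun z => \sum_j v 0 j * 'D_(delta_mx 0 j) f z)) => //.
  by move=> z Uz; have [_ ->] := derive_sum_coord v fs Uz.
by apply: Ck_on_sum => // j _; apply: Ck_onM => //; [exact: Ck_on_cst|exact: smooth_on_derive].
Qed.

(** The derivative g' of f along the line vanishes at 0.  If its own derivative
    were positive there, g' would be positive on a small interval to the right of
    0, and f would increase along it. *)
Lemma second_derivative_le0 f z (v : coords R n) : smooth_on U f -> U z ->
  (\forall w \near z, f w <= f z) -> 'D_v ('D_v f) z <= 0.
Proof.
move=> fs Uz fmax; rewrite leNgt; apply/negP => D2.
pose g (t : R) := f (z + t *: v); pose g' (t : R) := 'D_v f (z + t *: v).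
have lc : {for (0:R), continuous (fun t : R => z + t *: v)}.
  apply: continuousD; first exact: cst_continuous.
  exact: scalel_continuous.
have nU : \forall t \near (0:R), U (z + t *: v) /\ f (z + t *: v) <= f z.
  have : \forall w \near z + (0:R) *: v, U w /\ f w <= f z.
    rewrite scale0r addr0; apply: filterI => //.
    exact: (open_nbhs_nbhs (conj Uo Uz)).
  by move/lc.
have gd (t : R) : U (z + t *: v) -> is_derive t 1 g (g' t).
  move=> Ut; apply: is_derive_line; apply: derivableP.
  exact: (derive_sum_coord v fs Ut).1.
have fs' := smooth_on_derive_dir v fs.
have g'd : is_derive (0:R) 1 g' ('D_v ('D_v f) z).
  apply: (@is_derive_line _ _ ('D_v f) z v 0); rewrite scale0r addr0.
  exact: derivableP (derive_sum_coord v fs' Uz).1.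
have [e /= e0 He] : exists2 e : R, 0 < e & forall t : R, `|t| < e -> U (z + t *: v) /\ f (z +
  t *: v) <= f z.
  move: nU => /nbhs_ballP[e /= e0 He]; exists e => // t te.
  by apply: He; rewrite -ball_normE /= sub0r normrN.
have g'0 : g' 0 = 0.
  have U0 : U (z + (0:R) *: v) by rewrite scale0r addr0.
  have [_ <-] := gd 0 U0.
  have ee : - e <= e by rewrite ge0_cp ?ltW.
  have [] // := @derive1_at_max R g (- e) e 0 ee.
  - by move=> t; rewrite in_itv /= -ltr_norml => /He [/gd []].
  - by rewrite in_itv /= oppr_lt0 e0.
  - move=> t; rewrite in_itv /= -ltr_norml => /He [_].
    by rewrite /g scale0r addr0.
have : \forall t \near (0:R)^', 0 < t^-1 * g' t.
  have [g'dd g'v] := g'd.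
  have : (fun h : R => h^-1 *: (g' (h *: (1:R) + 0) - g' 0)) @ 0^' --> 'D_v ('D_v f) z.
    by rewrite -g'v; exact: g'dd.
  move=> /cvgr_gt /(_ _ D2); apply: filterS => t /=.
  by rewrite g'0 subr0 addr0 [t *: 1]mulr1.
move=> /nbhs_ballP[d /= d0 Hd].
pose a := Num.min d e / 2.
have m0 : 0 < Num.min d e by rewrite lt_min d0.
have a0 : 0 < a by rewrite divr_gt0.
have am : a < Num.min d e by rewrite ltr_pdivrMr // mulr_natr mulr2n ltrDl.
move: am; rewrite lt_min => /andP[ad ae].
have pos (t : R) : 0 < t <= a -> 0 < g' t.
  move=> /andP[t0 ta].
  have : 0 < t^-1 * g' t.
    apply: Hd; last by rewrite gt_eqF.
    by rewrite -ball_normE /= sub0r normrN gtr0_norm // (le_lt_trans ta).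
  by rewrite pmulr_rgt0 // invr_gt0.
have ina (t : R) : 0 <= t <= a -> U (z + t *: v) /\ f (z + t *: v) <= f z.
  by move=> /andP[t0 ta]; apply: He; rewrite ger0_norm // (le_lt_trans ta).
have [|| c cin E] := @MVT R g g' 0 a a0.
- move=> t; rewrite in_itv /= => /andP[t0 ta].
  by apply: gd; case: (ina t _); rewrite // !ltW.
- apply: derivable_within_continuous => t; rewrite in_itv /= => ta.
  by case: (gd t (ina t ta).1).
have : g a <= g 0 by rewrite /g scale0r addr0; case: (ina a _); rewrite // lexx ltW.
move: cin; rewrite in_itv /= => /andP[c0 ca].
rewrite -subr_le0 E subr0 leNgt mulr_gt0 //; apply: pos; rewrite c0 ltW //.
Qed.

End SmoothOn.
End SmoothFunctions.

(** * Complex-valued functions *)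

Section ChainRule.
Context {R : realType} {n : nat}.
(** Only the outer function has to be differentiable: t is composed with the line
    through z in the direction v. *)
Lemma derive_comp_coords (f : coords R n -> R) (t : coords R n -> coords R n) (z v : coords R n) :
  differentiable f (t z) -> (forall k, derivable (fun w => t w 0 k) z v) ->
  derivable (f \o t) z v /\
  'D_v (f \o t) z = \sum_k 'D_(delta_mx 0 k) f (t z) * 'D_v (fun w => t w 0 k) z.
Proof.
move=> fd tk.
have td : derivable t z v by apply/derivable_mxP => i j; rewrite ord1; exact: tk.
have /derivable1P/derivable1_diffP gd := td.
pose g (h : R) := t (h *: v + z).
have fd' : differentiable f (g 0) by rewrite /g scale0r add0r.
have fgd : differentiable (f \o g) 0 by exact: differentiable_comp.
have D : derivable (f \o t) z v by apply/derivable1P/derivable1_diffP.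
have lineE (V : normedModType R) (h : coords R n -> V) : 
  (fun s : R => s^-1 *: (h ((s *: (1:R) + 0) *: v + z) - h (0 *: v + z)))
   = (fun s : R => s^-1 *: (h (s *: v + z) - h z)).
  by apply/funext => s; rewrite scale0r add0r addr0 [s *: 1]mulr1.
split => //.
have -> : 'D_v (f \o t) z = 'D_1 (f \o g) 0 by rewrite /derive /= (lineE _ (f \o t)).
rewrite deriveE // diff_comp //= -(deriveE _ gd).
have -> : 'D_1 g 0 = 'D_v t z by rewrite /derive /= (lineE _ t).
have g0 : g 0 = t z by rewrite /g scale0r add0r.
rewrite -(deriveE _ fd') g0 deriveE // {1}['D_v t z]row_sum_delta linear_sum.
by apply: eq_bigr => k _; rewrite linearZ /= -deriveE // derive_mx // mxE mulrC.
Qed.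
End ChainRule.

Section ComplexCalculus.
Context {R : realType} {n : nat}.
Implicit Types (f g h : coords R n -> R[i]).

Lemma Re_mul (x y : R[i]) : complex.Re (x * y) =
    complex.Re x * complex.Re y - complex.Im x * complex.Im y.
Proof. by case: x; case: y. Qed.
Lemma Im_mul (x y : R[i]) : complex.Im (x * y) =
    complex.Re x * complex.Im y + complex.Im x * complex.Re y.
Proof. by case: x; case: y. Qed.
Lemma Re_add (x y : R[i]) : complex.Re (x + y) = complex.Re x + complex.Re y.
Proof. by case: x; case: y. Qed.
Lemma Im_add (x y : R[i]) : complex.Im (x + y) = complex.Im x + complex.Im y.
Proof. by case: x; case: y. Qed.
Lemma Re_opp (x : R[i]) : complex.Re (- x) = - complex.Re x.
Proof. by case: x. Qed.
Lemma complex_eq (x y : R[i]) : complex.Re x = complex.Re y -> complex.Im x =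
    complex.Im y -> x = y.
Proof. by case: x => a b; case: y => c d /= -> ->. Qed.

Section OnOpen.
Variable U : set (coords R n).
Hypothesis Uo : open U.

Lemma smooth_on_eq (u v : coords R n -> R) : (forall z, U z -> u z = v z) ->
  smooth_on U u -> smooth_on U v.
Proof. by move=> uv us k; exact: Ck_on_eq (us k). Qed.

Lemma smooth_onD (u v : coords R n -> R) :
  smooth_on U u -> smooth_on U v -> smooth_on U (fun z => u z + v z).
Proof. by move=> us vs k; exact: Ck_onD. Qed.

Lemma smooth_onM (u v : coords R n -> R) :
  smooth_on U u -> smooth_on U v -> smooth_on U (fun z => u z * v z).
Proof. by move=> us vs k; exact: Ck_onM. Qed.

Lemma smooth_onN (u : coords R n -> R) : smooth_on U u -> smooth_on U (fun z => - u z).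
Proof. by move=> us k; exact: Ck_onN. Qed.

Lemma smooth_on_cst (c : R) : smooth_on U (fun=> c).
Proof. by move=> k; exact: Ck_on_cst. Qed.

Lemma csmooth_on_eq f g : (forall z, U z -> f z = g z) -> csmooth_on U f -> csmooth_on U g.
Proof.
by move=> fg [fr fi]; split; [apply: smooth_on_eq fr|apply: smooth_on_eq fi] => z /fg ->.
Qed.

Lemma csmooth_on_cst c : csmooth_on U (fun=> c).
Proof. by split; exact: smooth_on_cst. Qed.

Lemma csmooth_on_real (u : coords R n -> R) : smooth_on U u -> csmooth_on U (fun z => (u z)%:C%C).
Proof. by split=> //; exact: smooth_on_cst. Qed.

Lemma csmooth_onD f g : csmooth_on U f -> csmooth_on U g -> csmooth_on U (fun z => f z + g z).
Proof.
move=> [fr fi] [gr gi]; split.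
  by apply: smooth_on_eq (smooth_onD fr gr) => z _; rewrite Re_add.
by apply: smooth_on_eq (smooth_onD fi gi) => z _; rewrite Im_add.
Qed.

Lemma csmooth_onM f g : csmooth_on U f -> csmooth_on U g -> csmooth_on U (fun z => f z * g z).
Proof.
move=> [fr fi] [gr gi]; split.
  by apply: smooth_on_eq (smooth_onD (smooth_onM fr gr) (smooth_onN (smooth_onM fi gi)))
    => z _; rewrite Re_mul.
by apply: smooth_on_eq (smooth_onD (smooth_onM fr gi) (smooth_onM fi gr)) => z _; rewrite Im_mul.
Qed.

Lemma csmooth_onN f : csmooth_on U f -> csmooth_on U (fun z => - f z).
Proof.
move=> fs; apply: csmooth_on_eq (csmooth_onM (csmooth_on_cst (-1)) fs) => z _.
by rewrite mulN1r.
Qed.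

Lemma csmooth_onB f g : csmooth_on U f -> csmooth_on U g -> csmooth_on U (fun z => f z - g z).
Proof. by move=> fs gs; apply: csmooth_onD => //; exact: csmooth_onN. Qed.

Lemma csmooth_on_conj f : csmooth_on U f -> csmooth_on U (fun z => (f z)^*%C).
Proof.
move=> [fr fi]; split; first by apply: smooth_on_eq fr => z _; case: (f z).
by apply: smooth_on_eq (smooth_onN fi) => z _; case: (f z).
Qed.

Lemma csmooth_on_sum (I : Type) (r : seq I) (P : pred I) (F : I -> coords R n -> R[i]) :
  (forall i, P i -> csmooth_on U (F i)) -> csmooth_on U (fun z => \sum_(i <- r | P i) F i z).
Proof.
move=> Fs; elim: r => [|i r IH].
  by apply: csmooth_on_eq (csmooth_on_cst 0) => z _; rewrite big_nil.
have /csmooth_on_eq : forall z, U z -> (if P i then F i z else 0) + 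
   \sum_(i <- r | P i) F i z = \sum_(j <- i :: r | P j) F j z.
  by move=> z _; rewrite big_cons; case: (P i); rewrite ?add0r.
apply; apply: csmooth_onD => //; case: (P i) (Fs i) => [/(_ isT)//|_].
exact: csmooth_on_cst.
Qed.

Lemma csmooth_on_prod (I : Type) (r : seq I) (P : pred I) (F : I -> coords R n -> R[i]) :
  (forall i, P i -> csmooth_on U (F i)) -> csmooth_on U (fun z => \prod_(i <- r | P i) F i z).
Proof.
move=> Fs; elim: r => [|i r IH].
  by apply: csmooth_on_eq (csmooth_on_cst 1) => z _; rewrite big_nil.
have /csmooth_on_eq : forall z, U z -> (if P i then F i z else 1) *
   \prod_(i <- r | P i) F i z = \prod_(j <- i :: r | P j) F j z.
  by move=> z _; rewrite big_cons; case: (P i); rewrite ?mul1r.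
apply; apply: csmooth_onM => //; case: (P i) (Fs i) => [/(_ isT)//|_].
exact: csmooth_on_cst.
Qed.

Lemma csmooth_on_inv f : (forall z, U z -> f z != 0) -> csmooth_on U f ->
  csmooth_on U (fun z => (f z)^-1).
Proof.
move=> f0 fs; have [fr fi] := fs.
have ms := smooth_onD (smooth_onM fr fr) (smooth_onM fi fi).
have m0 z : U z -> complex.Re (f z) * complex.Re (f z) + complex.Im (f z) * complex.Im (f z) != 0.
  move=> /f0; apply: contraNneq; case: (f z) => a b /= /eqP.
  by rewrite -!expr2 paddr_eq0 ?sqr_ge0// !sqrf_eq0 => /andP[/eqP-> /eqP->].
have ims : smooth_on U (fun z => (complex.Re (f z) * complex.Re (f z) + complex.Im (f z)
  * complex.Im (f z))^-1).
  by move=> k; apply: Ck_onV (ms k).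
apply: csmooth_on_eq (csmooth_onM (csmooth_on_conj fs) (csmooth_on_real ims)) => z Uz.
apply: (mulfI (f0 z Uz)); rewrite mulfV ?f0//.
have := m0 z Uz; case: (f z) => a b /= ab; apply: complex_eq => /=; field; exact: ab.
Qed.

Lemma csmooth_on_cpartial j f : csmooth_on U f -> csmooth_on U (cpartial j f).
Proof. by move=> [fr fi]; split; exact: smooth_on_derive. Qed.

Lemma cpartial_eq j f g z : (forall w, U w -> f w = g w) -> U z -> cpartial j f z =
    cpartial j g z.
Proof.
move=> fg Uz; have nU := open_nbhs_nbhs (conj Uo Uz).
by congr (_ +i* _)%C; apply: near_eq_derive; apply: filterS nU => w /fg ->.
Qed.

Lemma cpartial_cst j c z : cpartial j (fun=> c) (z : coords R n) = 0.
Proof. by rewrite /cpartial !derive_cst. Qed.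

Section AtPoint.
Variable z : coords R n.
Hypothesis Uz : U z.

Lemma cpartialD j f g : csmooth_on U f -> csmooth_on U g ->
  cpartial j (fun w => f w + g w) z = cpartial j f z + cpartial j g z.
Proof.
move=> [fr fi] [gr gi]; apply: complex_eq => /=.
  under eq_fun do rewrite Re_add; rewrite [LHS]deriveD //; exact: smooth_on_derivable.
under eq_fun do rewrite Im_add; rewrite [LHS]deriveD //; exact: smooth_on_derivable.
Qed.

Lemma cpartialM j f g : csmooth_on U f -> csmooth_on U g ->
  cpartial j (fun w => f w * g w) z = cpartial j f z * g z + f z * cpartial j g z.
Proof.
move=> [fr fi] [gr gi].
have der (u : coords R n -> R) : smooth_on U u -> derivable u z (delta_mx 0 j).
  by move=> us; exact: smooth_on_derivable.
have [dfr dfi] := (derivableP (der _ fr), derivableP (der _ fi)).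
have [dgr dgi] := (derivableP (der _ gr), derivableP (der _ gi)).
apply: complex_eq => /=; rewrite ?(Re_add, Re_mul, Im_add, Im_mul) /=.
  under eq_fun do rewrite Re_mul.
  have [_ H] := is_deriveB (is_deriveM dfr dgr) (is_deriveM dfi dgi).
  by etransitivity; [exact: H|rewrite /GRing.scale /=; ring].
under eq_fun do rewrite Im_mul.
have [_ H] := is_deriveD (is_deriveM dfr dgi) (is_deriveM dfi dgr).
by etransitivity; [exact: H|rewrite /GRing.scale /=; ring].
Qed.

Lemma cpartial_conj j f : csmooth_on U f ->
  cpartial j (fun w => (f w)^*%C) z = (cpartial j f z)^*%C.
Proof.
move=> [fr fi]; apply: complex_eq => /=.
  by congr ('D_ _ _ z); apply/funext => w; case: (f w).
rewrite -deriveN; last exact: smooth_on_derivable.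
congr (derive _ z _); apply/funext => w.
by change (complex.Im (f w)^*%C = - complex.Im (f w)); case: (f w).
Qed.

Lemma cpartial_comm j k f : csmooth_on U f ->
  cpartial j (cpartial k f) z = cpartial k (cpartial j f) z.
Proof. by move=> [fr fi]; apply: complex_eq => /=; exact: (smooth_on_derive_comm Uo). Qed.

End AtPoint.
End OnOpen.
End ComplexCalculus.

(** * Wirtinger derivatives *)

Section Wirtinger.
Context {R : realType} {n : nat}.
Implicit Types (f g h : coords R n -> R[i]) (u : coords R n -> R) (a b : 'I_n) (e : R[i]).

(** Both dz (e = - i) and dzbar (e = i), so that every rule is proved once. *)
Definition wirtinger e a h z : R[i] :=
  2%:R^-1 * (cpartial (lshift n a) h z + e * cpartial (rshift n a) h z).

Lemma dzE a h z : dz a h z = wirtinger (- 'i%C) a h z.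
Proof. by rewrite /wirtinger mulNr. Qed.
Lemma dzbarE a h z : dzbar a h z = wirtinger 'i%C a h z.
Proof. by []. Qed.

Section OnOpen.
Variable U : set (coords R n).
Hypothesis Uo : open U.

Lemma csmooth_on_wirtinger e a f : csmooth_on U f -> csmooth_on U (wirtinger e a f).
Proof.
move=> fs; have c c0 := csmooth_on_cst U c0.
apply: (csmooth_onM Uo (c _)); apply: csmooth_onD => //; last apply: (csmooth_onM Uo (c _));
  exact: csmooth_on_cpartial.
Qed.

Lemma csmooth_on_dz a f : csmooth_on U f -> csmooth_on U (dz a f).
Proof. by move=> /(csmooth_on_wirtinger (- 'i%C) a); apply: csmooth_on_eq => // z _;
  rewrite dzE. Qed.

Lemma csmooth_on_dzbar a f : csmooth_on U f -> csmooth_on U (dzbar a f).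
Proof. exact: csmooth_on_wirtinger. Qed.

Lemma wirtinger_eq e a f g z : (forall w, U w -> f w = g w) -> U z ->
  wirtinger e a f z = wirtinger e a g z.
Proof. by move=> fg Uz; rewrite /wirtinger !(cpartial_eq Uo _ fg Uz). Qed.

Lemma wirtinger_cst e a c (z : coords R n) : wirtinger e a (fun=> c) z = 0.
Proof. by rewrite /wirtinger !cpartial_cst mulr0 addr0 mulr0. Qed.

Section AtPoint.
Variable z : coords R n.
Hypothesis Uz : U z.

Lemma wirtingerD e a f g : csmooth_on U f -> csmooth_on U g ->
  wirtinger e a (fun w => f w + g w) z = wirtinger e a f z + wirtinger e a g z.
Proof.
move=> fs gs; rewrite /wirtinger !(cpartialD Uz)//.
move: (cpartial (lshift n a) f z) (cpartial (rshift n a) f z) (cpartial (lshift n a) g z)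
  (cpartial (rshift n a) g z) => *; ring.
Qed.

Lemma wirtingerM e a f g : csmooth_on U f -> csmooth_on U g ->
  wirtinger e a (fun w => f w * g w) z = wirtinger e a f z * g z + f z * wirtinger e a g z.
Proof.
move=> fs gs; rewrite /wirtinger !(cpartialM Uz)//.
move: (cpartial (lshift n a) f z) (cpartial (rshift n a) f z) (cpartial (lshift n a) g z)
  (cpartial (rshift n a) g z) (f z) (g z) => *; ring.
Qed.

Lemma wirtingerZ e a c f : csmooth_on U f ->
  wirtinger e a (fun w => c * f w) z = c * wirtinger e a f z.
Proof.
move=> fs; rewrite wirtingerM ?wirtinger_cst ?mul0r ?add0r//.
exact: csmooth_on_cst.
Qed.

Lemma wirtingerN e a f : csmooth_on U f ->
  wirtinger e a (fun w => - f w) z = - wirtinger e a f z.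
Proof.
move=> fs; have -> : (fun w => - f w) = (fun w => (-1) * f w).
  by apply/funext => w; rewrite mulN1r.
by rewrite wirtingerZ // mulN1r.
Qed.

Lemma wirtingerB e a f g : csmooth_on U f -> csmooth_on U g ->
  wirtinger e a (fun w => f w - g w) z = wirtinger e a f z - wirtinger e a g z.
Proof.
by move=> fs gs; rewrite wirtingerD ?wirtingerN//; exact: csmooth_onN.
Qed.

Lemma wirtinger_sum e a (I : Type) (r : seq I) (P : pred I) (F : I -> coords R n -> R[i]) :
  (forall i, P i -> csmooth_on U (F i)) ->
  wirtinger e a (fun w => \sum_(i <- r | P i) F i w) z =
    \sum_(i <- r | P i) wirtinger e a (F i) z.
Proof.
move=> Fs; elim: r => [|i r IH].
  have -> : (fun w => \sum_(i <- [::] | P i) F i w) = (fun=> 0).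
    by apply/funext => w; rewrite big_nil.
  by rewrite big_nil wirtinger_cst.
rewrite big_cons; case: ifPn => Pi; last first.
  have -> : (fun w => \sum_(j <- i :: r | P j) F j w) = (fun w => \sum_(j <- r | P j) F j w).
    by apply/funext => w; rewrite big_cons (negbTE Pi).
  exact: IH.
have -> : (fun w => \sum_(j <- i :: r | P j) F j w) =
    (fun w => F i w + \sum_(j <- r | P j) F j w).
  by apply/funext => w; rewrite big_cons Pi.
by rewrite wirtingerD ?IH; [|exact: Fs|exact: csmooth_on_sum].
Qed.

Lemma wirtinger_prod e a (I : eqType) (r : seq I) (F : I -> coords R n -> R[i]) :
  uniq r -> (forall i, csmooth_on U (F i)) ->
  wirtinger e a (fun w => \prod_(i <- r) F i w) z =
  \sum_(i <- r) \prod_(j <- r) (if j == i then wirtinger e a (F i) z else F j z).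
Proof.
move=> + Fs; elim: r => [|i r IH] /=.
  move=> _; have -> : (fun w => \prod_(i <- [::]) F i w) = (fun=> 1).
    by apply/funext => w; rewrite big_nil.
  by rewrite big_nil wirtinger_cst.
move=> /andP[ir ur].
have -> : (fun w => \prod_(j <- i :: r) F j w) = (fun w => F i w * \prod_(j <- r) F j w).
  by apply/funext => w; rewrite big_cons.
rewrite wirtingerM ?IH //; last exact: csmooth_on_prod.
rewrite [in RHS]big_cons big_cons eqxx; congr (_ * _ + _).
  by apply: eq_big_seq => j jr; case: eqP jr ir => // -> ->.
rewrite mulr_sumr; apply: eq_big_seq => j jr; rewrite big_cons; congr (_ * _).
by case: eqP jr ir => // -> ->.
Qed.

Lemma cpartial_wirtinger e a j f : csmooth_on U f ->
  cpartial j (wirtinger e a f) z =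
  2%:R^-1 * (cpartial j (cpartial (lshift n a) f) z + e * cpartial j (cpartial (rshift n a) f) z).
Proof.
move=> fs; have c c0 := csmooth_on_cst U c0; have p k := csmooth_on_cpartial k fs.
have m g : csmooth_on U g -> csmooth_on U (fun w => e * g w) by move=> gs;
  exact: (csmooth_onM Uo (c _)).
rewrite (cpartialM Uz) //; last by apply: csmooth_onD => //; exact: m.
rewrite cpartial_cst mul0r add0r (cpartialD Uz) //; last exact: m.
by rewrite (cpartialM Uz) // cpartial_cst mul0r add0r.
Qed.

Lemma wirtinger_comm e e' a b f : csmooth_on U f ->
  wirtinger e a (wirtinger e' b f) z = wirtinger e' b (wirtinger e a f) z.
Proof.
move=> fs.
have W e1 a1 g : wirtinger e1 a1 g z =
   2%:R^-1 * (cpartial (lshift n a1) g z + e1 * cpartial (rshift n a1) g z) by [].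
have C j k : cpartial j (cpartial k f) z =
  cpartial k (cpartial j f) z by exact: (cpartial_comm Uo).
have E e1 a1 j := cpartial_wirtinger e1 a1 j fs; rewrite (W e) (W e') !E.
rewrite (C (lshift n b) (lshift n a)) (C (lshift n b) (rshift n a)).
rewrite (C (rshift n b) (lshift n a)) (C (rshift n b) (rshift n a)).
move: (cpartial _ _ z) (cpartial _ _ z) (cpartial _ _ z) (cpartial _ _ z) => *; ring.
Qed.

Lemma dzbar_conj a f : csmooth_on U f -> dzbar a (fun w => (f w)^*%C) z = (dz a f z)^*%C.
Proof.
move=> fs; rewrite /dz /dzbar !(cpartial_conj Uz) //.
case: (cpartial _ _ _) => x y; case: (cpartial _ _ _) => x' y'.
have -> : 2%:R^-1 = (2%:R^-1 : R)%:C%C by rewrite fmorphV /= rmorph_nat.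
by apply: complex_eq => /=; ring.
Qed.

Lemma dz_conj a f : csmooth_on U f -> dz a (fun w => (f w)^*%C) z = (dzbar a f z)^*%C.
Proof.
move=> fs; have := dzbar_conj a (csmooth_on_conj Uo fs).
have -> : (fun w => ((f w)^*%C)^*%C) = f by apply/funext => w; exact: conjcK.
by move=> ->; rewrite conjcK.
Qed.

Lemma wirtinger_outer e a u (p : R -> R) (d : R) :
  is_derive (u z) 1 p d -> smooth_on U u ->
  wirtinger e a (fun w => (p (u w))%:C%C) z = d%:C%C * wirtinger e a (fun w => (u w)%:C%C) z.
Proof.
move=> pd us.
have E j : cpartial j (fun w => (p (u w))%:C%C) z = d%:C%C * cpartial j (fun w => (u w)%:C%C) z.
  have [_ D] := is_derive_outer pd (derivableP (smooth_on_derivable (j := j) us Uz)).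
  rewrite /cpartial /= !derive_cst; apply: complex_eq => /=; last by ring.
  by rewrite mulr0 subr0 -D.
rewrite /wirtinger !E; move: (cpartial _ _ z) (cpartial _ _ z) => *; ring.
Qed.

(** Jacobi's formula.  By the Leibniz rule the derivative of the determinant is the
    sum over k of the determinants with row k differentiated; each of them is
    expanded along that row. *)
Lemma wirtinger_det e a m (G : coords R n -> 'M[R[i]]_m) :
  (forall k l, csmooth_on U (fun w => G w k l)) ->
  wirtinger e a (fun w => \det (G w)) z =
  \sum_k \sum_l wirtinger e a (fun w => G w k l) z * cofactor (G z) k l.
Proof.
move=> Gs; rewrite /determinant wirtinger_sum; last first.
  move=> s _; apply: csmooth_onM => //; first exact: csmooth_on_cst.
  by apply: csmooth_on_prod => // i _; exact: Gs.
pose D k := \matrix_(i, l) (if i == k then wirtinger e a (fun w => G w k l) z else G z i l).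
have -> : \sum_k \sum_l wirtinger e a (fun w => G w k l) z * cofactor (G z) k l =
   \sum_k \det (D k).
  apply: eq_bigr => k _; rewrite (expand_det_row _ k); apply: eq_bigr => l _.
  rewrite mxE eqxx; congr (_ * _); rewrite /cofactor; congr (_ * \det _).
  by apply/matrixP => i j; rewrite !mxE eq_sym (negbTE (neq_lift _ _)).
rewrite /determinant exchange_big /=; apply: eq_bigr => s _.
rewrite wirtingerZ; last by apply: csmooth_on_prod => // i _; exact: Gs.
rewrite (wirtinger_prod e a (index_enum_uniq _) (fun i => Gs i _)).
rewrite mulr_sumr; apply: eq_bigr => k _; congr (_ * _); apply: eq_bigr => i _.
by rewrite mxE; case: eqP => // ->.
Qed.

End AtPoint.
End OnOpen.
End Wirtinger.

(** * The complex Hessian at a local maximum *)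

Section MaximumPrinciple.
Context {R : realType} {n : nat}.
Variable U : set (coords R n).
Hypothesis Uo : open U.
Implicit Types (u : coords R n -> R).

Lemma derive2_sum_coord u z (v : coords R n) : smooth_on U u -> U z ->
  'D_v ('D_v u) z = \sum_j \sum_k v 0 j * v 0 k * 'D_(delta_mx 0 j) ('D_(delta_mx 0 k) u) z.
Proof.
move=> us Uz; have [_ ->] := derive_sum_coord Uo v (smooth_on_derive_dir Uo v us) Uz.
apply: eq_bigr => j _; under [RHS]eq_bigr do rewrite -mulrA; rewrite -mulr_sumr; congr (_ * _).
have nU := open_nbhs_nbhs (conj Uo Uz).
have D k : is_derive z (delta_mx 0 j) (v 0 k *: 'D_(delta_mx 0 k) u)
  (v 0 k *: 'D_(delta_mx 0 j) ('D_(delta_mx 0 k) u) z).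
  apply: is_deriveZ; apply: derivableP.
  exact: (smooth_on_derivable (j := j) (smooth_on_derive k us) Uz).
have [_ <-] := is_derive_sum D.
apply: near_eq_derive; apply: filterS nU => w Uw.
have [_ ->] := derive_sum_coord Uo v us Uw.
by rewrite fct_sumE.
Qed.

Lemma cpartial_real j u z : cpartial j (fun w => (u w)%:C%C) z = ('D_(delta_mx 0 j) u z)%:C%C.
Proof. by rewrite /cpartial /= derive_cst. Qed.

Lemma Re_sum (I : Type) (r : seq I) (P : pred I) (F : I -> R[i]) :
  complex.Re (\sum_(i <- r | P i) F i) = \sum_(i <- r | P i) complex.Re (F i).
Proof. by elim/big_rec2: _ => // i x y _ <-; rewrite Re_add. Qed.

Lemma double_sum_split (F : 'I_(n + n) -> 'I_(n + n) -> R) :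
  \sum_j \sum_k F j k = \sum_(a < n) \sum_(b < n)
    (F (lshift n a) (lshift n b) + F (lshift n a) (rshift n b) +
     (F (rshift n a) (lshift n b) + F (rshift n a) (rshift n b))).
Proof.
rewrite big_split_ord /= -big_split /=; apply: eq_bigr => a _.
by rewrite !big_split_ord /= -!big_split.
Qed.

(** On the complex line spanned by v the complex Hessian is a quarter of the
    Laplacian: the second derivatives along v and along i v are added.  The real
    parts of the two sides agree entry by entry. *)
Lemma complex_hessian_eval u z (v : 'rV[R[i]]_n) : smooth_on U u -> U z ->
  let x := \row_a complex.Re (v 0 a) in let y := \row_a complex.Im (v 0 a) in
  complex.Re (\sum_a \sum_b complex_hessian u z a b * v 0 a * (v 0 b)^*%C) =
  4%:R^-1 * ('D_(row_mx x y) ('D_(row_mx x y) u) z +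
             'D_(row_mx (- y) x) ('D_(row_mx (- y) x) u) z).
Proof.
move=> us Uz x y; pose d j k := 'D_(delta_mx 0 j) ('D_(delta_mx 0 k) u) z.
have D2 w : 'D_w ('D_w u) z = \sum_j \sum_k w 0 j * w 0 k * d j k.
  exact: derive2_sum_coord.
rewrite (D2 (row_mx x y)) (D2 (row_mx (- y) x)) !double_sum_split.
rewrite Re_sum -big_split mulr_sumr; apply: eq_bigr => a _.
rewrite Re_sum -big_split mulr_sumr; apply: eq_bigr => b _ /=.
rewrite !row_mxEl !row_mxEr !mxE.
have cs := csmooth_on_real us.
have E j : cpartial j (dzbar b (fun w => (u w)%:C%C)) z =
  2%:R^-1 * ((d j (lshift n b))%:C%C + 'i%C * (d j (rshift n b))%:C%C).
  have e k : cpartial k (fun w => (u w)%:C%C) = fun w => ('D_(delta_mx 0 k) u w)%:C%C.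
    by apply/funext => w; rewrite cpartial_real.
  have := cpartial_wirtinger Uo Uz 'i%C b j cs.
  by rewrite !e !cpartial_real.
rewrite /dz !E.
move: (d (lshift n a) (lshift n b)) (d (lshift n a) (rshift n b))
  (d (rshift n a) (lshift n b)) (d (rshift n a) (rshift n b)) => d1 d2 d3 d4.
case: (v 0 a) => xa ya; case: (v 0 b) => xb yb.
have -> : 2%:R^-1 = (2%:R^-1 : R)%:C%C by rewrite fmorphV /= rmorph_nat.
by rewrite /=; field.
Qed.

Lemma complex_hessian_local_max u z (v : 'rV[R[i]]_n) : smooth_on U u -> U z ->
  (\forall w \near z, u w <= u z) ->
  complex.Re (\sum_a \sum_b complex_hessian u z a b * v 0 a * (v 0 b)^*%C) <= 0.
Proof.
move=> us Uz um; rewrite complex_hessian_eval // pmulr_rle0 ?invr_gt0//.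
rewrite -[X in _ <= X]addr0.
by apply: lerD; exact: (second_derivative_le0 Uo _ us Uz um).
Qed.

End MaximumPrinciple.

(** * Simultaneous diagonalization of Hermitian forms *)

Section SimultaneousDiagonalization.
Context {C : numClosedFieldType} {n : nat}.
Local Notation "M ^t*" := (map_mx Num.conj (M^T)) (at level 30).
Implicit Types (G P : 'M[C]_n).

Definition posdefmx G := G^t* = G /\ forall v : 'rV[C]_n, v != 0 -> 0 < (v *m G *m v^t*) 0 0.

Lemma adjmxM m p q (A : 'M[C]_(m, p)) (B : 'M[C]_(p, q)) : (A *m B)^t* = B^t* *m A^t*.
Proof. by rewrite trmx_mul map_mxM. Qed.

Lemma adjmxK m p (A : 'M[C]_(m, p)) : (A^t*)^t* = A.
Proof. by apply/matrixP => i j; rewrite !mxE conjCK. Qed.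

Lemma posdefmx_congr G P : P \in unitmx -> posdefmx G -> posdefmx (P *m G *m P^t*).
Proof.
move=> Pu [Gh Gp]; split; first by rewrite !adjmxM adjmxK Gh mulmxA.
move=> v v0; rewrite !mulmxA -mulmxA -adjmxM; apply: Gp.
by apply: contra_neq v0 => vP; rewrite -[v](mulmxK Pu) vP mul0mx.
Qed.

Lemma posdefmx_diagonal G : posdefmx G -> exists (P : 'M[C]_n) (d : 'rV[C]_n),
  [/\ P *m P^t* = 1%:M, P *m G *m P^t* = diag_mx d & forall i, 0 < d 0 i].
Proof.
move=> [Gh Gp]; pose P := spectralmx G; pose d := spectral_diag G.
have Pu : P *m P^t* = 1%:M by apply/unitarymxP; exact: spectral_unitarymx.
have GE : G = invmx P *m diag_mx d *m P.
  apply/orthomx_spectralP; apply: hermitian_normalmx.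
  by apply/is_hermitianmxP; rewrite expr0 scale1r.
have D : P *m G *m P^t* = diag_mx d.
  rewrite {1}GE !mulmxA mulmxV ?spectral_unit // mul1mx -mulmxA.
  by rewrite Pu mulmx1.
exists P, d; split => // i.
have := Gp (row i P); rewrite -row_mul.
have -> : (row i (P *m G) *m (row i P)^t*) 0 0 = (P *m G *m P^t*) i i.
  by rewrite !mxE; apply: eq_bigr => k _; rewrite !mxE.
rewrite D !mxE eqxx mulr1n; apply; apply/eqP => r0.
have /matrixP/(_ i i) := Pu; rewrite !mxE eqxx big1.
  by move/eqP; rewrite eq_sym oner_eq0.
by move=> k _; have /rowP/(_ k) := r0; rewrite !mxE => ->; rewrite mul0r.
Qed.

(** The rows of a unitary matrix diagonalizing G are divided by the square roots
    of the eigenvalues. *)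
Lemma posdefmx_orthonormal G : posdefmx G -> exists P : 'M[C]_n,
  P \in unitmx /\ P *m G *m P^t* = 1%:M.
Proof.
move=> /posdefmx_diagonal[P [d [Pu D d0]]].
pose E := diag_mx (\row_i (sqrtC (d 0 i))^-1).
have Eh : E^t* = E.
  apply/matrixP => i j; rewrite !mxE eq_sym; case: eqP => [->|_]; last by rewrite !mulr0n rmorph0.
  rewrite !mulr1n; apply: CrealP; apply: ger0_real; rewrite invr_ge0 sqrtC_ge0; exact: ltW.
have EE : E *m diag_mx d *m E = 1%:M.
  rewrite /E !mulmx_diag; apply/matrixP => i j; rewrite !mxE.
  case: eqP => //= _; rewrite !mulr1n mulrAC -invfM -expr2 sqrtCK mulVf //.
  exact: lt0r_neq0.
exists (E *m P); rewrite adjmxM !mulmxA -(mulmxA E) -(mulmxA E) D Eh; split => //.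
have : (E *m diag_mx d *m E) \in unitmx by rewrite EE unitmx1.
rewrite !unitmx_mul => /andP[/andP[-> _] _] /=.
have : P *m P^t* \in unitmx by rewrite Pu unitmx1.
by rewrite unitmx_mul => /andP[].
Qed.

(** A frame orthonormal for G0 stays so after a unitary change, which can be
    chosen to diagonalize G1 in that frame. *)
Lemma simultaneous_diagonalization G0 G1 : posdefmx G0 -> posdefmx G1 ->
  exists (P : 'M[C]_n) (d : 'rV[C]_n), [/\ P *m G0 *m P^t* = 1%:M,
    P *m G1 *m P^t* = diag_mx d & forall i, 0 < d 0 i].
Proof.
move=> /posdefmx_orthonormal[P [Pu P1]] /(posdefmx_congr Pu).
move=> /posdefmx_diagonal[V [d [Vu D d0]]].
exists (V *m P), d; split => //; rewrite adjmxM.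
  by rewrite -!mulmxA (mulmxA P) (mulmxA (P *m G0)) P1 mul1mx.
by rewrite -D !mulmxA.
Qed.

Section Frame.
Variables (G P : 'M[C]_n) (d : 'rV[C]_n).
Hypotheses (PG : P *m G *m P^t* = diag_mx d) (d_gt0 : forall i, 0 < d 0 i).

Lemma frame_diag_unit : diag_mx d \in unitmx.
Proof.
rewrite unitmxE det_diag unitfE; apply/prodf_neq0 => i _.
exact: lt0r_neq0.
Qed.

Lemma frame_unit : G \in unitmx.
Proof. by have := frame_diag_unit; rewrite -PG !unitmx_mul => /andP[/andP[]]. Qed.

Lemma frame_invmx : invmx G = P^t* *m diag_mx (\row_i (d 0 i)^-1) *m P.
Proof.
set E := diag_mx _.
have ED : E *m diag_mx d = 1%:M.
  rewrite /E mulmx_diag; apply/matrixP => i j; rewrite !mxE.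
  by case: eqP => //= _; rewrite !mulr1n mulVf // lt0r_neq0.
have : P^t* *m (E *m P *m G) = 1%:M.
  by apply: mulmx1C; rewrite -!mulmxA (mulmxA P) PG.
move=> H; rewrite -[RHS](mulmxK frame_unit).
by move: H; rewrite !mulmxA => ->; rewrite mul1mx.
Qed.

Lemma frame_trace S : \tr (invmx G *m S) = \sum_i (d 0 i)^-1 * (P *m S *m P^t*) i i.
Proof.
rewrite frame_invmx -!mulmxA mxtrace_mulC -!mulmxA /mxtrace; apply: eq_bigr => i _.
by rewrite mul_diag_mx !mxE.
Qed.

Lemma frame_det : (\det P * (\det P)^*) * \det G = \prod_i d 0 i.
Proof.
by rewrite -det_diag -PG !det_mulmx det_map_mx det_tr mulrAC.
Qed.

Lemma frame_det_neq0 : \det P * (\det P)^* != 0.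
Proof.
have := frame_diag_unit; rewrite unitmxE unitfE det_diag -frame_det.
by rewrite mulf_eq0 negb_or => /andP[].
Qed.

End Frame.
End SimultaneousDiagonalization.

(** * The pointwise estimate *)

Section TraceIdentities.
Context {R : realType} {n : nat}.
Implicit Types (G S : 'M[R[i]]_n).
Local Notation "M ^t*" := (map_mx (@conjc R) (M^T)) (at level 30).

Lemma conjcE (x : R[i]) : Num.conj x = x^*%C.
Proof. by []. Qed.

Lemma hermitian_posdefP G : hermitian_posdef G -> posdefmx G.
Proof.
move=> [Gh Gp]; split; first by apply/matrixP => a b; rewrite !mxE Gh conjcE conjcK.
move=> v /Gp; congr (0 < _); rewrite !mxE exchange_big; apply: eq_bigr => b _ /=.
by rewrite !mxE mulr_suml; apply: eq_bigr => a _; rewrite [G a b * _]mulrC.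
Qed.

Lemma trace_wrtE G S : trace_wrt G S = \tr (invmx G *m S).
Proof.
rewrite /trace_wrt /mxtrace exchange_big; apply: eq_bigr => b _.
by rewrite mxE; apply: eq_bigr.
Qed.

(** The cancellation at the heart of the estimate.  Here G0 is g, G1 is g_phi,
    B a is the derivative of g in the direction a, L a the third derivatives of phi
    involving a, p = dphi, q = dF, s is the gradient of phi and sg its prescribed
    derivative.  The hypothesis LE is the differentiated volume equation.  Both LE
    and the derivative sg of s produce traces of B a with respect to G0 and to G1;
    the Kaehler condition BS identifies them, and they cancel. *)
Lemma trace_holomorphic_part G0 G1 (B L : 'I_n -> 'M[R[i]]_n) (p q al s : 'rV[R[i]]_n)
  (sg : 'I_n -> 'rV[R[i]]_n) :
  G0 \in unitmx -> G1 \in unitmx ->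
  s *m G0 = map_mx (@conjc R) p ->
  (forall k c l, B k c l = B c k l) ->
  (forall k, sg k = - (s *m B k *m invmx G0)) ->
  (forall a, trace_wrt G1 (B a + L a) = q 0 a + trace_wrt G0 (B a)) ->
  trace_wrt G1 (\matrix_(k, l) (al 0 k * (s *m (G1 - G0)) 0 l
     + \sum_a s 0 a * L a k l + (sg k *m (G1 - G0)) 0 l)) =
  \sum_a (q 0 a + al 0 a) * s 0 a - trace_wrt G1 (al^T *m map_mx (@conjc R) p).
Proof.
move=> G0u G1u sG BS sgE LE.
have trD G S S' : trace_wrt G (S + S') = trace_wrt G S + trace_wrt G S'.
  by rewrite !trace_wrtE mulmxDr mxtraceD.
have trN G S : trace_wrt G (- S) = - trace_wrt G S.
  by rewrite !trace_wrtE mulmxN raddfN.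
pose Sg := \matrix_k sg k.
have -> : \matrix_(k, l) (al 0 k * (s *m (G1 - G0)) 0 l
     + \sum_a s 0 a * L a k l + (sg k *m (G1 - G0)) 0 l) =
  al^T *m (s *m (G1 - G0)) + \sum_a s 0 a *: L a + Sg *m (G1 - G0).
  apply/matrixP => k l; rewrite !mxE big_ord1 !mxE; congr (_ + _ + _).
    by rewrite summxE; apply: eq_bigr => a _; rewrite mxE.
  by apply: eq_bigr => a _; rewrite !mxE.
rewrite !trD.
have E1 : trace_wrt G1 (al^T *m (s *m (G1 - G0))) =
   \sum_a al 0 a * s 0 a - trace_wrt G1 (al^T *m map_mx (@conjc R) p).
  rewrite mulmxBr mulmxBr sG trD trN; congr (_ - _).
  rewrite trace_wrtE mxtrace_mulC -!mulmxA mulmxV // mulmx1 mxtrace_mulC /mxtrace big_ord1 mxE.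
  by apply: eq_bigr => a _; rewrite mxE mulrC.
have E2 : trace_wrt G1 (\sum_a s 0 a *: L a) =
   \sum_a s 0 a * (q 0 a + trace_wrt G0 (B a) - trace_wrt G1 (B a)).
  rewrite trace_wrtE mulmx_sumr raddf_sum; apply: eq_bigr => a _ /=.
  by rewrite -scalemxAr mxtraceZ -LE trD addrAC subrr add0r trace_wrtE.
have E3 : trace_wrt G1 (Sg *m (G1 - G0)) =
   - (\sum_a s 0 a * trace_wrt G0 (B a)) + \sum_a s 0 a * trace_wrt G1 (B a).
  have tS H : \sum_k (s *m B k *m invmx H) 0 k = \sum_c s 0 c * trace_wrt H (B c).
    transitivity (\sum_k \sum_c \sum_l s 0 c * (invmx H l k * B c k l)).
      apply: eq_bigr => k _; rewrite mxE exchange_big; apply: eq_bigr => l _ /=.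
      by rewrite mxE mulr_suml; apply: eq_bigr => c _; rewrite BS; ring.
    rewrite exchange_big; apply: eq_bigr => c _; rewrite mulr_sumr.
    by apply: eq_bigr => k _; rewrite mulr_sumr.
  rewrite trace_wrtE mxtrace_mulC -mulmxA mulmxBl mulmxV // mulmxBr mulmx1 raddfB.
  congr (_ + _).
    by rewrite -tS -sumrN; apply: eq_bigr => k _; rewrite /= !mxE sgE !mxE.
  rewrite -tS -sumrN; apply: eq_bigr => k _; rewrite mulmxA !mxE -sumrN.
  apply: eq_bigr => l _; rewrite -mulNr; congr (_ * _).
  have -> : (Sg *m G0) k l = (sg k *m G0) 0 l.
    by rewrite !mxE; apply: eq_bigr => c _; rewrite !mxE.
  by rewrite sgE mulNmx mulmxKV // mxE opprK.
rewrite E1 E2 E3.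
under [X in _ + X + _ = _]eq_bigr do rewrite mulrBr mulrDr.
under [in RHS]eq_bigr do rewrite mulrDl.
rewrite sumrB !big_split /=.
under [X in _ + (X + _ - _) + _ = _]eq_bigr do rewrite mulrC.
move: (trace_wrt _ _) (\sum_a _) (\sum_a _) (\sum_a _) (\sum_a _) => *; ring.
Qed.
End TraceIdentities.

Section Frames.
Context {R : realType} {n : nat}.
Implicit Types (G S : 'M[R[i]]_n).
Local Notation "M ^t*" := (map_mx (@conjc R) (M^T)) (at level 30).
Local Notation conjmx := (map_mx (@conjc R)).

Definition normsq (x : R[i]) : R := complex.Re x ^+ 2 + complex.Im x ^+ 2.

Lemma normsqE x : x * x^*%C = (normsq x)%:C%C.
Proof. by case: x => a b; apply: complex_eq => /=; rewrite /normsq /=; ring. Qed.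

Lemma normsq_ge0 x : 0 <= normsq x.
Proof. by rewrite addr_ge0 ?sqr_ge0. Qed.

Lemma norm_mul_le (x y : R[i]) (c : R) : normsq x <= c -> normsq y <= c -> `|x| * `|y| <= c%:C%C.
Proof.
have E (w : R[i]) : `|w| * `|w| = (normsq w)%:C%C by rewrite -normsqE -sqr_normc expr2.
move=> xc yc; case: (real_leP (normr_real x) (normr_real y)) => xy.
  by apply: (le_trans (ler_wpM2r (normr_ge0 y) xy)); rewrite E lecR.
by apply: (le_trans (ler_wpM2l (normr_ge0 x) (ltW xy))); rewrite E lecR.
Qed.

(** The mu i are the eigenvalues of g_phi relative to g, and their product is e^F.
    Since every inverse of mu i is at most c, each mu i is at most c ^ n.-1 times
    that product, so y i / mu i controls y i / e^F. *)
Lemma volume_product_bound (mu y : 'I_n -> R) (c : R) :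
  (forall i, 0 < mu i) -> (forall i, 0 <= y i) -> 1 <= c ->
  \sum_i (mu i)^-1 <= c -> \sum_i (mu i)^-1 * y i <= 2 * c ->
  \sum_i y i + 2 <= (\prod_i mu i) * (4 * c ^+ n.+1).
Proof.
move=> mu0 y0 c1 Tc Dc.
have c0 : 0 <= c by exact: le_trans c1.
have muc i : 0 <= (mu i)^-1 <= c.
  rewrite invr_ge0 ltW //=; apply: le_trans Tc; rewrite (bigD1 i) //= lerDl.
  by apply: sumr_ge0 => j _; rewrite invr_ge0 ltW.
have E0 : 0 < \prod_i mu i by exact: prodr_gt0.
have cn i : \prod_(j | j != i) (mu j)^-1 <= c ^+ n.
  apply: (@le_trans _ _ (\prod_(j < n | j != i) c)); first by apply: ler_prod => j _; exact: muc.
  rewrite -[X in c ^+ X](card_ord n) -prodr_const [X in _ <= X](bigD1 i) //=.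
  by rewrite ler_peMl // prodr_ge0.
have yb i : y i <= (\prod_i mu i) * (c ^+ n * ((mu i)^-1 * y i)).
  apply: (@le_trans _ _ ((\prod_i mu i) * ((\prod_(j | j != i) (mu j)^-1) * ((mu i)^-1 * y i)))).
    rewrite (bigD1 i) //= prodfV.
    have : \prod_(j | j != i) mu j != 0 by apply/prodf_neq0 => j _; exact: lt0r_neq0.
    have := lt0r_neq0 (mu0 i); move: (\prod_(j | _) _) => w m0 w0.
    by rewrite le_eqVlt; apply/orP; left; apply/eqP; field; rewrite m0 w0.
  rewrite ler_pM2l // ler_wpM2r // mulr_ge0 // invr_ge0; exact: ltW.
have N : \sum_i y i <= (\prod_i mu i) * (2 * c ^+ n.+1).
  apply: (le_trans (ler_sum _ (fun i _ => yb i))).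
  rewrite -mulr_sumr ler_pM2l // -mulr_sumr exprSr mulrCA ler_wpM2l ?exprn_ge0 //.
have O : 1 <= (\prod_i mu i) * c ^+ n.+1.
  have : (\prod_i mu i)^-1 <= c ^+ n.+1.
    rewrite -prodfV; apply: (@le_trans _ _ (\prod_(i < n) c)).
      by apply: ler_prod => j _; exact: muc.
    by rewrite prodr_const card_ord exprS ler_peMl // exprn_ge0.
  by move=> H; apply: le_trans (ler_wpM2l (ltW E0) H); rewrite mulfV ?lt0r_neq0.
by move: N O; move: (\prod_i _) (c ^+ _) (\sum_i _) => a b d; lra.
Qed.

Section Frame.
Variables (G0 G1 P : 'M[R[i]]_n) (mu : 'I_n -> R).
Hypotheses (PG0 : P *m G0 *m P^t* = 1%:M)
  (PG1 : P *m G1 *m P^t* = diag_mx (\row_m (mu m)%:C%C)) (mu_gt0 : forall m, 0 < mu m).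

(** The rows of P form a frame that is orthonormal for g and orthogonal for g_phi;
    [frame_coord v m] is the value of the covector v on its m-th vector. *)
Definition frame_coord (v : 'rV[R[i]]_n) m : R[i] := \sum_a v 0 a * P m a.

Lemma frame_trace1 S : trace_wrt G1 S = \sum_m ((mu m)^-1)%:C%C * (P *m S *m P^t*) m m.
Proof.
rewrite trace_wrtE (frame_trace PG1); last by move=> m; rewrite mxE ltcR.
by apply: eq_bigr => m _; rewrite mxE fmorphV.
Qed.

Lemma frame_one : P *m G0 *m P^t* = diag_mx (const_mx 1).
Proof. by rewrite PG0; apply/matrixP => i j; rewrite !mxE. Qed.

Lemma frame_trace0 S : trace_wrt G0 S = \sum_m (P *m S *m P^t*) m m.
Proof.
rewrite trace_wrtE (frame_trace frame_one); last by move=> m; rewrite mxE ltr01.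
by apply: eq_bigr => m _; rewrite mxE invr1 mul1r.
Qed.

Lemma frame_det_ratio : \det G1 = (\prod_m mu m)%:C%C * \det G0.
Proof.
have /= d1 := frame_det PG1; have /= d0 := frame_det frame_one.
have k0 := @frame_det_neq0 _ _ _ _ _ frame_one.
have : \prod_m (const_mx 1 : 'rV[R[i]]_n) 0 m = 1 by rewrite big1 // => m _; rewrite mxE.
move=> E; rewrite E in d0; apply: (@mulfI _ (\det P * (\det P)^*)).
  by apply: k0 => m; rewrite mxE ltr01.
rewrite d1 mulrCA d0 mulr1 rmorph_prod; apply: eq_bigr => m _; by rewrite mxE.
Qed.

Lemma frame_rank_one (v w : 'rV[R[i]]_n) m :
  (P *m (v^T *m conjmx w) *m P^t*) m m = frame_coord v m * (frame_coord w m)^*%C.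
Proof.
rewrite mulmxA -(mulmxA _ (conjmx w)) mxE big_ord1; congr (_ * _).
  by rewrite mxE; apply: eq_bigr => a _; rewrite mxE mulrC.
by rewrite mxE rmorph_sum; apply: eq_bigr => a _; rewrite !mxE rmorphM.
Qed.

Lemma frame_ginv_diag k : invmx G0 k k = (\sum_m normsq (P m k))%:C%C.
Proof.
rewrite (frame_invmx frame_one); last by move=> m; rewrite mxE ltr01.
rewrite mxE rmorph_sum; apply: eq_bigr => m _ /=.
by rewrite mul_mx_diag !mxE invr1 mulr1 mulrC normsqE.
Qed.

Section Bounds.
Variable B : R.
Hypothesis GB : forall k, complex.Re (invmx G0 k k) <= B.

(** The diagonal entries of the inverse of G0 are the sums of the squared entries
    of P along a column. *)
Lemma frame_entry_bound m k : normsq (P m k) <= B.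
Proof.
apply: le_trans (GB k); rewrite frame_ginv_diag /= (bigD1 m) //= lerDl.
by apply: sumr_ge0 => *; exact: normsq_ge0.
Qed.

Lemma frame_form_bound S (b : R) m : 0 <= b -> (forall k l, `|S k l| <= b%:C%C) ->
  `|complex.Re ((P *m S *m P^t*) m m)| <= (n * n)%:R * (b * B).
Proof.
move=> b0 Sb; rewrite -lecR; apply: le_trans (normc_ge_Re _) _.
rewrite mxE; apply: le_trans (ler_norm_sum _ _ _) _.
apply: (@le_trans _ _ (\sum_(l < n) \sum_(k < n) (b * B)%:C%C)); last first.
  rewrite !sumr_const !card_ord -mulrnA -[X in X <= _]mulr_natl.
  by rewrite [X in _ <= X]rmorphM /= rmorph_nat.
apply: ler_sum => l _; rewrite mxE mulr_suml; apply: le_trans (ler_norm_sum _ _ _) _.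
apply: ler_sum => k _; rewrite !mxE mulrAC normrM mulrC normrM rmorphM /=.
rewrite normcJ; apply: ler_pM => //; rewrite ?mulr_ge0 //.
exact: norm_mul_le (frame_entry_bound _ _) (frame_entry_bound _ _).
Qed.

End Bounds.
End Frame.
End Frames.

Section AlgebraicEstimate.
Context {R : realType} {n : nat}.
Implicit Types (G S : 'M[R[i]]_n).
Local Notation "M ^t*" := (map_mx (@conjc R) (M^T)) (at level 30).
Local Notation conjmx := (map_mx (@conjc R)).

Lemma Re_scale (x : R) (y : R[i]) : complex.Re (x%:C%C * y) = x * complex.Re y.
Proof. by rewrite Re_mul /= mul0r subr0. Qed.

Lemma frame_exists G0 G1 : hermitian_posdef G0 -> hermitian_posdef G1 ->
  exists (P : 'M[R[i]]_n) (mu : 'I_n -> R), [/\ P *m G0 *m P^t* = 1%:M,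
    P *m G1 *m P^t* = diag_mx (\row_m (mu m)%:C%C) & forall m, 0 < mu m].
Proof.
move=> /hermitian_posdefP h0 /hermitian_posdefP h1.
have [P [d [P0 P1 d0]]] := simultaneous_diagonalization h0 h1.
have dE m : d 0 m = (complex.Re (d 0 m))%:C%C by rewrite RRe_real // ger0_real ?ltW.
exists P, (fun m => complex.Re (d 0 m)); split => //.
  by rewrite [LHS]P1; congr diag_mx; apply/rowP => m; rewrite mxE -dE.
by move=> m; rewrite -ltcR -dE.
Qed.

(** N = |grad phi|^2, T = tr_phi g, D and E are the squared norms of dphi and dA for
    omega_phi and X is the real part of their product; hA is the Laplacian of A,
    while ric and cv are the traces of the Ricci form and of the curvature.  The
    square 2 E - 2 X + D / 2 is where the constant 2 in |grad phi|^2 + 2 matters: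
    half of D is left over. *)
Lemma gradient_real_arithmetic (A lam cR c0 Rb ph N T D E X hA ric cv : R) :
  0 <= cR -> 0 <= c0 -> lam = A + cR + c0 + 1 -> `|ph| <= A ->
  0 <= N -> 0 <= T -> 0 <= D ->
  `|ric| <= cR * T -> `|cv| <= c0 * N * T ->
  0 <= 2 * E - 2 * X + D / 2 ->
  hA = Rb - ric + (ph - lam) * (n%:R - T) + D ->
  (N + 2) * hA + 2 * E + 2 * ((ph - lam) * N - X) - cv <= 0 ->
  T + D / 2 <= `|Rb| + (lam + A) * (n%:R + 2).
Proof.
move=> cR0 c00 lamE phA N0 T0 D0 ricb cvb sq hAE main.
have n0 : 0 <= n%:R :> R by exact: ler0n.
have [ph1 ph2] : ph <= A /\ - A <= ph by move: phA; rewrite ler_norml => /andP[].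
have Rb1 : - `|Rb| <= Rb by rewrite lerNl -normrN ler_norm.
have ric1 : ric <= cR * T by apply: le_trans ricb; exact: ler_norm.
have cv1 : cv <= c0 * N * T by apply: le_trans cvb; exact: ler_norm.
have k1 : (1 + cR + c0) * T <= (lam - ph) * T by rewrite ler_wpM2r // lamE; lra.
have k2 : (lam - ph) * n%:R <= (lam + A) * n%:R by rewrite ler_wpM2r //; lra.
have k3 : (lam - ph) * N <= (lam + A) * N by rewrite ler_wpM2r //; lra.
have hb : - `|Rb| + (1 + c0) * T - (lam + A) * n%:R + D <= hA by rewrite hAE; lra.
have M0 : 0 < N + 2 by lra.
have hb' := ler_wpM2l (ltW M0) hb.
have lA : 0 <= lam + A by have := normr_ge0 ph; lra.
have c0T : 0 <= c0 * T by rewrite mulr_ge0.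
have ND : 0 <= N * D by rewrite mulr_ge0.
rewrite -subr_le0 -(pmulr_rle0 _ M0).
apply: le_trans main; rewrite -subr_ge0.
by move: hb'; lra.
Qed.

Section Curvature.
Variables (G0 P : 'M[R[i]]_n) (B : R).
Hypotheses (PG0 : P *m G0 *m P^t* = 1%:M) (GB : forall k, complex.Re (invmx G0 k k) <= B).
Variables (p s : 'rV[R[i]]_n).
Hypothesis sG : s *m G0 = conjmx p.
Let N := \sum_m normsq (frame_coord P p m).

(** s is the gradient of phi: the vector that g pairs with the conjugate of dphi. *)
Lemma dual_vectorE a : s 0 a = \sum_m (frame_coord P p m)^*%C * P m a.
Proof.
have G0u : G0 \in unitmx by apply: (frame_unit (frame_one PG0)) => m; rewrite mxE ltr01.
rewrite -[s](mulmxK G0u) sG (frame_invmx (frame_one PG0)); last by move=> m; rewrite mxE ltr01.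
have -> : diag_mx (\row_(m < n) ((const_mx 1 : 'rV[R[i]]_n) 0 m)^-1) = 1%:M.
  by apply/matrixP => k l; rewrite !mxE invr1.
rewrite mulmx1 mulmxA mxE; apply: eq_bigr => m _; congr (_ * _).
by rewrite mxE /frame_coord rmorph_sum; apply: eq_bigr => c _; rewrite !mxE rmorphM.
Qed.

Lemma dual_pairing : \sum_a p 0 a * s 0 a = N%:C%C.
Proof.
under eq_bigr do rewrite dual_vectorE mulr_sumr.
rewrite exchange_big /N rmorph_sum; apply: eq_bigr => m _ /=.
rewrite -normsqE {1}/frame_coord mulr_suml; apply: eq_bigr => a _; ring.
Qed.

Lemma dual_entries_bound a b : `|s 0 a| * `|s 0 b| <= (n * n)%:R * (N * B)%:C%C.
Proof.
have sa c : `|s 0 c| <= \sum_m `|frame_coord P p m| * `|P m c|.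
  rewrite dual_vectorE; apply: le_trans (ler_norm_sum _ _ _) _.
  by apply: ler_sum => m _; rewrite normrM normcJ.
apply: le_trans (ler_pM (normr_ge0 _) (normr_ge0 _) (sa a) (sa b)) _.
rewrite mulr_suml; apply: (@le_trans _ _ (\sum_(m < n) \sum_(k < n) (N * B)%:C%C)); last first.
  by rewrite !sumr_const !card_ord -mulrnA -[X in X <= _]mulr_natl.
apply: ler_sum => m _; rewrite mulr_sumr; apply: ler_sum => k _.
rewrite mulrACA rmorphM /=.
have pN j : normsq (frame_coord P p j) <= N.
  by rewrite /N (bigD1 j) //= lerDl; apply: sumr_ge0 => *; exact: normsq_ge0.
apply: ler_pM; rewrite ?mulr_ge0 //; first exact: norm_mul_le.
by apply: norm_mul_le; exact: (frame_entry_bound PG0 GB).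
Qed.

Lemma curvature_bound (Rm : 'M[R[i]]_n) (b : R) : 0 <= b -> (forall k l, `|Rm k l| <= b%:C%C) ->
  `|(s *m Rm *m s^t*) 0 0| <= ((n * n)%:R * (b * ((n * n)%:R * (N * B))))%:C%C.
Proof.
move=> b0 Rb; rewrite mxE; apply: le_trans (ler_norm_sum _ _ _) _.
apply: (@le_trans _ _ (\sum_(l < n) \sum_(k < n) (b * ((n * n)%:R * (N * B)))%:C%C)); last first.
  rewrite !sumr_const !card_ord -mulrnA -[X in X <= _]mulr_natl.
  by rewrite [X in _ <= X]rmorphM /= rmorph_nat.
apply: ler_sum => l _; rewrite mxE mulr_suml; apply: le_trans (ler_norm_sum _ _ _) _.
apply: ler_sum => k _; rewrite !mxE mulrAC normrM mulrC normrM normcJ rmorphM /=.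
apply: ler_pM; rewrite ?mulr_ge0 //.
by rewrite rmorphM /= rmorph_nat; exact: dual_entries_bound.
Qed.

End Curvature.

(** The whole argument at one point, as linear algebra: al = dA, HA is the complex
    Hessian of A and Rm the curvature of g.  The last hypothesis says that the
    Laplacian of the test function is nonpositive. *)
Lemma algebraic_gradient_estimate (G0 G1 Ric HA : 'M[R[i]]_n) (Rm : 'I_n -> 'I_n -> 'M[R[i]]_n)
    (p q al s : 'rV[R[i]]_n) (A B lam Rb ph F : R) :
  let cR := (n * n)%:R * (B * B) in
  let c0 := (n * n)%:R * ((n * n)%:R * (B * ((n * n)%:R * B)) * B) in
  hermitian_posdef G0 -> hermitian_posdef G1 -> 0 <= B ->
  (forall k, complex.Re (invmx G0 k k) <= B) -> (forall k l, `|Ric k l| <= B%:C%C) ->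
  (forall k l a b, `|Rm k l a b| <= B%:C%C) ->
  lam = A + cR + c0 + 1 -> `|ph| <= A -> s *m G0 = conjmx p ->
  q + al = (ph - lam)%:C%C *: p ->
  trace_wrt G1 HA = Rb%:C%C - trace_wrt G1 Ric +
    (ph - lam)%:C%C * (n%:R - trace_wrt G1 G0) + trace_wrt G1 (p^T *m conjmx p) ->
  \det G1 = (expR F)%:C%C * \det G0 ->
  \det G0 != 0 ->
  let Z := \sum_a (q 0 a + al 0 a) * s 0 a - trace_wrt G1 (al^T *m conjmx p) in
  complex.Re ((trace_wrt G0 (p^T *m conjmx p) + 2) * trace_wrt G1 HA +
     2 * trace_wrt G1 (al^T *m conjmx al) + (Z + Z^*%C) -
     trace_wrt G1 (\matrix_(k, l) (s *m Rm k l *m s^t*) 0 0)) <= 0 ->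
  complex.Re (trace_wrt G0 (p^T *m conjmx p)) + 2 <=
    expR F * (4 * (1 + `|Rb| + (lam + A) * (n%:R + 2)) ^+ n.+1).
Proof.
move=> cR c0 H0 H1 B0 GB RicB RmB lamE phA sG qal trA detE det0 Z main.
have [P [mu [PG0 PG1 mu0]]] := frame_exists H0 H1.
pose N := \sum_m normsq (frame_coord P p m).
pose T := \sum_m (mu m)^-1.
pose D := \sum_m (mu m)^-1 * normsq (frame_coord P p m).
pose E := \sum_m (mu m)^-1 * normsq (frame_coord P al m).
pose X := complex.Re (trace_wrt G1 (al^T *m conjmx p)).
have mui m : 0 <= (mu m)^-1 by rewrite invr_ge0 ltW.
have N0 : 0 <= N by apply: sumr_ge0 => *; exact: normsq_ge0.
have T0 : 0 <= T by apply: sumr_ge0.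
have D0 : 0 <= D by apply: sumr_ge0 => *; rewrite mulr_ge0 // normsq_ge0.
have tN : trace_wrt G0 (p^T *m conjmx p) = N%:C%C.
  rewrite (frame_trace0 PG0) rmorph_sum; apply: eq_bigr => m _.
  by rewrite frame_rank_one normsqE.
have tsq v : trace_wrt G1 (v^T *m conjmx v) =
  (\sum_m (mu m)^-1 * normsq (frame_coord P v m))%:C%C.
  rewrite (frame_trace1 PG1 mu0) rmorph_sum; apply: eq_bigr => m _.
  by rewrite frame_rank_one normsqE -rmorphM.
have tT : trace_wrt G1 G0 = T%:C%C.
  rewrite (frame_trace1 PG1 mu0) rmorph_sum; apply: eq_bigr => m _.
  by rewrite PG0 mxE eqxx mulr1.
have reT S (b : R) : (forall m, `|complex.Re ((P *m S *m P^t*) m m)| <= b) ->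
    `|complex.Re (trace_wrt G1 S)| <= b * T.
  move=> Sb; rewrite (frame_trace1 PG1 mu0) Re_sum; apply: le_trans (ler_norm_sum _ _ _) _.
  rewrite mulr_sumr; apply: ler_sum => m _.
  rewrite Re_scale normrM mulrC (ger0_norm (mui m)).
  by rewrite ler_wpM2r.
have TD : T + D / 2 <= `|Rb| + (lam + A) * (n%:R + 2).
  apply: (@gradient_real_arithmetic A lam cR c0 Rb ph N T D E X
    (complex.Re (trace_wrt G1 HA)) (complex.Re (trace_wrt G1 Ric))
    (complex.Re (trace_wrt G1 (\matrix_(k, l) (s *m Rm k l *m s^t*) 0 0)))) => //.
  - by rewrite !mulr_ge0.
  - by rewrite !mulr_ge0.
  - by apply: reT => m; exact: (frame_form_bound PG0 GB).
  - have -> : c0 * N * T = (n * n)%:R * ((n * n)%:R * (B * ((n * n)%:R * (N * B))) * B) * T.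
      by rewrite /c0; ring.
    apply: reT => m; apply: (frame_form_bound PG0 GB).
      by rewrite !mulr_ge0.
    by move=> k l; rewrite mxE; exact: (curvature_bound PG0 GB sG).
  - have -> : X = \sum_m (mu m)^-1 * complex.Re (frame_coord P al m * (frame_coord P p m)^*%C).
      rewrite /X (frame_trace1 PG1 mu0) Re_sum; apply: eq_bigr => m _.
      by rewrite frame_rank_one Re_scale.
    rewrite /E /D mulr_sumr mulr_sumr mulr_suml -sumrB -big_split.
    apply: sumr_ge0 => m _ /=.
    have -> : 2 * ((mu m)^-1 * normsq (frame_coord P al m)) -
        2 * ((mu m)^-1 * complex.Re (frame_coord P al m * (frame_coord P p m)^*%C)) +
        (mu m)^-1 * normsq (frame_coord P p m) / 2 =
      (mu m)^-1 * (normsq (2 * frame_coord P al m - frame_coord P p m) / 2).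
      move: (frame_coord P al m) (frame_coord P p m) (mu m)^-1 => [x1 x2] [y1 y2] w.
      by rewrite /normsq /=; field.
    by rewrite mulr_ge0 // divr_ge0 ?normsq_ge0.
  - rewrite trA tT tsq -/D -(rmorph_nat (real_complex R) n) -rmorphB -rmorphM !Re_add Re_opp.
    by [].
  - have <- : complex.Re Z = (ph - lam) * N - X.
      rewrite /Z Re_add Re_opp -/X; congr (_ - _).
      have -> : \sum_a (q 0 a + al 0 a) * s 0 a = (ph - lam)%:C%C * \sum_a p 0 a * s 0 a.
        rewrite mulr_sumr; apply: eq_bigr => a _.
        by have /rowP/(_ a) := qal; rewrite !mxE => ->; rewrite mulrA.
      by rewrite (dual_pairing PG0 sG) -/N -rmorphM.
    move: main; rewrite tN tsq -/E -(rmorph_nat (real_complex R) 2) -rmorphD -rmorphM.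
    rewrite !Re_add Re_opp Re_scale.
    have -> : complex.Re Z^*%C = complex.Re Z by case: (Z).
    by rewrite /Z !Re_add !Re_opp /=; lra.
have detR : \prod_m mu m = expR F.
  have := frame_det_ratio PG0 PG1; rewrite detE => /(mulIf det0).
  by case.
rewrite tN /= -detR; apply: volume_product_bound => //.
- by move=> i; exact: normsq_ge0.
- have nn : 0 <= n%:R :> R by exact: ler0n.
  have A0 : 0 <= A by exact: le_trans phA.
  have cR0 : 0 <= cR by rewrite !mulr_ge0.
  have c00 : 0 <= c0 by rewrite !mulr_ge0.
  have : 0 <= (lam + A) * (n%:R + 2) by apply: mulr_ge0; lra.
  by have := normr_ge0 Rb; lra.
- by move: TD; rewrite -/T; lra.
- by move: TD; rewrite -/D; lra.
Qed.
End AlgebraicEstimate.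

(** * Hermitian metrics and their derivatives *)

Section HermitianForms.
Context {R : realType} {n : nat}.
Implicit Types (G S : 'M[R[i]]_n).
Local Notation "M ^t*" := (map_mx (@conjc R) (M^T)) (at level 30).
Local Notation conjmx := (map_mx (@conjc R)).

Lemma posdef_det_gt0 G : hermitian_posdef G -> 0 < \det G.
Proof.
move=> /hermitian_posdefP /posdefmx_diagonal[P [d [Pu D d0]]].
have := congr1 determinant Pu; rewrite det_mulmx det_map_mx det_tr det1 => dP.
by have := frame_det D; rewrite dP mul1r => ->; exact: prodr_gt0.
Qed.

Lemma posdef_unit G : hermitian_posdef G -> G \in unitmx.
Proof. by move=> /posdef_det_gt0 d0; rewrite unitmxE unitfE lt0r_neq0. Qed.

Lemma trace_wrt_conj G S : hermitian_posdef G -> trace_wrt G (S^t*) = (trace_wrt G S)^*%C.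
Proof.
move=> Gp; have Gu := posdef_unit Gp; have [Gh _] := Gp.
have GE : G^t* = G by apply/matrixP => a b; rewrite !mxE Gh conjcK.
have IE : (invmx G)^t* = invmx G.
  have H : (invmx G)^t* *m G = 1%:M.
    rewrite -{2}GE -map_mxM -trmx_mul mulmxV // trmx1 map_mx1 //.
  by rewrite -[LHS](mulmxK Gu) H mul1mx.
rewrite !trace_wrtE -{1}IE -map_mxM -trmx_mul [in RHS]mxtrace_mulC /mxtrace rmorph_sum.
by apply: eq_bigr => m _; rewrite !mxE.
Qed.

(** Expand the squared length of s - conj (h) r, where r is the vector dual to p. *)
Lemma dual_inequality G (p s : 'rV[R[i]]_n) (h : R[i]) : hermitian_posdef G ->
  2 * complex.Re (h * \sum_a p 0 a * s 0 a) <=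
  normsq h * complex.Re (trace_wrt G (p^T *m conjmx p)) + complex.Re ((s *m G *m s^t*) 0 0).
Proof.
move=> Gp; have Gu := posdef_unit Gp; have [Gh Gpos] := Gp.
have GE : G^t* = G by apply/matrixP => a b; rewrite !mxE Gh conjcK.
pose r := conjmx p *m invmx G.
have rG : r *m G = conjmx p by rewrite mulmxKV.
pose t := s - h^*%C *: r.
have tt : 0 <= (t *m G *m t^t*) 0 0.
  have [->|t0] := eqVneq t 0; first by rewrite !mul0mx mxE.
  by have [_ /(_ t t0)/ltW] := hermitian_posdefP Gp.
have N1 : (r *m p^T) 0 0 = trace_wrt G (p^T *m conjmx p).
  by rewrite trace_wrtE mulmxA mxtrace_mulC mulmxA /mxtrace big_ord1.
have sp : (s *m p^T) 0 0 = \sum_a p 0 a * s 0 a.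
  by rewrite mxE; apply: eq_bigr => a _; rewrite mxE mulrC.
have Gr : G *m r^t* = p^T.
  rewrite -{1}GE -map_mxM -trmx_mul rG; apply/matrixP => a b; rewrite !mxE; exact: conjcK.
have cE m (A : 'M[R[i]]_(1, m)) (B : 'M[R[i]]_(m, 1)) : ((A *m B) 0 0)^*%C = (B^t* *m A^t*) 0 0.
  by rewrite -map_mxM -trmx_mul !mxE.
have E : (t *m G *m t^t*) 0 0 = (s *m G *m s^t*) 0 0 - h * (s *m p^T) 0 0
    - (h * (s *m p^T) 0 0)^*%C + (normsq h)%:C%C * (r *m p^T) 0 0.
  have tE : t^t* = s^t* - h *: r^t*.
    by apply/matrixP => a b; rewrite !mxE rmorphB rmorphM /= conjcK.
  rewrite tE /t mulmxBl !mulmxBr !mulmxBl -!scalemxAl -!scalemxAr.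
  rewrite -(mulmxA s G (r^t*)) -(mulmxA r G (r^t*)) Gr rG.
  have -> : conjmx p *m s^t* = (s *m p^T)^t*.
    by rewrite trmx_mul map_mxM trmxK.
  rewrite !mxE -normsqE rmorphM; ring.
move: tt; rewrite lecE E !Re_add !Re_opp Re_scale sp N1 => /andP[_].
have -> : complex.Re (h * \sum_a p 0 a * s 0 a)^*%C = complex.Re (h * \sum_a p 0 a * s 0 a).
  by case: (h * _).
by rewrite /=; lra.
Qed.

Section Hessian.
Variables (U : set (coords R n)).
Hypothesis Uo : open U.

Definition dz_dzbar (f : coords R n -> R[i]) z k l : R[i] := dz k (dzbar l f) z.

Lemma dz_eq a f g z : (forall w, U w -> f w = g w) -> U z -> dz a f z = dz a g z :> R[i].
Proof. by move=> fg Uz; rewrite !dzE; exact: (wirtinger_eq Uo). Qed.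

Lemma dzbar_eq a f g z : (forall w, U w -> f w = g w) -> U z -> dzbar a f z = dzbar a g z :> R[i].
Proof. by move=> fg Uz; rewrite !dzbarE; exact: (wirtinger_eq Uo). Qed.

Lemma dz_dzbar_eq f g z k l : (forall w, U w -> f w = g w) -> U z -> dz_dzbar f z k l =
    dz_dzbar g z k l.
Proof. by move=> fg Uz; apply: dz_eq => // w Uw; exact: dzbar_eq. Qed.

Lemma dz_dzbarD f g z k l : csmooth_on U f -> csmooth_on U g -> U z ->
  dz_dzbar (fun w => f w + g w) z k l = dz_dzbar f z k l + dz_dzbar g z k l.
Proof.
move=> fs gs Uz; rewrite /dz_dzbar.
rewrite (dz_eq k (f := dzbar l (fun w => f w + g w)) (g :=
  fun w => dzbar l f w + dzbar l g w)) //.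
  by rewrite !dzE (wirtingerD Uz) //; exact: csmooth_on_dzbar.
by move=> w Uw; rewrite !dzbarE; exact: (wirtingerD Uw).
Qed.

Lemma dz_dzbarZ c f z k l : csmooth_on U f -> U z ->
  dz_dzbar (fun w => c * f w) z k l = c * dz_dzbar f z k l.
Proof.
move=> fs Uz; rewrite /dz_dzbar.
rewrite (dz_eq k (f := dzbar l (fun w => c * f w)) (g := fun w => c * dzbar l f w)) //.
  by rewrite !dzE (wirtingerZ Uz) //; exact: csmooth_on_dzbar.
by move=> w Uw; rewrite !dzbarE; exact: (wirtingerZ Uw).
Qed.

Lemma dz_dzbarB f g z k l : csmooth_on U f -> csmooth_on U g -> U z ->
  dz_dzbar (fun w => f w - g w) z k l = dz_dzbar f z k l - dz_dzbar g z k l.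
Proof.
move=> fs gs Uz; rewrite (@dz_dzbar_eq _ (fun w => f w + (-1) * g w)) //; last by move=> w _;
  rewrite mulN1r.
rewrite dz_dzbarD ?dz_dzbarZ ?mulN1r //.
by apply: csmooth_onM => //; exact: csmooth_on_cst.
Qed.

Lemma dz_dzbar_sum (I : Type) (r : seq I) (F : I -> coords R n -> R[i]) z k l :
  (forall m, csmooth_on U (F m)) -> U z ->
  dz_dzbar (fun w => \sum_(m <- r) F m w) z k l = \sum_(m <- r) dz_dzbar (F m) z k l.
Proof.
move=> Fs Uz; rewrite /dz_dzbar.
rewrite (dz_eq k (f := dzbar l (fun w => \sum_(m <- r) F m w)) (g :=
  fun w => \sum_(m <- r) dzbar l (F m) w)) //.
  rewrite dzE (wirtinger_sum Uo Uz) //; last by move=> m _; exact: csmooth_on_dzbar.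
  by apply: eq_bigr => m _; rewrite dzE.
by move=> w Uw; rewrite dzbarE; exact: (wirtinger_sum Uo Uw).
Qed.

Lemma dz_dzbarM f g z k l : csmooth_on U f -> csmooth_on U g -> U z ->
  dz_dzbar (fun w => f w * g w) z k l = dz_dzbar f z k l * g z + dzbar l f z * dz k g z
    + (dz k f z * dzbar l g z + f z * dz_dzbar g z k l).
Proof.
move=> fs gs Uz; rewrite /dz_dzbar.
rewrite (dz_eq k (f := dzbar l (fun w => f w * g w)) (g :=
  fun w => dzbar l f w * g w + f w * dzbar l g w)) //.
  have fl := csmooth_on_dzbar Uo l fs; have gl := csmooth_on_dzbar Uo l gs.
  rewrite !dzE (wirtingerD Uz); [|exact: csmooth_onM|exact: csmooth_onM].
  by rewrite (wirtingerM Uz (- 'i%C) k fl gs) (wirtingerM Uz (- 'i%C) k fs gl).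
by move=> w Uw; rewrite !dzbarE; exact: (wirtingerM Uw).
Qed.

End Hessian.

Section Affine.
Variable z0 : coords R n.

(** Holomorphic functions with a prescribed value c and differential d at z0; they
    serve as the components of h and s. *)
Definition affine_fun (c : R[i]) (d : 'rV[R[i]]_n) (z : coords R n) : R[i] :=
  c + \sum_j d 0 j * (zcoord j z - zcoord j z0).

Lemma csmooth_on_zcoord U j : csmooth_on U (@zcoord R n j).
Proof. by split=> k; exact: Ck_on_coord. Qed.

Lemma csmooth_on_affine U c d : open U -> csmooth_on U (affine_fun c d).
Proof.
move=> Uo; apply: csmooth_onD => //; first exact: csmooth_on_cst.
apply: csmooth_on_sum => // j _; apply: csmooth_onM => //; first exact: csmooth_on_cst.
by apply: csmooth_onB => //; [exact: csmooth_on_zcoord|exact: csmooth_on_cst].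
Qed.

Lemma cpartial_zcoord (j : 'I_n) k (z : coords R n) : cpartial k (zcoord j) z =
  (k == lshift n j)%:R%:C%C + 'i%C * (k == rshift n j)%:R%:C%C.
Proof.
rewrite /cpartial /=; have [_ ->] := is_derive_coord (lshift n j) z (delta_mx 0 k).
have [_ ->] := is_derive_coord (rshift n j) z (delta_mx 0 k).
by rewrite !mxE /= !(eq_sym k); apply: complex_eq => /=; ring.
Qed.

Lemma wirtinger_zcoord e a j (z : coords R n) :
  wirtinger e a (zcoord j) z = (a == j)%:R * (2%:R^-1 * (1 + e * 'i%C)).
Proof.
rewrite /wirtinger !cpartial_zcoord eq_lrshift eq_rlshift !(inj_eq (@lshift_inj _ _))
  !(inj_eq (@rshift_inj _ _)).
by rewrite !rmorph_nat mulr0 addr0 add0r; ring.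
Qed.

Lemma wirtinger_affine e a c d (z : coords R n) :
  wirtinger e a (affine_fun c d) z = d 0 a * (2%:R^-1 * (1 + e * 'i%C)).
Proof.
have To : open [set: coords R n] by exact: openT.
have Tz : [set: coords R n] z by [].
have cs c' := csmooth_on_cst [set: coords R n] c'.
have zs j : csmooth_on [set: coords R n] (fun w => zcoord j w - zcoord j z0).
  by apply: csmooth_onB => //; exact: csmooth_on_zcoord.
rewrite (wirtingerD Tz) //; last first.
  by apply: csmooth_on_sum => // j _; exact: csmooth_onM.
rewrite wirtinger_cst add0r (wirtinger_sum To Tz); last by move=> j _; exact: csmooth_onM.
rewrite (bigD1 a) //= big1 ?addr0.
  rewrite (wirtingerZ Tz) // (wirtingerB To Tz)
    // ?wirtinger_cst ?wirtinger_zcoord ?eqxx ?subr0 ?mul1r //.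
  exact: csmooth_on_zcoord.
move=> j ja; rewrite (wirtingerZ Tz) // (wirtingerB To Tz) // ?wirtinger_cst ?wirtinger_zcoord;
  last exact: csmooth_on_zcoord.
by rewrite eq_sym (negbTE ja) mul0r subr0 mulr0.
Qed.

Lemma dz_affine a c d z : dz a (affine_fun c d) z = d 0 a.
Proof.
rewrite dzE wirtinger_affine mulNr -expr2 sqr_i opprK.
by rewrite (_ : 2%:R^-1 * (1 + 1) = 1) ?mulr1 //; field.
Qed.

Lemma dzbar_affine a c d z : dzbar a (affine_fun c d) z = 0.
Proof. by rewrite dzbarE wirtinger_affine -expr2 sqr_i subrr !mulr0. Qed.

Lemma affine_fun_center c d : affine_fun c d z0 = c.
Proof. by rewrite /affine_fun big1 ?addr0 // => j _; rewrite subrr mulr0. Qed.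

Lemma dz_dzbar_affine c d z k l : dz_dzbar (affine_fun c d) z k l = 0.
Proof.
rewrite /dz_dzbar (_ : dzbar l _ = fun=> 0); last by apply/funext => w; rewrite dzbar_affine.
by rewrite dzE wirtinger_cst.
Qed.
End Affine.
End HermitianForms.

Section MetricOnOpen.
Context {R : realType} {n : nat}.
Local Notation "M ^t*" := (map_mx (@conjc R) (M^T)) (at level 30).
Local Notation conjmx := (map_mx (@conjc R)).
Variable U : set (coords R n).
Hypothesis Uo : open U.

Lemma csmooth_on_det m (G : coords R n -> 'M[R[i]]_m) :
  (forall a b, csmooth_on U (fun z => G z a b)) -> csmooth_on U (fun z => \det (G z)).
Proof.
move=> Gs; apply: csmooth_on_sum => // s _; apply: csmooth_onM => //.
  exact: csmooth_on_cst.
by apply: csmooth_on_prod.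
Qed.

Lemma csmooth_on_cofactor m (G : coords R n -> 'M[R[i]]_m) k l :
  (forall a b, csmooth_on U (fun z => G z a b)) -> csmooth_on U (fun z => cofactor (G z) k l).
Proof.
move=> Gs; apply: csmooth_onM => //; first exact: csmooth_on_cst.
apply: csmooth_on_det => a b; apply: csmooth_on_eq (Gs (lift k a) (lift l b)) => // z _.
by rewrite !mxE.
Qed.

Section Metric.
Variable G : coords R n -> 'M[R[i]]_n.
Hypotheses (Gs : forall a b, csmooth_on U (fun z => G z a b))
  (Gp : forall z, U z -> hermitian_posdef (G z)).

Lemma csmooth_on_invmx k l : csmooth_on U (fun z => invmx (G z) k l).
Proof.
have d0 z : U z -> \det (G z) != 0 by move=> /Gp/posdef_det_gt0/lt0r_neq0.
apply: csmooth_on_eq (csmooth_onM Uo (csmooth_on_inv Uo d0 (csmooth_on_det Gs))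
  (csmooth_on_cofactor l k Gs)) => // z Uz.
by rewrite /invmx (posdef_unit (Gp Uz)) !mxE.
Qed.

Lemma smooth_on_log_det : smooth_on U (fun z => log_det (G z)).
Proof.
have [dr _] := csmooth_on_det Gs.
move=> k; apply: Ck_on_ln => // z /Gp/posdef_det_gt0.
by rewrite ltcE => /andP[_].
Qed.

Lemma dz_log_det a z : U z -> dz a (fun w => (log_det (G w))%:C%C) z =
  trace_wrt (G z) (\matrix_(k, l) dz a (fun w => G w k l) z).
Proof.
move=> Uz; have [dr _] := csmooth_on_det Gs.
have dp w : U w -> 0 < complex.Re (\det (G w)) /\ (complex.Re (\det (G w)))%:C%C = \det (G w).
  move=> /Gp/posdef_det_gt0 dp; rewrite RRe_real ?ger0_real ?ltW //; split => //.
  by move: dp; rewrite ltcE => /andP[_].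
have [dz0 dE] := dp z Uz.
rewrite dzE (wirtinger_outer Uz (- 'i%C) a (is_derive1_ln dz0) dr).
rewrite (wirtinger_eq Uo (- 'i%C) a (fun w Uw => (dp w Uw).2) Uz).
have iE : ((complex.Re (\det (G z)))^-1)%:C%C = (\det (G z))^-1 by rewrite [LHS]fmorphV;
  congr (_^-1); exact: dE.
rewrite (wirtinger_det Uo Uz) // iE [LHS]mulrC mulr_suml; apply: eq_bigr => k _.
rewrite mulr_suml; apply: eq_bigr => l _.
rewrite !mxE dzE /ginv /invmx (posdef_unit (Gp Uz)) !mxE; ring.
Qed.

(** Minus the curvature of the Chern connection of G in the directions k and l, with
    both indices lowered. *)
Definition curvature_form z k l : 'M[R[i]]_n :=
  \matrix_(a, b) dz_dzbar (fun w => G w a b) z k l -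
  (\matrix_(a, b) dz k (fun w => G w a b) z) *m invmx (G z) *m
  (\matrix_(a, b) dzbar l (fun w => G w a b) z).

Lemma csmooth_on_curvature k l a b : csmooth_on U (fun z => curvature_form z k l a b).
Proof.
have H : csmooth_on U (fun z => dz_dzbar (fun w => G w a b) z k l -
   \sum_d (\sum_c dz k (fun w => G w a c) z * invmx (G z) c d) * dzbar l (fun w => G w d b) z).
  apply: csmooth_onB => //; first by apply: csmooth_on_dz => //; exact: csmooth_on_dzbar.
  apply: csmooth_on_sum => // d _; apply: csmooth_onM => //; last exact: csmooth_on_dzbar.
  apply: csmooth_on_sum => // c _; apply: csmooth_onM => //; first exact: csmooth_on_dz.
  exact: csmooth_on_invmx.
apply: csmooth_on_eq H => // z _; rewrite !mxE; congr (_ - _); apply: eq_bigr => d _.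
by rewrite !mxE; congr (_ * _); apply: eq_bigr => c _; rewrite mxE.
Qed.

End Metric.

(** In a frame diagonalizing H1 the trace is a positive combination of values of the
    Hermitian form of the Hessian. *)
Lemma trace_hessian_local_max (H1 : 'M[R[i]]_n) (u : coords R n -> R) z : hermitian_posdef H1 ->
  smooth_on U u -> U z -> (\forall w \near z, u w <= u z) ->
  complex.Re (trace_wrt H1 (complex_hessian u z)) <= 0.
Proof.
move=> Hp us Uz um; have [P [mu [_ PG1 mu0]]] := frame_exists Hp Hp.
rewrite (frame_trace1 PG1 mu0) Re_sum.
rewrite -oppr_ge0 -sumrN; apply: sumr_ge0 => m _; rewrite Re_scale -mulrN mulr_ge0 //.
  by rewrite invr_ge0 ltW.
rewrite oppr_ge0; have := complex_hessian_local_max Uo (row m P) us Uz um.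
congr (complex.Re _ <= 0); rewrite mxE exchange_big; apply: eq_bigr => b _ /=.
rewrite [(P *m _) m b]mxE mulr_suml; apply: eq_bigr => a _.
rewrite [row m P 0 a]mxE [row m P 0 b]mxE [(map_mx _ _) b m]mxE [P^T b m]mxE.
by move: (complex_hessian u z a b) => H; ring.
Qed.

End MetricOnOpen.

Section HessianRules.
Context {R : realType} {n : nat}.
Variable U : set (coords R n).
Hypothesis Uo : open U.
Implicit Types (f : coords R n -> R[i]) (u : coords R n -> R).

Lemma dz_dzbar_comm a b f z : csmooth_on U f -> U z -> dz a (dzbar b f) z = dzbar b (dz a f) z.
Proof.
move=> fs Uz; rewrite dzE dzbarE -/(wirtinger 'i%C b f).
rewrite (wirtinger_comm Uo Uz (- 'i%C) 'i%C a b fs).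
by apply: (wirtinger_eq Uo) => // w _; rewrite dzE.
Qed.

Lemma dz_comm a b f z : csmooth_on U f -> U z -> dz a (dz b f) z = dz b (dz a f) z.
Proof.
move=> fs Uz; rewrite [LHS]dzE [RHS]dzE.
rewrite (wirtinger_eq Uo _ _ (g := wirtinger (- 'i%C) b f)) //; last by move=> w _; rewrite dzE.
rewrite (wirtinger_comm Uo Uz _ _ a b fs).
by apply: (wirtinger_eq Uo) => // w _; rewrite dzE.
Qed.

Lemma dz_dzbar_dz a f z k l : csmooth_on U f -> U z ->
  dz a (fun w => dz_dzbar f w k l) z = dz_dzbar (dz a f) z k l.
Proof.
move=> fs Uz; rewrite [LHS](dz_comm a k (csmooth_on_dzbar Uo l fs) Uz).
by apply: (dz_eq Uo) => // w Uw; exact: dz_dzbar_comm.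
Qed.

Lemma dz_dzbar_conj f z k l : csmooth_on U f -> U z ->
  dz_dzbar (fun w => (f w)^*%C) z k l = (dz_dzbar f z l k)^*%C.
Proof.
move=> fs Uz; rewrite /dz_dzbar.
rewrite (dz_eq Uo k (g := fun w => (dz l f w)^*%C)) //; last by move=> w Uw;
  exact: (dzbar_conj Uw).
rewrite (dz_conj Uo Uz) //; last exact: csmooth_on_dz.
by rewrite dz_dzbar_comm.
Qed.

(** Passing to real parts replaces a complex Hessian by its Hermitian part. *)
Lemma complex_hessian_Re (f : coords R n -> R[i]) z : csmooth_on U f -> U z ->
  complex_hessian (fun w => complex.Re (f w)) z =
  \matrix_(k, l) (2%:R^-1 * (dz_dzbar f z k l + (dz_dzbar f z l k)^*%C)).
Proof.
move=> fs Uz; apply/matrixP => k l; rewrite !mxE -(dz_dzbar_conj _ _ fs Uz)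
  -(dz_dzbarD Uo k l fs (csmooth_on_conj Uo fs) Uz).
rewrite -(dz_dzbarZ Uo _ k l (csmooth_onD Uo fs (csmooth_on_conj Uo fs)) Uz).
apply: (dz_dzbar_eq Uo) => // w _.
rewrite ReJ_add mulrC; congr (_ * _).
Qed.

Lemma trace_hessian_Re (H1 : 'M[R[i]]_n) f z : hermitian_posdef H1 -> csmooth_on U f -> U z ->
  complex.Re (trace_wrt H1 (complex_hessian (fun w => complex.Re (f w)) z)) =
  complex.Re (trace_wrt H1 (\matrix_(k, l) dz_dzbar f z k l)).
Proof.
move=> Hp fs Uz; rewrite complex_hessian_Re //.
set S := \matrix_(k, l) dz_dzbar f z k l.
have -> : \matrix_(k, l) (2%:R^-1 * (dz_dzbar f z k l + (dz_dzbar f z l k)^*%C)) =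
    2%:R^-1 *: (S + map_mx (@conjc R) (S^T)) by apply/matrixP => k l; rewrite !mxE.
rewrite trace_wrtE -scalemxAr mulmxDr linearZ linearD /= -!trace_wrtE trace_wrt_conj //.
have -> : 2%:R^-1 = (2%:R^-1 : R)%:C%C by rewrite fmorphV /= rmorph_nat.
rewrite Re_scale Re_add.
have -> : complex.Re (trace_wrt H1 S)^*%C = complex.Re (trace_wrt H1 S) by case: (trace_wrt _ _).
by lra.
Qed.

Lemma dz_outer a u (p : R -> R) d z : is_derive (u z) 1 p d -> smooth_on U u -> U z ->
  dz a (fun w => (p (u w))%:C%C) z = d%:C%C * dz a (fun w => (u w)%:C%C) z.
Proof. by move=> pd us Uz; rewrite !dzE; exact: (wirtinger_outer Uz). Qed.

Lemma dzbar_real a u z : smooth_on U u -> U z ->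
  dzbar a (fun w => (u w)%:C%C) z = (dz a (fun w => (u w)%:C%C) z)^*%C.
Proof.
move=> us Uz; have := dzbar_conj Uz a (csmooth_on_real us).
have -> : (fun w => ((u w)%:C%C)^*%C) = (fun w => (u w)%:C%C).
  by apply/funext => w; exact: conjc_real.
by [].
Qed.

Lemma dzbar_outer a u (p : R -> R) d z : is_derive (u z) 1 p d -> smooth_on U u -> U z ->
  dzbar a (fun w => (p (u w))%:C%C) z = d%:C%C * dzbar a (fun w => (u w)%:C%C) z.
Proof. by move=> pd us Uz; rewrite !dzbarE; exact: (wirtinger_outer Uz). Qed.

Lemma is_derive_scaled_expN (m x : R) :
  is_derive x 1 (fun x => m * expR (- x)) (- (m * expR (- x))).
Proof.
have d1 : is_derive x 1 (fun x : R => expR (- x)) (- expR (- x)).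
  have := @is_derive1_comp R expR (fun x => - x) x _ _ (is_derive_expR _) (is_deriveNid x 1).
  by rewrite mulrN1.
by have := is_deriveZ m d1; rewrite /GRing.scale /= mulrN.
Qed.

Lemma dz_dzbar_expN u (m : R) z k l : smooth_on U u -> U z ->
  dz_dzbar (fun w => (m * expR (- u w))%:C%C) z k l =
  (m * expR (- u z))%:C%C * (dz k (fun w => (u w)%:C%C) z * dzbar l (fun w => (u w)%:C%C) z
     - dz_dzbar (fun w => (u w)%:C%C) z k l).
Proof.
move=> us Uz; pose e w := m * expR (- u w).
have ed := is_derive_scaled_expN m.
have es : smooth_on U e.
  move=> j; apply: Ck_onM => //; first exact: Ck_on_cst.
  by apply: Ck_on_expR => //; apply: Ck_onN.
have uC := csmooth_on_real us; have eC := csmooth_on_real es.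
have ul := csmooth_on_dzbar Uo l uC.
rewrite /dz_dzbar (dz_eq Uo k (g := fun w => (-1) * ((e w)%:C%C * dzbar l (fun w => (u w)%:C%C)
  w))) //; last first.
  by move=> w Uw; rewrite (dzbar_outer l (ed (u w)) us Uw) -/(e w) rmorphN;
    move: (dzbar l _ w) => d; ring.
have em : csmooth_on U (fun w => (e w)%:C%C * dzbar l (fun w => (u w)%:C%C) w)
  by exact: csmooth_onM.
rewrite dzE (wirtingerZ Uz) // (wirtingerM Uz) // -!dzE.
rewrite (dz_outer k (ed (u z)) us Uz) -/(e z) rmorphN.
move: (dz k _ z) (dzbar l _ z) (dz k _ z) => *; ring.
Qed.

End HessianRules.

(** * The test function *)

Section TestFunction.
Context {R : realType} {n : nat}.
Local Notation "M ^t*" := (map_mx (@conjc R) (M^T)) (at level 30).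
Local Notation conjmx := (map_mx (@conjc R)).
Variables (U : set (coords R n)) (G : coords R n -> 'M[R[i]]_n) (phi : coords R n -> R).
Hypotheses (Uo : open U) (Gs : forall a b, csmooth_on U (fun z => G z a b))
  (Gp : forall z, U z -> hermitian_posdef (G z)) (phis : smooth_on U phi).

Lemma completed_bound (a b N x y : R) : 0 <= a -> N + 2 <= b -> 2 * x <= a * N + y ->
  2 * x - y + a * (2 - b) <= 0.
Proof. by move=> a0 /(ler_wpM2l a0); lra. Qed.

Lemma trace_wrt_comb (H Y1 Y2 Y3 Y4 : 'M[R[i]]_n) (c : R[i]) :
  trace_wrt H (2 *: Y1 - Y2 + (2 *: Y3 + c *: Y4)) =
  2 * trace_wrt H Y1 - trace_wrt H Y2 + (2 * trace_wrt H Y3 + c * trace_wrt H Y4).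
Proof. by rewrite !trace_wrtE !(mulmxDr, mulmxN) -!scalemxAr !(linearD, linearN, linearZ). Qed.

Lemma comb_mxE (Y1 Y2 Y3 Y4 : 'M[R[i]]_n) (c : R[i]) k l :
  (2 *: Y1 - Y2 + (2 *: Y3 + c *: Y4)) k l =
  2 * Y1 k l - Y2 k l + (2 * Y3 k l + c * Y4 k l).
Proof. by rewrite !mxE. Qed.

(** The (1,0)-part of the differential of phi. *)
Definition dphi (w : coords R n) : 'rV[R[i]]_n := \row_a dz a (fun v => (phi v)%:C%C) w.

Definition local_grad_sqnorm (w : coords R n) : R :=
  complex.Re (trace_wrt (G w) ((dphi w)^T *m conjmx (dphi w))).

Variables (Af : coords R n -> R) (z0 : coords R n).
Hypotheses (Afs : smooth_on U Af) (Uz : U z0).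
Hypothesis amax : \forall w \near z0, 
  expR (Af w) * (local_grad_sqnorm w + 2) <= expR (Af z0) * (local_grad_sqnorm z0 + 2).

Let al : 'rV[R[i]]_n := \row_k dz k (fun w => (Af w)%:C%C) z0.
(* The gradient of phi at z0. *)
Let s0 := conjmx (dphi z0) *m invmx (G z0).
Let B k := \matrix_(a, b) dz k (fun w => G w a b) z0.
(* The derivative that makes s parallel at z0 for the Chern connection. *)
Let sg k := - (s0 *m B k *m invmx (G z0)).
Let h := affine_fun z0 1 al.
Let s a := affine_fun z0 (s0 0 a) (\row_k sg k 0 a).
Let M := local_grad_sqnorm z0 + 2.
Let m := expR (Af z0) * M.
Let W w := \sum_a dz a (fun v => (phi v)%:C%C) w * s a w.
Let Q w := \sum_a \sum_b s a w * G w a b * (s b w)^*%C.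
Let q w := (2 - m * expR (- Af w))%:C%C.
(* Twice h W stands for h W plus its conjugate: only the real part is used. *)
Let Psi w := 2 * (h w * W w) - Q w + h w * (h w)^*%C * q w.

Let phiC := csmooth_on_real phis.
Let hs : csmooth_on U h. Proof. exact: csmooth_on_affine. Qed.
Let ss a : csmooth_on U (s a). Proof. exact: csmooth_on_affine. Qed.
Let pas a : csmooth_on U (dz a (fun v => (phi v)%:C%C)). Proof. exact: csmooth_on_dz. Qed.
Let Ws : csmooth_on U W.
Proof. by apply: csmooth_on_sum => // a _; exact: csmooth_onM. Qed.
Let sGs a b : csmooth_on U (fun w => s a w * G w a b). Proof. exact: csmooth_onM. Qed.
Let scs b : csmooth_on U (fun w => (s b w)^*%C). Proof. exact: csmooth_on_conj. Qed.
Let Qs : csmooth_on U Q.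
Proof. by apply: csmooth_on_sum => // a _; apply: csmooth_on_sum => // b _;
  exact: csmooth_onM. Qed.
Let es : smooth_on U (fun w => m * expR (- Af w)).
Proof.
move=> j; apply: Ck_onM => //; first exact: Ck_on_cst.
by apply: Ck_on_expR => //; apply: Ck_onN.
Qed.
Let qE w : q w = 2 - (m * expR (- Af w))%:C%C.
Proof. by rewrite /q rmorphB /= rmorph_nat. Qed.
Let qs : csmooth_on U q.
Proof.
apply: csmooth_on_eq (csmooth_onB Uo (csmooth_on_cst U 2) (csmooth_on_real es)) => //.
Qed.
Let hhs : csmooth_on U (fun w => h w * (h w)^*%C).
Proof. by apply: csmooth_onM => //; exact: csmooth_on_conj. Qed.
Let hWs : csmooth_on U (fun w => h w * W w). Proof. exact: csmooth_onM. Qed.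

Let Psis : csmooth_on U Psi.
Proof.
apply: csmooth_onD => //; last exact: csmooth_onM.
by apply: csmooth_onB => //; apply: csmooth_onM => //; exact: csmooth_on_cst.
Qed.

Let h0 : h z0 = 1. Proof. exact: affine_fun_center. Qed.
Let sz0 a : s a z0 = s0 0 a. Proof. exact: affine_fun_center. Qed.
Let m0 : m * expR (- Af z0) = M.
Proof. by rewrite /m mulrAC -expRD subrr expR0 mul1r. Qed.

Let hessE a l : complex_hessian phi z0 a l = dzbar l (dz a (fun v => (phi v)%:C%C)) z0.
Proof. by rewrite [LHS]mxE (dz_dzbar_comm Uo _ _ phiC Uz). Qed.

Let W_dzbar l : dzbar l W z0 = (s0 *m complex_hessian phi z0) 0 l.
Proof.
rewrite dzbarE (wirtinger_sum Uo Uz); last by move=> a _; exact: csmooth_onM.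
rewrite mxE; apply: eq_bigr => a _; rewrite (wirtingerM Uz) // -!dzbarE.
by rewrite dzbar_affine mulr0 addr0 sz0 mulrC hessE.
Qed.

Let W_hess k l : dz_dzbar W z0 k l =
  \sum_a s0 0 a * dz_dzbar (dz a (fun v => (phi v)%:C%C)) z0 k l +
  (sg k *m complex_hessian phi z0) 0 l.
Proof.
rewrite (dz_dzbar_sum Uo) //; last by move=> a; exact: csmooth_onM.
rewrite [X in _ = _ + X]mxE -big_split; apply: eq_bigr => a _ /=.
rewrite (dz_dzbarM Uo) // dz_affine dzbar_affine dz_dzbar_affine !mulr0 addr0 addr0 sz0.
rewrite hessE [(\row__ _) 0 k]mxE; move: (dz_dzbar _ _ _ _) (dzbar _ _ _) => *; ring.
Qed.

Let hW_hess k l : dz_dzbar (fun w => h w * W w) z0 k l =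
  al 0 k * (s0 *m complex_hessian phi z0) 0 l +
  \sum_a s0 0 a * dz_dzbar (dz a (fun v => (phi v)%:C%C)) z0 k l +
  (sg k *m complex_hessian phi z0) 0 l.
Proof.
rewrite (dz_dzbarM Uo) // dz_dzbar_affine dzbar_affine !mul0r !add0r dz_affine h0 mul1r.
by rewrite W_dzbar W_hess addrA.
Qed.

Let s_conj_dz k b : dz k (fun w => (s b w)^*%C) z0 = 0.
Proof. by rewrite (dz_conj Uo Uz) // dzbar_affine conjc0. Qed.
Let s_conj_dzbar l b : dzbar l (fun w => (s b w)^*%C) z0 = (sg l 0 b)^*%C.
Proof. by rewrite (dzbar_conj Uz) // dz_affine mxE. Qed.
Let s_conj_hess k l b : dz_dzbar (fun w => (s b w)^*%C) z0 k l = 0.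
Proof. by rewrite (dz_dzbar_conj Uo) // dz_dzbar_affine conjc0. Qed.

(** Since sg is the derivative of a parallel section, the first derivatives of G
    enter only through the curvature. *)
Let Q_hess k l : dz_dzbar Q z0 k l = (s0 *m curvature_form G z0 k l *m s0^t*) 0 0.
Proof.
have Gu := posdef_unit (Gp Uz).
have E a b : dz_dzbar (fun w => s a w * G w a b * (s b w)^*%C) z0 k l =
  (sg k 0 a * dzbar l (fun w => G w a b) z0 + s0 0 a * dz_dzbar (fun w => G w a b) z0 k l)
    * (s0 0 b)^*%C
  + (sg k 0 a * G z0 a b + s0 0 a * B k a b) * (sg l 0 b)^*%C.
  rewrite (dz_dzbarM Uo) // s_conj_dz s_conj_dzbar s_conj_hess (dz_dzbarM Uo)
    // dz_dzbar_affine dzbar_affine.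
  rewrite [dz k (fun w => s a w * G w a b) z0]dzE (wirtingerM Uz)
    // -!dzE dz_affine sz0 sz0 [B k a b]mxE.
  rewrite [(\row__ _) 0 k]mxE; ring.
rewrite (dz_dzbar_sum Uo) //; last first.
  by move=> a; apply: csmooth_on_sum => // b _; exact: csmooth_onM.
have -> : \sum_a dz_dzbar (fun w => \sum_b s a w * G w a b * (s b w)^*%C) z0 k l =
  \sum_b (\sum_a (sg k 0 a * dzbar l (fun w => G w a b) z0 +
    s0 0 a * dz_dzbar (fun w => G w a b) z0 k l)) * (s0 0 b)^*%C
  + \sum_b (\sum_a (sg k 0 a * G z0 a b + s0 0 a * B k a b)) * (sg l 0 b)^*%C.
  rewrite -big_split /=.
  transitivity (\sum_a \sum_b dz_dzbar (fun w => s a w * G w a b * (s b w)^*%C) z0 k l).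
    apply: eq_bigr => a _; rewrite (dz_dzbar_sum Uo) // => b; exact: csmooth_onM.
  rewrite exchange_big; apply: eq_bigr => b _ /=.
  by rewrite !mulr_suml -big_split; apply: eq_bigr => a _; rewrite E.
rewrite [X in _ + X]big1 ?addr0; last first.
  move=> b _; rewrite big_split /=.
  have -> : \sum_a sg k 0 a * G z0 a b = (sg k *m G z0) 0 b by rewrite mxE.
  have -> : \sum_a s0 0 a * B k a b = (s0 *m B k) 0 b by rewrite mxE.
  by rewrite /sg mulNmx mulmxKV // mxE addNr mul0r.
rewrite [RHS]mxE; apply: eq_bigr => b _.
rewrite [(map_mx _ _) b 0]mxE [s0^T b 0]mxE; congr (_ * _).
rewrite /curvature_form mulmxBr mxE big_split [LHS]addrC /=; congr (_ + _).
  by rewrite [RHS]mxE; apply: eq_bigr => a _; rewrite [(\matrix_(_, _) _) a b]mxE.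
have -> : (- (s0 *m (B k *m invmx (G z0) *m \matrix_(a, b) dzbar l (fun w => G w a b) z0))) 0 b =
   (sg k *m \matrix_(a, b) dzbar l (fun w => G w a b) z0) 0 b.
  by rewrite /sg mulNmx !mulmxA.
by rewrite [RHS]mxE; apply: eq_bigr => a _; rewrite [(\matrix_(_, _) _) a b]mxE.
Qed.

(** The terms in dA have total coefficient 2 = (2 - M) + 2 M - M: they come from
    |dh|^2 q, from the cross terms and from the second derivative of exp (- A). *)
Let hhq_hess k l : dz_dzbar (fun w => h w * (h w)^*%C * q w) z0 k l =
  2 * (al 0 k * (al 0 l)^*%C) + M%:C%C * dz_dzbar (fun w => (Af w)%:C%C) z0 k l.
Proof.
have ed := is_derive_scaled_expN m.
have eC := csmooth_on_real es.
have c2 := csmooth_on_cst U (2 : R[i]).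
have qfE : q = (fun w => 2 - (m * expR (- Af w))%:C%C) by apply/funext => w; rewrite qE.
have q_dz : dz k q z0 = M%:C%C * al 0 k.
  rewrite qfE dzE (wirtingerB Uo Uz) // wirtinger_cst sub0r -dzE.
  by rewrite (dz_outer k (ed (Af z0)) Afs Uz) m0 [al 0 k]mxE rmorphN mulNr opprK.
have q_dzbar : dzbar l q z0 = M%:C%C * (al 0 l)^*%C.
  rewrite qfE dzbarE (wirtingerB Uo Uz) // wirtinger_cst sub0r -dzbarE.
  rewrite (dzbar_outer l (ed (Af z0)) Afs Uz) m0 [al 0 l]mxE rmorphN mulNr opprK.
  by rewrite (dzbar_real l Afs Uz).
have q_hess : dz_dzbar q z0 k l = - (M%:C%C * (al 0 k * (al 0 l)^*%C -
  dz_dzbar (fun w => (Af w)%:C%C) z0 k l)).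
  rewrite qfE (dz_dzbarB Uo k l c2 eC Uz) (dz_dzbar_expN Uo m k l Afs Uz)
    m0 (dzbar_real l Afs Uz) ![al 0 _]mxE.
  rewrite (_ : dz_dzbar (fun=> 2) z0 k l = 0) ?sub0r //.
  rewrite /dz_dzbar (_ : dzbar l (fun=> 2) = fun=> 0) ?dzE ?wirtinger_cst //.
  by apply/funext => w; rewrite dzbarE wirtinger_cst.
have q0 : q z0 = 2 - M%:C%C by rewrite qE m0.
have hc := csmooth_on_conj Uo hs.
have hc_dz : dz k (fun w => (h w)^*%C) z0 = 0 by rewrite (dz_conj Uo Uz) // dzbar_affine conjc0.
have hc_dzbar : dzbar l (fun w => (h w)^*%C) z0 =
  (al 0 l)^*%C by rewrite (dzbar_conj Uz) // dz_affine.
have hc_hess : dz_dzbar (fun w => (h w)^*%C) z0 k l =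
  0 by rewrite (dz_dzbar_conj Uo) // dz_dzbar_affine conjc0.
rewrite (dz_dzbarM Uo) // (dz_dzbarM Uo)
  // q_dz q_dzbar q_hess q0 hc_dz hc_dzbar hc_hess dz_dzbar_affine.
rewrite [dz k (fun w => h w * (h w)^*%C) z0]dzE (wirtingerM Uz) // -!dzE hc_dz dz_affine.
rewrite [dzbar l (fun w => h w * (h w)^*%C) z0]dzbarE (wirtingerM Uz)
  // -!dzbarE hc_dzbar dzbar_affine.
rewrite h0 conjc1; move: (dz_dzbar _ _ _ _) (al 0 k) (al 0 l)^*%C => *; ring.
Qed.

Let Psi_hess k l : dz_dzbar Psi z0 k l =
  2 * (al 0 k * (s0 *m complex_hessian phi z0) 0 l +
  \sum_a s0 0 a * dz_dzbar (dz a (fun v => (phi v)%:C%C)) z0 k l +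
  (sg k *m complex_hessian phi z0) 0 l)
  - (s0 *m curvature_form G z0 k l *m s0^t*) 0 0 +
  (2 * (al 0 k * (al 0 l)^*%C) + M%:C%C * dz_dzbar (fun w => (Af w)%:C%C) z0 k l).
Proof.
have c2 : csmooth_on U (fun w => 2 * (h w * W w)).
  by apply: csmooth_onM => //; exact: csmooth_on_cst.
rewrite (dz_dzbarD Uo) //; [|exact: csmooth_onB|exact: csmooth_onM].
by rewrite (dz_dzbarB Uo) // (dz_dzbarZ Uo) // hW_hess Q_hess hhq_hess.
Qed.

Let sG0 : s0 *m G z0 = conjmx (dphi z0).
Proof. by rewrite mulmxKV // posdef_unit //; exact: Gp. Qed.

(** By [dual_inequality], Psi w is at most |h|^2 (N + 2 - m e^(-A)) at w, which is
    nonpositive because z0 maximizes e^A (N + 2); and Psi vanishes at z0. *)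
Let Psi_max : \forall w \near z0, complex.Re (Psi w) <= complex.Re (Psi z0).
Proof.
have QE w : Q w = ((\row_a s a w) *m G w *m (\row_a s a w)^t*) 0 0.
  rewrite mxE /Q exchange_big; apply: eq_bigr => b _ /=.
  by rewrite !mxE mulr_suml; apply: eq_bigr => a _; rewrite !mxE.
have Psi0 : complex.Re (Psi z0) = 0.
  have -> : Psi z0 = 2 * W z0 - Q z0 + (2 - M)%:C%C.
    by rewrite /Psi h0 mul1r conjc1 !mul1r /q m0.
  have se : \row_a s a z0 = s0 by apply/rowP => a; rewrite mxE sz0.
  have W0 : W z0 = (s0 *m (dphi z0)^T) 0 0.
    rewrite [RHS]mxE; apply: eq_bigr => a _.
    by rewrite sz0 [(dphi z0)^T a 0]mxE [dphi z0 0 a]mxE mulrC.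
  have N0 : trace_wrt (G z0) ((dphi z0)^T *m conjmx (dphi z0)) = (s0 *m (dphi z0)^T) 0 0.
    by rewrite trace_wrtE mulmxA mxtrace_mulC mulmxA /mxtrace big_ord1.
  have Q0 : Q z0 = (W z0)^*%C.
    rewrite QE se sG0 W0 [LHS]mxE [(s0 *m _) 0 0]mxE rmorph_sum; apply: eq_bigr => a _.
    rewrite [(map_mx _ _) 0 a]mxE [(map_mx _ _) a 0]mxE [s0^T a 0]mxE.
    by rewrite [(dphi z0)^T a 0]mxE rmorphM mulrC.
  rewrite Re_add Re_add Re_opp Q0.
  have -> : complex.Re (W z0)^*%C = complex.Re (W z0) by case: (W z0).
  rewrite -(rmorph_nat (real_complex R) 2) Re_scale /= /M /local_grad_sqnorm N0 W0; ring.
rewrite Psi0; move: amax; apply: filter_app; have nU := open_nbhs_nbhs (conj Uo Uz).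
apply: filterS nU => w Uw aw.
have Nle : local_grad_sqnorm w + 2 <= m * expR (- Af w).
  rewrite -(ler_pM2l (expR_gt0 (Af w))) mulrCA -expRD subrr expR0 mulr1; exact: aw.
have := dual_inequality (dphi w) (\row_a s a w) (h w) (Gp Uw).
rewrite -QE -/(local_grad_sqnorm w).
have -> : \sum_a (dphi w) 0 a * (\row_a s a w) 0 a = W w by apply: eq_bigr => a _; rewrite !mxE.
rewrite /Psi normsqE /q -rmorphM Re_add Re_add Re_opp -(rmorph_nat (real_complex R) 2) Re_scale.
move=> dual; apply: completed_bound Nle dual; exact: normsq_ge0.
Qed.

(** The trace of the Hessian of Psi at its maximum z0, with respect to an arbitrary
    metric H1. *)
Lemma test_function_inequality (H1 : 'M[R[i]]_n) : hermitian_posdef H1 ->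
  complex.Re (2 * trace_wrt H1 (\matrix_(k, l) (al 0 k * (s0 *m complex_hessian phi z0) 0 l
     + \sum_a s0 0 a * dz_dzbar (dz a (fun v => (phi v)%:C%C)) z0 k l
     + (sg k *m complex_hessian phi z0) 0 l))
   - trace_wrt H1 (\matrix_(k, l) (s0 *m curvature_form G z0 k l *m s0^t*) 0 0)
   + (2 * trace_wrt H1 (al^T *m conjmx al) +
      M%:C%C * trace_wrt H1 (complex_hessian Af z0))) <= 0.
Proof.
move=> Hp; have [Pr _] := Psis.
have := trace_hessian_local_max Uo Hp Pr Uz Psi_max.
rewrite (trace_hessian_Re Uo Hp Psis Uz); congr (complex.Re _ <= 0).
set Y := \matrix_(k, l) (_ + _ + _).
set C := \matrix_(k, l) (_ *m _ *m _) 0 0.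
have -> : \matrix_(k, l) dz_dzbar Psi z0 k l =
    2 *: Y - C + (2 *: (al^T *m conjmx al) + M%:C%C *: complex_hessian Af z0).
  apply/matrixP => k l; rewrite [LHS]mxE Psi_hess.
  have aE : (al^T *m conjmx al) k l = al 0 k * (al 0 l)^*%C.
    by rewrite [LHS]mxE big_ord1 [al^T k 0]mxE [(map_mx _ _) 0 l]mxE.
  have HE : complex_hessian Af z0 k l = dz_dzbar (fun w => (Af w)%:C%C) z0 k l.
    by rewrite [LHS]mxE.
  by rewrite comb_mxE aE HE [Y k l]mxE [C k l]mxE.
exact: trace_wrt_comb.
Qed.

End TestFunction.

(** * The estimate at a maximum, in a chart *)

Section LocalEstimate.
Context {R : realType} {n : nat}.
Local Notation "M ^t*" := (map_mx (@conjc R) (M^T)) (at level 30).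
Local Notation conjmx := (map_mx (@conjc R)).

Lemma trace_rank_one_real (G : 'M[R[i]]_n) (p : 'rV[R[i]]_n) : hermitian_posdef G ->
  trace_wrt G (p^T *m conjmx p) = (complex.Re (trace_wrt G (p^T *m conjmx p)))%:C%C.
Proof.
move=> Gp; have [P [mu [PG0 _ _]]] := frame_exists Gp Gp.
have -> : trace_wrt G (p^T *m conjmx p) = (\sum_m normsq (frame_coord P p m))%:C%C.
  rewrite (frame_trace0 PG0) rmorph_sum; apply: eq_bigr => m _.
  by rewrite frame_rank_one normsqE.
by [].
Qed.

Definition weight (lam : R) (phi F : coords R n -> R) (w : coords R n) : R :=
  - F w - lam * phi w + phi w * phi w / 2.

Variables (U : set (coords R n)) (G : coords R n -> 'M[R[i]]_n) (phi F : coords R n -> R).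
Hypotheses (Uo : open U) (Gs : forall a b, csmooth_on U (fun z => G z a b))
  (Gp : forall z, U z -> hermitian_posdef (G z)) (phis : smooth_on U phi) (Fs : smooth_on U F).

Lemma smooth_on_weight lam : smooth_on U (weight lam phi F).
Proof.
have c (x : R) := smooth_on_cst U x.
apply: smooth_onD => //; last first.
  by apply: smooth_onM => //; exact: smooth_onM.
apply: smooth_onD => //; first exact: smooth_onN.
by apply: smooth_onN => //; exact: smooth_onM.
Qed.

Variables (z0 : coords R n) (lam : R).
Hypothesis Uz : U z0.
Let phiC w := (phi w)%:C%C.
Let FC w := (F w)%:C%C.
Let phiCs : csmooth_on U phiC. Proof. exact: csmooth_on_real. Qed.
Let FCs : csmooth_on U FC. Proof. exact: csmooth_on_real. Qed.

Let weightE w : (weight lam phi F w)%:C%C =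
  (-1) * FC w + (- lam)%:C%C * phiC w + (2%:R^-1)%:C%C * (phiC w * phiC w).
Proof. by apply: complex_eq => /=; rewrite /weight; field. Qed.

Let t1s : csmooth_on U (fun w => (-1) * FC w).
Proof. by apply: csmooth_onM => //; exact: csmooth_on_cst. Qed.
Let t2s : csmooth_on U (fun w => (- lam)%:C%C * phiC w).
Proof. by apply: csmooth_onM => //; exact: csmooth_on_cst. Qed.
Let pps : csmooth_on U (fun w => phiC w * phiC w). Proof. exact: csmooth_onM. Qed.
Let t3s : csmooth_on U (fun w => (2%:R^-1)%:C%C * (phiC w * phiC w)).
Proof. by apply: csmooth_onM => //; exact: csmooth_on_cst. Qed.

Let half2 : (2%:R^-1 : R)%:C%C * 2 = 1.
Proof. by rewrite -(rmorph_nat (real_complex R) 2) -rmorphM mulVf. Qed.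

Lemma dz_weight k : dz k (fun w => (weight lam phi F w)%:C%C) z0 =
  (phi z0 - lam)%:C%C * dz k phiC z0 - dz k FC z0.
Proof.
rewrite (dz_eq Uo k (fun w _ => weightE w) Uz) dzE.
rewrite (wirtingerD Uz) //; last exact: csmooth_onD.
rewrite (wirtingerD Uz) // !(wirtingerZ Uz) // (wirtingerM Uz) // -!dzE.
have : phiC z0 = (phi z0)%:C%C by [].
have := half2; move: (dz k phiC z0) (dz k FC z0) (2^-1)%:C%C (phiC z0) => d e c x c2 ->.
rewrite rmorphB rmorphN mulN1r mulNr.
rewrite (_ : c * (d * (phi z0)%:C%C + (phi z0)%:C%C * d) = (c * 2) * ((phi z0)%:C%C * d));
  last by ring.
rewrite c2; ring.
Qed.

Lemma dz_dzbar_weight k l : dz_dzbar (fun w => (weight lam phi F w)%:C%C) z0 k l =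
  - dz_dzbar FC z0 k l + (phi z0 - lam)%:C%C * dz_dzbar phiC z0 k l +
    dz k phiC z0 * (dz l phiC z0)^*%C.
Proof.
rewrite (dz_dzbar_eq Uo k l (fun w _ => weightE w) Uz).
rewrite (dz_dzbarD Uo) //; last exact: csmooth_onD.
rewrite (dz_dzbarD Uo) // !(dz_dzbarZ Uo) // (dz_dzbarM Uo) // (dzbar_real l phis Uz).
have : phiC z0 = (phi z0)%:C%C by [].
have := half2; move: (dz k phiC z0) ((dz l _ z0)^*%C) (dz_dzbar _ _ _ _) (dz_dzbar _ _ _ _)
  (2^-1)%:C%C (phiC z0) => d e f g c x c2 ->.
rewrite rmorphB rmorphN mulN1r mulNr.
rewrite (_ : c * (f * (phi z0)%:C%C + e * d + (d * e + (phi z0)%:C%C * f)) =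
  (c * 2) * ((phi z0)%:C%C * f + d * e)); last by ring.
rewrite c2; ring.
Qed.

Let H1 z := G z + complex_hessian phi z.
Hypotheses (H1p : forall z, U z -> hermitian_posdef (H1 z))
  (vol : forall z, U z -> log_det (H1 z) = F z + log_det (G z))
  (kah : forall k c l, dz k (fun w => G w c l) z0 = dz c (fun w => G w k l) z0).

Lemma log_det_ratio : \det (H1 z0) = (expR (F z0))%:C%C * \det (G z0).
Proof.
have d1 := posdef_det_gt0 (H1p Uz); have d0 := posdef_det_gt0 (Gp Uz).
have E x : 0 < x -> x = (complex.Re x)%:C%C :> R[i] by move=> x0;
  rewrite RRe_real // ger0_real // ltW.
have r0 x : 0 < x :> R[i] -> 0 < complex.Re x by rewrite ltcE => /andP[].
rewrite (E _ d1) (E _ d0) -rmorphM; congr (_%:C%C).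
have := congr1 expR (vol Uz); rewrite expRD /log_det !lnK //; exact: r0.
Qed.

(** The volume equation, differentiated once. *)
Lemma dz_volume a :
  trace_wrt (H1 z0) (\matrix_(k, l) dz a (fun w => G w k l) z0 +
     \matrix_(k, l) dz_dzbar (dz a phiC) z0 k l) =
  dz a FC z0 + trace_wrt (G z0) (\matrix_(k, l) dz a (fun w => G w k l) z0).
Proof.
have hs k l : csmooth_on U (fun z => dz_dzbar phiC z k l).
  by apply: csmooth_on_dz => //; exact: csmooth_on_dzbar.
have H1E z k l : H1 z k l = G z k l + dz_dzbar phiC z k l by rewrite !mxE.
have H1s k l : csmooth_on U (fun z => H1 z k l).
  by apply: csmooth_on_eq (csmooth_onD Uo (Gs k l) (hs k l)) => // z _; rewrite H1E.
have ls := csmooth_on_real (smooth_on_log_det Uo Gs Gp).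
rewrite -(dz_log_det Uo Gs Gp a Uz) [dz a FC z0]dzE [X in _ = _ + X]dzE -(wirtingerD Uz) // -dzE.
have <- : dz a (fun w => (log_det (H1 w))%:C%C) z0 =
    dz a (fun w => FC w + (log_det (G w))%:C%C) z0.
  by apply: (dz_eq Uo) => // w Uw; rewrite vol // rmorphD.
rewrite (dz_log_det Uo H1s H1p a Uz); congr trace_wrt; apply/matrixP => k l.
apply/esym; rewrite [RHS]mxE [X in _ = X + _]mxE [X in _ = _ + X]mxE [LHS]mxE.
rewrite -(dz_dzbar_dz Uo a k l phiCs Uz) (dz_eq Uo a (fun w _ => H1E w k l) Uz) dzE.
by rewrite (wirtingerD Uz (- 'i%C) a (Gs k l) (hs k l)) -!dzE.
Qed.

Let Ric := - complex_hessian (fun w => log_det (G w)) z0.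

(** B bounds the geometry of g at z0; the constants depend on B, A, n and Rb only. *)
Lemma local_gradient_estimate (A B Rb : R) :
  let cR := (n * n)%:R * (B * B) in
  let c0 := (n * n)%:R * ((n * n)%:R * (B * ((n * n)%:R * B)) * B) in
  trace_wrt (H1 z0) (complex_hessian F z0) = - Rb%:C%C + trace_wrt (H1 z0) Ric ->
  0 <= B -> (forall k, complex.Re (invmx (G z0) k k) <= B) ->
  (forall k l, `|Ric k l| <= B%:C%C) ->
  (forall k l a b, `|curvature_form G z0 k l a b| <= B%:C%C) ->
  lam = A + cR + c0 + 1 -> `|phi z0| <= A ->
  (\forall w \near z0,
    expR (weight lam phi F w) * (local_grad_sqnorm G phi w + 2) <=
    expR (weight lam phi F z0) * (local_grad_sqnorm G phi z0 + 2)) ->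
  local_grad_sqnorm G phi z0 + 2 <=
    expR (F z0) * (4 * (1 + `|Rb| + (lam + A) * (n%:R + 2)) ^+ n.+1).
Proof.
move=> cR c0 lapl B0 GB RicB RmB lamE phA amax.
have Gp0 := Gp Uz; have H1p0 := H1p Uz.
have Gu := posdef_unit Gp0; have H1u := posdef_unit H1p0.
pose p := dphi phi z0; pose q : 'rV[R[i]]_n := \row_a dz a FC z0.
pose al : 'rV[R[i]]_n := \row_k dz k (fun w => (weight lam phi F w)%:C%C) z0.
pose s := conjmx p *m invmx (G z0).
pose Bk k : 'M[R[i]]_n := \matrix_(a, b) dz k (fun w => G w a b) z0.
pose L a : 'M[R[i]]_n := \matrix_(k, l) dz_dzbar (dz a phiC) z0 k l.
pose sg k := - (s *m Bk k *m invmx (G z0)).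
have HE : complex_hessian phi z0 = H1 z0 - G z0 by rewrite /H1 addrAC subrr add0r.
have sG : s *m G z0 = conjmx p by rewrite mulmxKV.
have BS k c l : Bk k c l = Bk c k l by rewrite [LHS]mxE [RHS]mxE; exact: kah.
have LE a : trace_wrt (H1 z0) (Bk a + L a) = q 0 a + trace_wrt (G z0) (Bk a).
  by rewrite dz_volume /q mxE.
have ZE := trace_holomorphic_part al Gu H1u sG BS (fun k => erefl (sg k)) LE.
have TF := test_function_inequality Uo Gs Gp phis (smooth_on_weight lam) Uz amax H1p0.
have tr3 (c1 c2 : R[i]) (Y1 Y2 Y3 : 'M[R[i]]_n) : 
   trace_wrt (H1 z0) (c1 *: Y1 + c2 *: Y2 + Y3) = 
   c1 * trace_wrt (H1 z0) Y1 + c2 * trace_wrt (H1 z0) Y2 + trace_wrt (H1 z0) Y3.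
  by rewrite !trace_wrtE !mulmxDr -!scalemxAr !linearD /= !linearZ.
have comb (c1 c2 : R[i]) (Y1 Y2 Y3 : 'M[R[i]]_n) k l :
   (c1 *: Y1 + c2 *: Y2 + Y3) k l = c1 * Y1 k l + c2 * Y2 k l + Y3 k l by rewrite !mxE.
apply: (@algebraic_gradient_estimate R n (G z0) (H1 z0) Ric (complex_hessian (weight lam phi F)
  z0)
  (curvature_form G z0) p q al s A B lam Rb (phi z0) (F z0)) => //.
- apply/rowP => a; rewrite [(q + al) 0 a]mxE [q 0 a]mxE [al 0 a]mxE dz_weight.
  by rewrite [(_ *: p) 0 a]mxE [p 0 a]mxE addrC subrK.
- have -> : complex_hessian (weight lam phi F) z0 = 
     (-1) *: complex_hessian F z0 + (phi z0 - lam)%:C%C *: (complex_hessian phi z0) +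
       p^T *m conjmx p.
    apply/matrixP => k l.
    have pE : (p^T *m conjmx p) k l = dz k phiC z0 * (dz l phiC z0)^*%C.
      by rewrite mxE big_ord1 !mxE.
    have hE u : complex_hessian u z0 k l = dz_dzbar (fun w => (u w)%:C%C) z0 k l by rewrite mxE.
    rewrite [RHS]comb.
    rewrite [LHS](hE (weight lam phi F)).
    rewrite dz_dzbar_weight.
    by congr (_ + _ + _); [rewrite [RHS]mulN1r; congr (- _); exact/esym/hE|congr (_ * _);
      exact/esym/hE|exact/esym].
  apply: etrans (tr3 _ _ _ _ _) _; congr (_ + _ * _ + _).
    by rewrite [X in _ * X]lapl; move: (trace_wrt (H1 z0) Ric) => t; ring.
  rewrite HE !trace_wrtE mulmxBr mulVmx // raddfB /=.
  by rewrite mxtrace1.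
- exact: log_det_ratio.
have EM : \matrix_(k, l) (al 0 k * (s *m complex_hessian phi z0) 0 l
      + \sum_a s 0 a * dz_dzbar (dz a phiC) z0 k l + (sg k *m complex_hessian phi z0) 0 l) =
    \matrix_(k, l) (al 0 k * (s *m (H1 z0 - G z0)) 0 l
      + \sum_a s 0 a * L a k l + (sg k *m (H1 z0 - G z0)) 0 l).
  rewrite -HE; apply/matrixP => k l; rewrite [LHS]mxE [RHS]mxE; congr (_ + _ + _).
  by apply: eq_bigr => a _; rewrite [L a k l]mxE.
set C := trace_wrt _ (\matrix_(k, l) (_ *m _ *m _) 0 0).
have : complex.Re (2 * trace_wrt (H1 z0) (\matrix_(k, l)
  (al 0 k * (s *m complex_hessian phi z0) 0 l
      + \sum_a s 0 a * dz_dzbar (dz a phiC) z0 k l + (sg k *m complex_hessian phi z0) 0 l))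
    - C + (2 * trace_wrt (H1 z0) (al^T *m conjmx al) + (local_grad_sqnorm G phi z0 + 2)%:C%C *
       trace_wrt (H1 z0) (complex_hessian (weight lam phi F) z0))) <= 0.
  refine TF.
rewrite EM ZE (trace_rank_one_real p Gp0) -/(local_grad_sqnorm G phi z0).
set Z := \sum_a _ - _.
move: Z C (trace_wrt _ (al^T *m conjmx al)) (trace_wrt _ (complex_hessian _ _)) => Z C t1 t2.
rewrite -(rmorph_nat (real_complex R) 2) -rmorphD !Re_add !Re_opp !Re_scale.
have -> : complex.Re Z^*%C = complex.Re Z by case: (Z).
by lra.
Qed.

End LocalEstimate.

(** * Change of charts *)

Section Charts.
Context {R : realType} {n : nat} {M : topologicalType}.
Local Notation conjmx := (map_mx (@conjc R)).
Variable X : complex_atlas R n M.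

Lemma chart_inv_continuous_at i z : chart_cod (X i) z -> {for z, continuous (chart_inv (X i))}.
Proof.
move=> Uz; have := @chart_inv_continuous _ _ _ (X i).
by rewrite continuous_open_subspace; [apply; rewrite inE|exact: chart_cod_open].
Qed.

Lemma chart_map_continuous_at i p : chart_dom (X i) p -> {for p, continuous (chart_map (X i))}.
Proof.
move=> Dp; have := @chart_map_continuous _ _ _ (X i).
by rewrite continuous_open_subspace; [apply; rewrite inE|exact: chart_dom_open].
Qed.

Lemma transition_dom_open i j : open (transition_dom (X i) (X j)).
Proof.
rewrite openE => z [Uz Dz]; rewrite /interior /=.
have H1 := open_nbhs_nbhs (conj (@chart_cod_open _ _ _ (X i)) Uz).
have H2 : \forall w \near z, chart_dom (X j) (chart_inv (X i) w).
  apply: (chart_inv_continuous_at Uz).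
  exact: (open_nbhs_nbhs (conj (@chart_dom_open _ _ _ (X j)) Dz)).
exact: filterI H1 H2.
Qed.

Lemma transition_cod i j z : transition_dom (X i) (X j) z -> chart_cod (X j) (transition (X i)
    (X j) z).
Proof. by move=> [_ Dz]; exact: chart_mapP. Qed.

Lemma local_expr_transition (f : M -> R) i j z : transition_dom (X i) (X j) z ->
  local_expr f i z = local_expr f j (transition (X i) (X j) z).
Proof. by move=> [_ Dz]; rewrite /local_expr /transition chart_mapK. Qed.

(** The real chain rule expresses the derivative through those of the real and
    imaginary parts x_c, y_c of the transition; as dz (x_c - i y_c) = 0 by
    holomorphy, both are multiples of the complex Jacobian. *)
Lemma dz_transition (f : M -> R) i j z a : smooth_fun X f -> transition_dom (X i) (X j) z ->
  dz a (fun w => (local_expr f i w)%:C%C) z =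
  \sum_c dz c (fun w => (local_expr f j w)%:C%C) (transition (X i) (X j) z) *
    complex_jacobian (transition (X i) (X j)) z c a.
Proof.
move=> fs Tz; set t := transition _ _; pose U := transition_dom (X i) (X j).
have Uo : open U by exact: transition_dom_open.
have Vo := @chart_cod_open _ _ _ (X j); have Vt := transition_cod Tz.
have th := transition_holomorphic i j.
have tl c : smooth_on U (fun w => t w 0 (lshift n c)) by have [[]] := th c.
have tr c : smooth_on U (fun w => t w 0 (rshift n c)) by have [[]] := th c.
have td k v : derivable (fun w => t w 0 k) z (delta_mx 0 v).
  by case: (splitP k) => c kc; [rewrite (_ : k = lshift n c)|rewrite (_ : k = rshift n c)];
    try exact: val_inj; [exact: smooth_on_derivable (tl c) Tz|exact: smooth_on_derivable (tr c)
      Tz].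
have fd := smooth_on_differentiable Vo (fs j) Vt.
pose dl c : R[i] := ('D_(delta_mx 0 (lshift n c)) (local_expr f j) (t z))%:C%C.
pose dr c : R[i] := ('D_(delta_mx 0 (rshift n c)) (local_expr f j) (t z))%:C%C.
pose xl c w := (t w 0 (lshift n c))%:C%C; pose xr c w := (t w 0 (rshift n c))%:C%C.
have cE k : cpartial k (fun w => (local_expr f i w)%:C%C) z =
   \sum_c (dl c * cpartial k (xl c) z + dr c * cpartial k (xr c) z).
  have E w : U w -> (local_expr f i w)%:C%C = ((local_expr f j \o t) w)%:C%C.
    by move=> Tw; rewrite (local_expr_transition f Tw).
  rewrite (cpartial_eq Uo k E Tz) cpartial_real;
    have [_ ->] := derive_comp_coords fd (fun m => td m k).
  rewrite big_split_ord rmorphD !rmorph_sum -big_split; apply: eq_bigr => c _.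
  by rewrite !rmorphM /= /xl /xr !cpartial_real.
have dE : dz a (fun w => (local_expr f i w)%:C%C) z =
  \sum_c (dl c * dz a (xl c) z + dr c * dz a (xr c) z).
  rewrite /dz !cE mulr_sumr -sumrB mulr_sumr; apply: eq_bigr => c _.
  move: (dl c) (dr c) (cpartial (lshift n a) (xl c) z) (cpartial (rshift n a) (xl c) z)
    (cpartial (lshift n a) (xr c) z) (cpartial (rshift n a) (xr c) z) => *; ring.
rewrite dE; apply: eq_bigr => c _; rewrite mxE.
have zE : (fun w => zcoord c (t w)) = fun w => xl c w + 'i%C * xr c w.
  by apply/funext => w; apply: complex_eq => /=; ring.
have zcE : (fun w => (zcoord c (t w))^*%C) = fun w => xl c w + (- 'i%C) * xr c w.
  by apply/funext => w; apply: complex_eq => /=; ring.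
have ls := csmooth_on_real (tl c); have rs := csmooth_on_real (tr c).
have [zs hol] := th c.
have J1 : dz a (fun w => zcoord c (t w)) z = dz a (xl c) z + 'i%C * dz a (xr c) z.
  rewrite zE dzE (wirtingerD Tz) // ?(wirtingerZ Tz) // -?dzE //.
  by apply: csmooth_onM => //; exact: csmooth_on_cst.
have J2 : 0 = dz a (xl c) z + (- 'i%C) * dz a (xr c) z.
  have := dz_conj Uo Tz a zs; rewrite hol // conjc0 => <-.
  rewrite zcE dzE (wirtingerD Tz) // ?(wirtingerZ Tz) // -?dzE //.
  by apply: csmooth_onM => //; exact: csmooth_on_cst.
have xlE : dz a (xl c) z = 'i%C * dz a (xr c) z.
  by apply/eqP; rewrite -subr_eq0 J2 mulNr.
have fjE : dz c (fun w => (local_expr f j w)%:C%C) (t z) = 2%:R^-1 * (dl c - 'i%C * dr c).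
  by rewrite /dz !cpartial_real.
rewrite J1 xlE fjE.
have ii : 'i%C * 'i%C = -1 :> R[i] by rewrite -expr2 sqr_i.
move: (dz a (xr c) z) (dl c) (dr c) => y d e.
transitivity (d * ('i%C * y) - ('i%C * 'i%C) * e * y); first by rewrite ii; ring.
by field.
Qed.

Variable g : kahler_metric X.

Lemma grad_sqnormE (f : M -> R) i z : smooth_fun X f -> chart_cod (X i) z ->
  grad_sqnorm g f i z = local_grad_sqnorm (kmetric g i) (local_expr f i) z.
Proof.
move=> fs Uz; rewrite /grad_sqnorm /local_grad_sqnorm /trace_wrt; congr complex.Re.
apply: eq_bigr => a _; apply: eq_bigr => b _; rewrite -mulrA; congr (_ * _).
by rewrite mxE big_ord1 !mxE (dzbar_real b (fs i) Uz).
Qed.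

(** The vectors dual to dphi in the two charts correspond under the Jacobian, and
    |grad phi|^2 is the value of dphi on its dual vector. *)
Lemma grad_sqnorm_transition (f : M -> R) i j z : smooth_fun X f ->
  transition_dom (X i) (X j) z ->
  grad_sqnorm g f i z = grad_sqnorm g f j (transition (X i) (X j) z).
Proof.
move=> fs Tz; have Vt := transition_cod Tz; have [Uz _] := Tz.
rewrite (grad_sqnormE fs Uz) (grad_sqnormE fs Vt); set t := transition _ _.
pose J := complex_jacobian t z.
pose p1 := dphi (local_expr f i) z; pose p2 := dphi (local_expr f j) (t z).
pose G1 := kmetric g i z; pose G2 := kmetric g j (t z).
have G1u : G1 \in unitmx by exact: posdef_unit (kmetric_posdef g Uz).
have G2u : G2 \in unitmx by exact: posdef_unit (kmetric_posdef g Vt).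
have pJ : p1 = p2 *m J.
  apply/rowP => a; rewrite !mxE (dz_transition a fs Tz); apply: eq_bigr => c _.
  by rewrite [p2 0 c]mxE.
have GJ : G1 = J^T *m G2 *m conjmx J.
  apply/matrixP => a b; rewrite [LHS](kmetric_tensor g Tz) [RHS]mxE exchange_big.
  apply: eq_bigr => d _ /=; rewrite [(J^T *m G2) a d]mxE mulr_suml; apply: eq_bigr => c _.
  by rewrite [J^T a c]mxE [(map_mx _ _) d b]mxE -/J -/G2 -/t mulrAC.
have Ju : conjmx J \in unitmx.
  by move: G1u; rewrite GJ !unitmx_mul => /andP[].
have N G (p : 'rV[R[i]]_n) : trace_wrt G (p^T *m conjmx p) = (conjmx p *m invmx G *m p^T) 0 0.
  by rewrite trace_wrtE mulmxA mxtrace_mulC mulmxA /mxtrace big_ord1.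
rewrite /local_grad_sqnorm -/p1 -/p2 -/G1 -/G2 !N.
have rJ : conjmx p1 *m invmx G1 *m J^T = conjmx p2 *m invmx G2.
  rewrite -[LHS](mulmxK G2u); congr (_ *m _).
  rewrite -[LHS](mulmxK Ju) -[RHS](mulmxK Ju); congr (_ *m _).
  have -> : conjmx p1 *m invmx G1 *m J^T *m G2 *m conjmx J = conjmx p1.
    by rewrite -!mulmxA (mulmxA J^T) -GJ mulVmx // mulmx1.
  by rewrite pJ map_mxM.
by rewrite {2}pJ trmx_mul mulmxA rJ.
Qed.

End Charts.

(** * Compactness and the global estimate *)

Section LocallyBounded.
Context {R : realType} {n : nat}.

Lemma csmooth_locally_bounded (U : set (coords R n)) (I : finType)
    (h : I -> coords R n -> R[i]) z :
  U z -> (forall m, csmooth_on U (h m)) ->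
  exists2 b : R, 0 <= b & \forall w \near z, forall m, `|h m w| <= b%:C%C.
Proof.
move=> Uz hs; pose c m : R := `|complex.Re (h m z)| + `|complex.Im (h m z)| + 2.
have c0 m : 0 <= c m by rewrite !addr_ge0.
exists (\sum_m c m); first exact: sumr_ge0.
have FF : Filter (nbhs z) by exact: nbhs_filter.
apply: (@filter_forall _ _ (fun m w => `|h m w| <= (\sum_m c m)%:C%C) (nbhs z) FF) => m.
have [hr hi] := hs m.
have := smooth_on_continuous hr Uz => /cvgrPdist_le/(_ 1 ltr01).
have := smooth_on_continuous hi Uz => /cvgrPdist_le/(_ 1 ltr01).
apply: filterS2 => w Hi Hr.
apply: (@le_trans _ _ (c m)%:C%C); last first.
  by rewrite lecR (bigD1 m) //= lerDl; exact: sumr_ge0.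
have hw : h m w = (complex.Re (h m w))%:C%C + 'i%C * (complex.Im (h m w))%:C%C by exact: complexE.
have nr (x : R) : `|x%:C%C : R[i]| = (`|x|)%:C%C.
  by rewrite normc_def /= expr0n addr0 sqrtr_sqr.
have ni : `|'i%C : R[i]| = 1.
  by rewrite normc_def /= expr0n add0r expr1n sqrtr1.
rewrite hw; apply: le_trans (ler_normD _ _) _; rewrite normrM ni mul1r !nr -rmorphD lecR.
have e1 (x y : R) : `|x - y| <= 1 -> `|y| <= `|x| + 1.
  move=> xy; rewrite -[y](subKr x); apply: le_trans (ler_normB _ _) _.
  by rewrite lerD2l.
by have := e1 _ _ Hi; have := e1 _ _ Hr; rewrite /c; lra.
Qed.

End LocallyBounded.

Section Compactness.
Context {R : realType} {n : nat} {M : topologicalType}.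
Variables (X : complex_atlas R n M) (g : kahler_metric X).
Hypothesis M_compact : compact [set: M].

Definition geometry_bounded_by i z (B : R) : Prop :=
  [/\ forall k, complex.Re (invmx (kmetric g i z) k k) <= B,
      forall k l, `|ricci g i z k l| <= B%:C%C &
      forall k l a b, `|curvature_form (kmetric g i) z k l a b| <= B%:C%C].

Lemma geometry_locally_bounded i z : chart_cod (X i) z ->
  exists2 b : R, 0 <= b & \forall w \near z, geometry_bounded_by i w b.
Proof.
move=> Uz; have Uo := @chart_cod_open _ _ _ (X i).
have Gs := kmetric_smooth g i; have Gp := @kmetric_posdef _ _ _ _ g i.
have ivs := csmooth_on_invmx Uo Gs Gp; have cs := csmooth_on_curvature Uo Gs Gp.
have lC := csmooth_on_real (smooth_on_log_det Uo Gs Gp).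
have rs (kl : 'I_n * 'I_n) : csmooth_on (chart_cod (X i)) (fun w => ricci g i w kl.1 kl.2).
  have H := csmooth_onN Uo (csmooth_on_dz Uo kl.1 (csmooth_on_dzbar Uo kl.2 lC)).
  by apply: (csmooth_on_eq Uo _ H) => w _; rewrite !mxE.
have [b1 b10 B1] := csmooth_locally_bounded (h :=
  fun (k : 'I_n) w => invmx (kmetric g i w) k k) Uz (fun k => ivs k k).
have [b2 b20 B2] := csmooth_locally_bounded (h :=
  fun kl : 'I_n * 'I_n => fun w => ricci g i w kl.1 kl.2) Uz rs.
have [b3 b30 B3] := csmooth_locally_bounded
  (h := fun q : ('I_n * 'I_n) * ('I_n * 'I_n) => fun w => curvature_form (kmetric g i)
    w q.1.1 q.1.2 q.2.1 q.2.2)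
  Uz (fun q => cs q.1.1 q.1.2 q.2.1 q.2.2).
exists (b1 + b2 + b3); first by rewrite !addr_ge0.
move: B1 B2 B3; apply: filterS3 => w B1 B2 B3; split.
- move=> k; apply: (@le_trans _ _ b1); last by lra.
  rewrite -lecR; apply: le_trans (B1 k); apply: le_trans (normc_ge_Re _).
  by rewrite lecR ler_norm.
- by move=> k l; apply: le_trans (B2 (k, l)) _; rewrite lecR; lra.
- by move=> k l a b; apply: le_trans (B3 ((k, l), (a, b))) _; rewrite lecR; lra.
Qed.

(** Around each point, one chart and one constant serve for a whole neighbourhood;
    compactness makes the constant uniform.  At each point the bound holds in some
    chart, which is enough to run the argument at the maximum. *)
Lemma geometry_bounded : exists2 B : R, 0 <= B &
  forall p : M, exists2 i, chart_dom (X i) p & geometry_bounded_by i (chart_map (X i) p) B.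
Proof.
pose P (B : R) (p : M) := exists2 i, chart_dom (X i) p & geometry_bounded_by i (chart_map (X i)
  p) B.
have : \forall B \near +oo, [set: M] `<=` P B.
  move/compact_near_coveringP: M_compact; apply => p _.
  have [i Dp] := chart_cover X p.
  have [b b0 near_b] := geometry_locally_bounded (chart_mapP Dp).
  have near_p : \forall q \near p, chart_dom (X i) q /\ geometry_bounded_by i (chart_map (X i)
    q) b.
    apply: filterI.
      exact: (open_nbhs_nbhs (conj (@chart_dom_open _ _ _ (X i)) Dp)).
    exact: (chart_map_continuous_at Dp near_b).
  exists ([set q | chart_dom (X i) q /\ geometry_bounded_by i (chart_map (X i) q)
    b], [set B | b <= B]).
    by split => //=; apply: nbhs_pinfty_ge; exact: num_real.
  move=> [q B] /= [[Dq [h1 h2 h3]] bB]; exists i => //; split.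
  - by move=> k; exact: le_trans (h1 k) bB.
  - by move=> k l; apply: le_trans (h2 k l) _; rewrite lecR.
  - by move=> k l a c; apply: le_trans (h3 k l a c) _; rewrite lecR.
move=> nB; have [B [B0 HB]] : exists B : R, 0 <= B /\ [set: M] `<=` P B.
  near (pinfty_nbhs R) => B; exists B; split; near: B => //.
  by apply: nbhs_pinfty_ge; exact: num_real.
by exists B => // p; exact: HB.
Unshelve. all: by end_near. Qed.

Lemma smooth_fun_continuous (f : M -> R) : smooth_fun X f -> continuous f.
Proof.
move=> fs p; have [i Dp] := chart_cover X p.
have lc := smooth_on_continuous (fs i) (chart_mapP Dp).
have : {for p, continuous (local_expr f i \o chart_map (X i))}.
  by apply: continuous_comp => //; exact: chart_map_continuous_at.
apply: near_eq_continuous_at.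
apply: filterS (open_nbhs_nbhs (conj (@chart_dom_open _ _ _ (X i)) Dp)) => q Dq.
by rewrite /= /local_expr chart_mapK.
Qed.

Lemma sup_norm_ge (f : M -> R) p : smooth_fun X f -> `|f p| <= sup_norm f.
Proof.
move=> fs; apply: ub_le_sup; last by exists p.
have : compact ((fun q => `|f q|) @` [set: M]).
  apply: continuous_compact => //; apply: continuous_subspaceT => q.
  by apply: continuous_comp; [exact: smooth_fun_continuous|exact: norm_continuous].
have ne : ((fun q => `|f q|) @` [set: M]) !=set0 by exists `|f p|; exists p.
by move/(compact_has_sup ne) => -[_].
Qed.

Definition grad_sqnorm_at (f : M -> R) (p : M) : R :=
  let i := projT1 (cid (chart_cover X p)) in grad_sqnorm g f i (chart_map (X i) p).

Lemma grad_sqnorm_atE (f : M -> R) p i : smooth_fun X f -> chart_dom (X i) p ->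
  grad_sqnorm g f i (chart_map (X i) p) = grad_sqnorm_at f p.
Proof.
move=> fs Dp; rewrite /grad_sqnorm_at; case: (cid _) => j Dj /=.
have T : transition_dom (X i) (X j) (chart_map (X i) p).
  by split; [exact: chart_mapP|rewrite chart_mapK].
by rewrite (grad_sqnorm_transition g fs T) /transition chart_mapK.
Qed.

Lemma smooth_on_grad_sqnorm (f : M -> R) i : smooth_fun X f ->
  smooth_on (chart_cod (X i)) (grad_sqnorm g f i).
Proof.
move=> fs; have Uo := @chart_cod_open _ _ _ (X i).
have fC := csmooth_on_real (fs i).
have ivs := csmooth_on_invmx Uo (kmetric_smooth g i) (@kmetric_posdef _ _ _ _ g i).
suff [] : csmooth_on (chart_cod (X i)) (fun z => \sum_(a < n) \sum_(b < n)
    ginv (kmetric g i z) a b * dz a (fun w => (local_expr f i w)%:C%C) z *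
    dzbar b (fun w => (local_expr f i w)%:C%C) z) by [].
apply: csmooth_on_sum => // a _; apply: csmooth_on_sum => // b _.
apply: csmooth_onM => //; last exact: csmooth_on_dzbar.
by apply: csmooth_onM => //; [exact: ivs|exact: csmooth_on_dz].
Qed.

Lemma compact_max (u : M -> R) (p : M) : continuous u -> exists q, forall r, u r <= u q.
Proof.
move=> uc; have [||q _ qm] := @compact_EVT_max M R u [set: M] _ M_compact.
- by exists p.
- exact: continuous_subspaceT.
by exists q => r; apply: qm; rewrite inE.
Qed.

Lemma weighted_gradient_continuous (phi F : M -> R) lam : smooth_fun X phi -> smooth_fun X F ->
  continuous (fun p => expR (- F p - lam * phi p + phi p * phi p / 2)
    * (grad_sqnorm_at phi p + 2)).
Proof.
move=> ps Fs p; have [i Dp] := chart_cover X p.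
have Uo := @chart_cod_open _ _ _ (X i).
pose v z := expR (weight lam (local_expr phi i) (local_expr F i) z) * (grad_sqnorm g phi i z + 2).
have vs : smooth_on (chart_cod (X i)) v.
  apply: smooth_onM => //.
    by move=> k; apply: Ck_on_expR => //; exact: (smooth_on_weight Uo (ps i) (Fs i) lam k).
  by apply: smooth_onD => //; [exact: smooth_on_grad_sqnorm|exact: smooth_on_cst].
have : {for p, continuous (v \o chart_map (X i))}.
  apply: continuous_comp; first exact: chart_map_continuous_at.
  exact: smooth_on_continuous vs (chart_mapP Dp).
apply: near_eq_continuous_at.
apply: filterS (open_nbhs_nbhs (conj (@chart_dom_open _ _ _ (X i)) Dp)) => q Dq.
by rewrite /= /v (grad_sqnorm_atE ps Dq) /weight /local_expr (chart_mapK Dq).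
Qed.

End Compactness.

Theorem theorem1p5 (R : realType) (n : nat) (M : topologicalType)
    (X : complex_atlas R n M) (g : kahler_metric X)
    (M_hausdorff : hausdorff_space M) (M_compact : compact [set: M])
    (A : R) (A_gt0 : 0 < A) :
  exists C : R, forall phi F : M -> R,
    csck_solution g phi F -> sup_norm phi <= A ->
    forall (p : M) (i : chart_index X), chart_dom (X i) p ->
      grad_sqnorm g phi i (chart_map (X i) p) / expR (F p) <= C.
Proof.
have [B B0 HB] := geometry_bounded g M_compact.
pose cR : R := (n * n)%:R * (B * B).
pose c0 : R := (n * n)%:R * ((n * n)%:R * (B * ((n * n)%:R * B)) * B).
pose lam := A + cR + c0 + 1; pose Rb := average_scalar_curvature g.
pose K := 4 * (1 + `|Rb| + (lam + A) * (n%:R + 2)) ^+ n.+1.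
exists (expR (lam * A + (lam * A + A * A / 2)) * K) => phi F sol phiA p i Dp.
have ps := csck_phi_smooth sol; have Fs := csck_F_smooth sol.
have pA q : `|phi q| <= A by apply: le_trans phiA; exact: (sup_norm_ge M_compact).
(* The function to which the maximum principle is applied. *)
pose u p := expR (- F p - lam * phi p + phi p * phi p / 2) * (grad_sqnorm_at g phi p + 2).
have [p0 p0max] := compact_max M_compact p (@weighted_gradient_continuous _ _ _ _ g phi F lam ps
  Fs).
have [j Dj [b1 b2 b3]] := HB p0.
pose z0 := chart_map (X j) p0; have Uz : chart_cod (X j) z0 := chart_mapP Dj.
have Uo := @chart_cod_open _ _ _ (X j).
have invz0 : chart_inv (X j) z0 = p0 by exact: chart_mapK.
have gE q z : chart_cod (X j) z -> chart_inv (X j) z = q ->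
    local_grad_sqnorm (kmetric g j) (local_expr phi j) z = grad_sqnorm_at g phi q.
  move=> Uz' zq; rewrite -(grad_sqnormE g ps Uz') -zq -(grad_sqnorm_atE g ps (chart_invP Uz')).
  by rewrite chart_invK.
have est : local_grad_sqnorm (kmetric g j) (local_expr phi j) z0 + 2 <=
  expR (local_expr F j z0) * K.
  apply: (@local_gradient_estimate R n (chart_cod (X j)) (kmetric g j) (local_expr phi j)
    (local_expr F j) Uo (kmetric_smooth g j) (@kmetric_posdef _ _ _ _ g j) (ps j) (Fs j)
    z0 lam Uz (@csck_posdef _ _ _ _ _ _ _ sol j) (@csck_volume _ _ _ _ _ _ _ sol j) _ A B Rb)
      => //.
  - by move=> k c l; exact: kmetric_closed.
  - exact: csck_laplacian.
  - exact: pA.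
  - apply: filterS (open_nbhs_nbhs (conj Uo Uz)) => w Uw.
    have := p0max (chart_inv (X j) w).
    by rewrite (gE _ w Uw erefl) (gE _ z0 Uz invz0) /weight /local_expr invz0.
rewrite (grad_sqnorm_atE g ps Dp) ler_pdivrMr ?expR_gt0 //.
rewrite (gE _ _ Uz invz0) /local_expr invz0 in est.
have cR0 : 0 <= cR by rewrite !mulr_ge0.
have c00 : 0 <= c0 by rewrite !mulr_ge0.
have lam0 : 0 <= lam by rewrite /lam; lra.
have K0 : 0 <= K.
  rewrite mulr_ge0 // exprn_ge0 // !addr_ge0 // mulr_ge0 ?addr_ge0 //; exact: ltW.
have wb (q : M) : - (lam * A) <= lam * phi q <= lam * A /\ 0 <= phi q * phi q / 2 <= A * A / 2.
  have := pA q; rewrite ler_norml => /andP[q1 q2]; split.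
    by rewrite -mulrN !ler_wpM2l.
  have s1 : 0 <= phi q * phi q by rewrite -expr2 sqr_ge0.
  have s2 : 0 <= (A - phi q) * (A + phi q) by apply: mulr_ge0; lra.
  by apply/andP; split; lra.
have [/andP[w1 w2] /andP[w3 w4]] := wb p.
have [/andP[v1 v2] /andP[v3 v4]] := wb p0.
set Np := grad_sqnorm_at g phi p; set N0 := grad_sqnorm_at g phi p0 in est *.
have H0 : u p0 <= expR (lam * A + A * A / 2) * K.
  apply: (le_trans (ler_wpM2l (expR_ge0 _) est)).
  rewrite mulrA -expRD ler_wpM2r // ler_expR; lra.
have Hp : Np + 2 <= expR (F p + lam * phi p - phi p * phi p / 2) * u p0.
  apply: le_trans (ler_wpM2l (expR_ge0 _) (p0max p)).
  rewrite mulrA -expRD -/Np (_ : _ + _ - _ + _ = 0) ?expR0 ?mul1r //; lra.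
apply: (@le_trans _ _ (Np + 2)); first by rewrite lerDl.
apply: (le_trans Hp); apply: (le_trans (ler_wpM2l (expR_ge0 _) H0)).
rewrite mulrA -expRD [X in _ <= X]mulrAC -expRD ler_wpM2r // ler_expR; lra.
Qed.
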